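(* For all real $t \geq 2$, $$\left|\zeta\left(\tfrac{1}{2} + it\right)\right| \leq 0.732\, t^{1/6} \log t.$$
   Context: $\zeta$ denotes the Riemann zeta-function and $\log$ the natural logarithm. *)

(* Defs.v *)
From Stdlib Require Import Reals.
Open Scope R_scope.

(* Partial sums (terms n = 1 .. N+1) of the Dirichlet eta series
   eta(s) = sum_{n>=1} (-1)^(n-1) n^(-s) at s = 1/2 + i t, where
   n^(-1/2 - i t) = n^(-1/2) (cos(t ln n) - i sin(t ln n)). *)
Definition eta_half_re (t : R) (N : nat) : R :=
  sum_f_R0 (fun k => (-1) ^ k / sqrt (INR (S k)) * cos (t * ln (INR (S k)))) N.

Definition eta_half_im (t : R) (N : nat) : R :=
  sum_f_R0 (fun k => - ((-1) ^ k / sqrt (INR (S k)) * sin (t * ln (INR (S k))))) N.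

(* 1 - 2^(1-s) at s = 1/2 + i t equals
   (1 - sqrt 2 cos(t ln 2)) + i (sqrt 2 sin(t ln 2)). *)
Definition eta_factor_abs (t : R) : R :=
  sqrt ((1 - sqrt 2 * cos (t * ln 2)) ^ 2 + (sqrt 2 * sin (t * ln 2)) ^ 2).

(* z = |zeta(1/2 + i t)|, using zeta(s) = eta(s) / (1 - 2^(1-s)), valid
   (as the analytic continuation) for Re s > 0, s <> 1. *)
Definition is_abs_zeta_half (t z : R) : Prop :=
  exists a b : R,
    Un_cv (eta_half_re t) a /\ Un_cv (eta_half_im t) b /\
    z = sqrt (a ^ 2 + b ^ 2) / eta_factor_abs t.

(* Main.v *)
(** The bound is proved in three ranges.  For [2 <= t <= 36], [zeta] is given by the
    Euler-Maclaurin formula of order five, with at most seven terms [n^(-s)] estimated trivially.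

    For larger [t], Poisson summation gives an approximate functional equation
    [|zeta| <= |sum_(n <= N) n^(-s)| + |sum_(n <= k) n^(-s)| + O(1)], with [k] the integer part of
    [t / (2 pi N)]: the frequencies beyond [k] have no stationary point, and those up to [k] are
    rescalings of a single improper integral [X], for which [|X| <= 1] follows from Bessel's
    inequality without evaluating a Gamma factor.  Both sums are estimated trivially as long as
    [t^(1/6) <= 31.6].

    Beyond that point, Weyl differencing and the Kusmin-Landau inequality bound the part of a sum
    over [A <= n <= 5 A / 4] by [0.489 t^(1/6)].  Such blocks cover the range from [5 t^(1/3)] to
    about [t^(1/2)], for a total of about [0.7316 t^(1/6) ln t] with a negative second order term. *)

Require Import Defs.
From Stdlib Require Import Reals Machin Lra Lia Psatz ZArith.
From Coquelicot Require Import Coquelicot.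
Open Scope R_scope.

(** * Mean value inequalities and complex-valued functions *)

(** Only the modulus is asked for. The value itself is pinned down by its Euler-Maclaurin remainder,
    which gives both the alternating series of the statement and the limit of the trapezoidal sums
    in Poisson summation.

    Estimates of integrals are mostly comparisons of derivatives, with an explicit primitive for the
    majorant. Complex integrals are handled through the real parts of all their rotations, which
    loses no constant.

    The origin of the constant: the two sums have lengths with product at most [t / (2 pi)], so the
    logarithms of their lengths add up to a fixed quantity. A block costs [0.489 t^(1/6)] wherever
    it lies and uses up 0.2228, slightly less than [ln (5/4)], of that quantity. The terms up to
    [5 t^(1/3)] cost only a multiple of [t^(1/6)] while removing [ln (5 t^(1/3))] from each
    logarithm, and this yields the saving of second order. *)

Lemma is_derive_cst (c x : R) : is_derive (fun _ : R => c) x 0.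
Proof. auto_derive; auto. Qed.

(** Plays the role of bounding an integral by the integral of a majorant: [h] is an explicit
    primitive of the majorant, so no integral is formed. Both [h + f] and [h - f] are
    nondecreasing. *)
Lemma MVT_abs_le (f h df dh : R -> R) (a b : R) :
  a <= b ->
  (forall x, a <= x <= b -> is_derive f x (df x)) ->
  (forall x, a <= x <= b -> is_derive h x (dh x)) ->
  (forall x, a <= x <= b -> Rabs (df x) <= dh x) ->
  Rabs (f b - f a) <= h b - h a.
Proof.
  intros ab Hf Hh Hle.
  assert (Hm : forall g dg : R -> R,
    (forall x, a <= x <= b -> is_derive g x (dg x)) ->
    (forall x, a <= x <= b -> 0 <= dg x) -> g a <= g b).
  { intros g dg Hg Hp.
    destruct (MVT_gen g a b dg) as [c [Hc E]].
    - intros x Hx; rewrite Rmin_left, Rmax_right in Hx by lra; apply Hg; lra.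
    - intros x Hx; rewrite Rmin_left, Rmax_right in Hx by lra.
      apply continuity_pt_filterlim, (ex_derive_continuous g x).
      exists (dg x); apply Hg; lra.
    - rewrite Rmin_left, Rmax_right in Hc by lra.
      specialize (Hp c Hc). nra. }
  apply Rabs_le; split.
  - assert (h a + f a <= h b + f b); [|lra].
    apply (Hm (fun x => h x + f x) (fun x => dh x + df x)).
    + intros x Hx; apply (is_derive_plus h f); auto.
    + intros x Hx; specialize (Hle x Hx); apply Rabs_le_between in Hle; lra.
  - assert (h a - f a <= h b - f b); [|lra].
    apply (Hm (fun x => h x - f x) (fun x => dh x - df x)).
    + intros x Hx; apply (is_derive_minus h f); auto.
    + intros x Hx; specialize (Hle x Hx); apply Rabs_le_between in Hle; lra.
Qed.

Lemma derive_nonneg_le (g dg : R -> R) (a b : R) :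
  a <= b ->
  (forall x, a <= x <= b -> is_derive g x (dg x)) ->
  (forall x, a <= x <= b -> 0 <= dg x) -> g a <= g b.
Proof.
  intros ab Hg Hp.
  assert (Rabs ((fun _ => 0) b - (fun _ => 0) a) <= g b - g a) as H.
  { apply (MVT_abs_le (fun _ => 0) g (fun _ => 0) dg); auto.
    - intros; apply is_derive_cst.
    - intros x Hx; rewrite Rabs_R0; auto. }
  generalize (Rabs_pos ((fun _ : R => 0) b - (fun _ : R => 0) a)); lra.
Qed.

Definition cis (x : R) : C := (cos x, sin x).

Lemma cis_add x y : cis (x + y) = Cmult (cis x) (cis y).
Proof. unfold cis, Cmult; simpl; rewrite cos_plus, sin_plus; f_equal; ring. Qed.

Lemma cis_0 : cis 0 = RtoC 1.
Proof. unfold cis; rewrite cos_0, sin_0; reflexivity. Qed.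

Lemma cis_opp x : cis (- x) = Cconj (cis x).
Proof. unfold cis, Cconj; simpl; rewrite cos_neg, sin_neg; reflexivity. Qed.

Lemma Cmod_cis x : Cmod (cis x) = 1.
Proof.
  unfold Cmod, cis; simpl fst; simpl snd.
  replace (cos x ^ 2 + sin x ^ 2) with 1; [apply sqrt_1|].
  generalize (sin2_cos2 x); unfold Rsqr; lra.
Qed.

Lemma polar (z : C) : exists p, z = Cmult (Cmod z) (cis p).
Proof.
  destruct (Req_dec (Cmod z) 0) as [H0|H0].
  - exists 0. rewrite H0. apply Cmod_eq_0 in H0. rewrite H0. ring.
  - assert (Hp : 0 < Cmod z) by (generalize (Cmod_ge_0 z); lra).
    assert (E2 : (Re z / Cmod z) * (Re z / Cmod z) + (Im z / Cmod z) * (Im z / Cmod z) = 1).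
    { transitivity ((Re z ^ 2 + Im z ^ 2) / Cmod z ^ 2); [field; lra|].
      rewrite <- Cmod2_alt; field; lra. }
    assert (B : -1 <= Re z / Cmod z <= 1) by (split; nra).
    assert (Hcos : cos (acos (Re z / Cmod z)) = Re z / Cmod z) by (apply cos_acos; lra).
    assert (Hsin : sin (acos (Re z / Cmod z)) = Rabs (Im z / Cmod z)).
    { rewrite sin_acos by lra.
      rewrite <- sqrt_Rsqr_abs. f_equal. unfold Rsqr in *. lra. }
    destruct (Rle_dec 0 (Im z / Cmod z)) as [Hs|Hs].
    + exists (acos (Re z / Cmod z)). unfold cis.
      rewrite Hcos, Hsin, Rabs_pos_eq by lra.
      apply injective_projections; unfold Re, Im; simpl; field; lra.
    + exists (- acos (Re z / Cmod z)). unfold cis.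
      rewrite cos_neg, sin_neg, Hcos, Hsin, Rabs_left by lra.
      apply injective_projections; unfold Re, Im; simpl; field; lra.
Qed.

Lemma Re_rot_le (z : C) p : Re (Cmult (cis p) z) <= Cmod z.
Proof.
  eapply Rle_trans; [apply Rle_abs|].
  eapply Rle_trans; [apply re_le_Cmod|].
  rewrite Cmod_mult, Cmod_cis; lra.
Qed.

(* A modulus is the supremum of the real parts of the rotations. *)
Lemma Cmod_le_rot (z : C) (B : R) :
  (forall p, Re (Cmult (cis p) z) <= B) -> Cmod z <= B.
Proof.
  intros H. destruct (polar z) as [p E].
  specialize (H (- p)). rewrite E in H at 1.
  replace (Cmult (cis (- p)) (Cmult (Cmod z) (cis p))) with (RtoC (Cmod z)) in H; [exact H|].
  transitivity (Cmult (Cmod z) (cis (- p + p))); [|rewrite cis_add; ring].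
  replace (- p + p) with 0 by ring. rewrite cis_0; ring.
Qed.

Lemma is_derive_multR (f g : R -> R) (x df dg : R) :
  is_derive f x df -> is_derive g x dg -> is_derive (fun u => f u * g u) x (df * g x + f x * dg).
Proof. intros A B. exact (is_derive_mult f g x df dg A B Rmult_comm). Qed.

Lemma is_derive_plusR (f g : R -> R) (x df dg : R) :
  is_derive f x df -> is_derive g x dg -> is_derive (fun u => f u + g u) x (df + dg).
Proof. intros A B. exact (is_derive_plus f g x df dg A B). Qed.

Lemma is_derive_minusR (f g : R -> R) (x df dg : R) :
  is_derive f x df -> is_derive g x dg -> is_derive (fun u => f u - g u) x (df - dg).
Proof. intros A B. exact (is_derive_minus f g x df dg A B). Qed.

Lemma is_derive_eqR (f : R -> R) (x a b : R) : is_derive f x a -> a = b -> is_derive f x b.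
Proof. intros H <-; exact H. Qed.

Definition cderiv (F : R -> C) (x : R) (F' : C) : Prop :=
  is_derive (fun u => Re (F u)) x (Re F') /\ is_derive (fun u => Im (F u)) x (Im F').

Lemma cderiv_plus F G x F' G' :
  cderiv F x F' -> cderiv G x G' -> cderiv (fun u => Cplus (F u) (G u)) x (Cplus F' G').
Proof.
  intros [A B] [A' B']; split.
  - exact (is_derive_plusR _ _ _ _ _ A A').
  - exact (is_derive_plusR _ _ _ _ _ B B').
Qed.

Lemma cderiv_const c x : cderiv (fun _ => c) x (RtoC 0).
Proof. split; apply is_derive_cst. Qed.

Lemma cderiv_real (f : R -> R) (x f' : R) : is_derive f x f' -> cderiv (fun u => RtoC (f u)) x (RtoC f').
Proof. intros H; split; [exact H|exact (is_derive_cst 0 x)]. Qed.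

Lemma cderiv_mult F G x F' G' :
  cderiv F x F' -> cderiv G x G' ->
  cderiv (fun u => Cmult (F u) (G u)) x (Cplus (Cmult F' (G x)) (Cmult (F x) G')).
Proof.
  intros [A B] [A' B']; split.
  - refine (is_derive_eqR _ _ _ _ (is_derive_minusR _ _ _ _ _
      (is_derive_multR _ _ _ _ _ A A') (is_derive_multR _ _ _ _ _ B B')) _).
    unfold Re, Im; simpl; ring.
  - refine (is_derive_eqR _ _ _ _ (is_derive_plusR _ _ _ _ _
      (is_derive_multR _ _ _ _ _ A B') (is_derive_multR _ _ _ _ _ B A')) _).
    unfold Re, Im; simpl; ring.
Qed.

Lemma cderiv_eq F x F' G' : cderiv F x F' -> F' = G' -> cderiv F x G'.
Proof. intros H <-; exact H. Qed.

(** Each rotation [Re (cis p * F)] satisfies the real inequality, and the supremum over [p] is the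
    modulus; treating the two components separately would lose a factor. *)
Lemma cMVT (F F' : R -> C) (h dh : R -> R) (a b : R) :
  a <= b ->
  (forall x, a <= x <= b -> cderiv F x (F' x)) ->
  (forall x, a <= x <= b -> is_derive h x (dh x)) ->
  (forall x, a <= x <= b -> Cmod (F' x) <= dh x) ->
  Cmod (Cminus (F b) (F a)) <= h b - h a.
Proof.
  intros ab HF Hh Hle.
  apply Cmod_le_rot; intros p.
  assert (K : Rabs (Re (Cmult (cis p) (F b)) - Re (Cmult (cis p) (F a))) <= h b - h a).
  { apply (MVT_abs_le (fun u => Re (Cmult (cis p) (F u))) h
            (fun u => Re (Cmult (cis p) (F' u))) dh); auto.
    - intros x Hx.
      destruct (cderiv_mult (fun _ => cis p) F x _ _ (cderiv_const (cis p) x) (HF x Hx)) as [A _].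
      refine (is_derive_eqR _ _ _ _ A _). f_equal. ring.
    - intros x Hx. eapply Rle_trans; [apply re_le_Cmod|].
      rewrite Cmod_mult, Cmod_cis, Rmult_1_l; auto. }
  apply Rabs_le_between in K.
  replace (Re (Cmult (cis p) (Cminus (F b) (F a))))
    with (Re (Cmult (cis p) (F b)) - Re (Cmult (cis p) (F a))); [lra|].
  unfold Re, Im; simpl; ring.
Qed.

(** * Finite sums of real and complex numbers, and the powers [u^(-s)] *)

Fixpoint csum (f : nat -> C) (n : nat) : C :=
  match n with O => RtoC 0 | S m => Cplus (csum f m) (f m) end.

Fixpoint rsum (f : nat -> R) (n : nat) : R :=
  match n with O => 0 | S m => rsum f m + f m end.

Lemma csum_S f n : csum f (S n) = Cplus (csum f n) (f n).
Proof. reflexivity. Qed.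

Lemma rsum_S f n : rsum f (S n) = rsum f n + f n.
Proof. reflexivity. Qed.

Lemma csum_ext f g n : (forall k, (k < n)%nat -> f k = g k) -> csum f n = csum g n.
Proof.
  induction n as [|n IH]; intros H; [reflexivity|].
  simpl; rewrite IH, H; [reflexivity|lia|intros; apply H; lia].
Qed.

Lemma rsum_ext f g n : (forall k, (k < n)%nat -> f k = g k) -> rsum f n = rsum g n.
Proof.
  induction n as [|n IH]; intros H; [reflexivity|].
  simpl; rewrite IH, H; [reflexivity|lia|intros; apply H; lia].
Qed.

Lemma csum_plus f g n : csum (fun k => Cplus (f k) (g k)) n = Cplus (csum f n) (csum g n).
Proof. induction n as [|n IH]; simpl; [ring|rewrite IH; ring]. Qed.

Lemma rsum_mult_l c f n : rsum (fun k => c * f k) n = c * rsum f n.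
Proof. induction n as [|n IH]; simpl; [ring|rewrite IH; ring]. Qed.

Lemma rsum_plus f g n : rsum (fun k => f k + g k) n = rsum f n + rsum g n.
Proof. induction n as [|n IH]; simpl; [ring|rewrite IH; ring]. Qed.

Lemma rsum_minus f g n : rsum (fun k => f k - g k) n = rsum f n - rsum g n.
Proof. induction n as [|n IH]; simpl; [ring|rewrite IH; ring]. Qed.

Lemma rsum_const c n : rsum (fun _ => c) n = INR n * c.
Proof. induction n as [|n IH]; [simpl; ring|]. simpl rsum; rewrite IH, S_INR; ring. Qed.

Lemma csum_app f m n : csum f (m + n) = Cplus (csum f m) (csum (fun k => f (m + k)%nat) n).
Proof.
  induction n as [|n IH]; [rewrite Nat.add_0_r; simpl; ring|].
  rewrite Nat.add_succ_r; simpl; rewrite IH; ring.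
Qed.

Lemma rsum_app f m n : rsum f (m + n) = rsum f m + rsum (fun k => f (m + k)%nat) n.
Proof.
  induction n as [|n IH]; [rewrite Nat.add_0_r; simpl; ring|].
  rewrite Nat.add_succ_r; simpl; rewrite IH; ring.
Qed.

Lemma rsum_le f g n : (forall k, (k < n)%nat -> f k <= g k) -> rsum f n <= rsum g n.
Proof.
  induction n as [|n IH]; intros H; simpl; [lra|].
  apply Rplus_le_compat; [apply IH; intros; apply H; lia|apply H; lia].
Qed.

Lemma rsum_nonneg f n : (forall k, (k < n)%nat -> 0 <= f k) -> 0 <= rsum f n.
Proof.
  induction n as [|n IH]; intros H; simpl; [lra|].
  assert (0 <= rsum f n) by (apply IH; intros; apply H; lia).
  assert (0 <= f n) by (apply H; lia). lra.
Qed.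

Lemma Cmod_csum f n : Cmod (csum f n) <= rsum (fun k => Cmod (f k)) n.
Proof.
  induction n as [|n IH]; simpl; [rewrite Cmod_0; lra|].
  eapply Rle_trans; [apply Cmod_triangle|]. lra.
Qed.

Lemma Re_csum f n : Re (csum f n) = rsum (fun k => Re (f k)) n.
Proof. induction n as [|n IH]; simpl; [reflexivity|rewrite <- IH; reflexivity]. Qed.

Lemma Cmod_minus_le x y : Cmod (Cminus x y) <= Cmod x + Cmod y.
Proof.
  unfold Cminus; eapply Rle_trans; [apply Cmod_triangle|]. rewrite Cmod_opp; lra.
Qed.

(* The conjugate of [zeta (1/2 + it)] is studied throughout, to avoid minus signs
   in the phases: [pw t u] is [u^(-s)] with [s = 1/2 - it]. *)
Definition pw (t u : R) : C := Cmult (RtoC (/ sqrt u)) (cis (t * ln u)).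

Lemma Cmod_pw t u : 0 < u -> Cmod (pw t u) = / sqrt u.
Proof.
  intros Hu; unfold pw; rewrite Cmod_mult, Cmod_cis, Cmod_R, Rmult_1_r.
  apply Rabs_pos_eq, Rlt_le, Rinv_0_lt_compat, sqrt_lt_R0, Hu.
Qed.

Lemma pw_mult t u v : 0 < u -> 0 < v -> pw t (u * v) = Cmult (pw t u) (pw t v).
Proof.
  intros Hu Hv; unfold pw.
  rewrite ln_mult, sqrt_mult, Rmult_plus_distr_l, cis_add, Rinv_mult, RtoC_mult by lra.
  ring.
Qed.

Lemma cderiv_pw t u : 0 < u ->
  cderiv (pw t) u (Cmult (Cmult (- (1 / 2), t) (RtoC (/ u))) (pw t u)).
Proof.
  intros Hu. assert (Hs : 0 < sqrt u) by (apply sqrt_lt_R0, Hu).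
  assert (Eq : u = sqrt u * sqrt u) by (rewrite sqrt_sqrt; lra).
  split.
  - apply (is_derive_ext (fun v => / sqrt v * cos (t * ln v))).
    { intros v; unfold pw, cis, Re; simpl; ring. }
    auto_derive; [repeat split; lra|].
    unfold pw, cis, Re, Im; simpl.
    assert (E3 : / (sqrt u * sqrt u) = / u) by (rewrite <- Eq; reflexivity).
    rewrite E3. field; lra.
  - apply (is_derive_ext (fun v => / sqrt v * sin (t * ln v))).
    { intros v; unfold pw, cis, Im; simpl; ring. }
    auto_derive; [repeat split; lra|].
    unfold pw, cis, Re, Im; simpl.
    assert (E3 : / (sqrt u * sqrt u) = / u) by (rewrite <- Eq; reflexivity).
    rewrite E3. field; lra.
Qed.

Definition Dsum (t : R) (n : nat) : C := csum (fun k => pw t (INR (S k))) n.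

(** * Euler-Maclaurin summation *)

Definition Ccv (a : nat -> C) (l : C) : Prop :=
  forall e, 0 < e -> exists N, forall n, (N <= n)%nat -> Cmod (Cminus (a n) l) < e.

Lemma Ccv_cauchy (a : nat -> C) (h : nat -> R) :
  (forall n k, Cmod (Cminus (a (n + k)%nat) (a n)) <= h n) ->
  Un_cv h 0 ->
  exists l, Ccv a l /\ forall n, Cmod (Cminus l (a n)) <= h n.
Proof.
  intros Hk Hh.
  assert (Hc : forall P : C -> R, (forall x y, Rabs (P x - P y) <= Cmod (Cminus x y)) ->
     Cauchy_crit (fun n => P (a n))).
  { intros P HP e He. destruct (Hh e He) as [N HN]. exists N.
    assert (Hone : forall n k, (N <= n)%nat -> R_dist (P (a (n + k)%nat)) (P (a n)) < e).
    { intros n k Hn. unfold R_dist. eapply Rle_lt_trans; [apply HP|].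
      eapply Rle_lt_trans; [apply Hk|]. specialize (HN n Hn). unfold R_dist in HN.
      apply Rabs_def2 in HN. lra. }
    intros n m Hn Hm. destruct (Nat.le_ge_cases n m) as [H|H].
    - rewrite R_dist_sym. replace m with (n + (m - n))%nat by lia. apply Hone; lia.
    - replace n with (m + (n - m))%nat by lia. apply Hone; lia. }
  destruct (Rcomplete.R_complete _ (Hc (fun z => Re z) ltac:(intros x y; apply (re_le_Cmod (Cminus x y))))) as [lr Hlr].
  assert (him : forall x y : C, Rabs (Im x - Im y) <= Cmod (Cminus x y)).
  { intros x y. eapply Rle_trans; [|apply Rmax_Cmod]. apply Rmax_r. }
  destruct (Rcomplete.R_complete _ (Hc (fun z => Im z) him)) as [li Hli].
  assert (Hcv : Ccv a (lr, li)).
  { intros e He. destruct (Hlr (e / 2)) as [N1 H1]; [lra|].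
    destruct (Hli (e / 2)) as [N2 H2]; [lra|].
    exists (N1 + N2)%nat; intros n Hn.
    specialize (H1 n ltac:(lia)); specialize (H2 n ltac:(lia)); unfold R_dist in *.
    replace (Cminus (a n) (lr, li)) with
      (Cplus (RtoC (Re (a n) - lr)) (Cmult (0, 1) (RtoC (Im (a n) - li)))).
    2:{ apply injective_projections; unfold Re, Im; simpl; ring. }
    eapply Rle_lt_trans; [apply Cmod_triangle|].
    rewrite Cmod_mult, !Cmod_R. replace (Cmod (0, 1)) with 1; [lra|].
    symmetry; exact Cmod_Ci. }
  exists (lr, li); split; [exact Hcv|].
  intros n. apply Rnot_lt_le; intros Hlt.
  destruct (Hcv (Cmod (Cminus (lr, li) (a n)) - h n)) as [N HN]; [lra|].
  specialize (HN (n + N)%nat ltac:(lia)). specialize (Hk n N).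
  assert (Cmod (Cminus (lr, li) (a n)) <=
    Cmod (Cminus (a (n + N)%nat) (lr, li)) + Cmod (Cminus (a (n + N)%nat) (a n))); [|lra].
  replace (Cminus (lr, li) (a n)) with
    (Cminus (Cminus (a (n + N)%nat) (a n)) (Cminus (a (n + N)%nat) (lr, li))) by ring.
  rewrite Rplus_comm; apply Cmod_minus_le.
Qed.

(** The increments of [a] are dominated by the decrements of [h], so [h n] is at once a Cauchy
    modulus and the bound of the error at [n]. With [h] the Euler-Maclaurin remainder this
    constructs the zeta value. *)
Lemma Ccv_telescope (a : nat -> C) (h : nat -> R) :
  (forall n, Cmod (Cminus (a (S n)) (a n)) <= h n - h (S n)) ->
  Un_cv h 0 ->
  exists l, Ccv a l /\ forall n, Cmod (Cminus l (a n)) <= h n.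
Proof.
  intros Hd Hh.
  assert (Hk : forall n k, Cmod (Cminus (a (n + k)%nat) (a n)) <= h n - h (n + k)%nat).
  { intros n k; induction k as [|k IH].
    - rewrite Nat.add_0_r. replace (Cminus (a n) (a n)) with (RtoC 0) by ring. rewrite Cmod_0; lra.
    - rewrite Nat.add_succ_r.
      replace (Cminus (a (S (n + k))) (a n)) with
        (Cplus (Cminus (a (S (n + k))) (a (n + k)%nat)) (Cminus (a (n + k)%nat) (a n))) by ring.
      eapply Rle_trans; [apply Cmod_triangle|]. specialize (Hd (n + k)%nat). lra. }
  assert (Hpos : forall n, 0 <= h n).
  { intros n. apply Rnot_lt_le; intros Hn.
    destruct (Hh (- h n)) as [N HN]; [lra|].
    specialize (HN (n + N)%nat ltac:(lia)). specialize (Hk n N).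
    generalize (Cmod_ge_0 (Cminus (a (n + N)%nat) (a n))); intros.
    unfold R_dist in HN. apply Rabs_def2 in HN. lra. }
  apply Ccv_cauchy; [|exact Hh].
  intros n k. specialize (Hk n k). specialize (Hpos (n + k)%nat). lra.
Qed.

(** The point [s = 1/2 - it] that goes with [pw]. The products [poch5] and [poch3] are the rising
    factorials of [s] produced by repeated differentiation of [u^(-s)]. *)
Definition sc (t : R) : C := (1 / 2, - t).
Definition poch5 (t : R) : C :=
  Cmult (sc t) (Cmult (Cplus (sc t) (RtoC 1)) (Cmult (Cplus (sc t) (RtoC 2))
    (Cmult (Cplus (sc t) (RtoC 3)) (Cplus (sc t) (RtoC 4))))).
Definition poch3 (t : R) : C :=
  Cmult (sc t) (Cmult (Cplus (sc t) (RtoC 1)) (Cplus (sc t) (RtoC 2))).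

(* [ber_j] is the Bernoulli polynomial [B_j / j!]. *)
Definition ber1 (v : R) := v - 1 / 2.
Definition ber2 (v : R) := v ^ 2 / 2 - v / 2 + 1 / 12.
Definition ber3 (v : R) := v ^ 3 / 6 - v ^ 2 / 4 + v / 12.
Definition ber4 (v : R) := v ^ 4 / 24 - v ^ 3 / 12 + v ^ 2 / 24 - 1 / 720.
Definition ber5 (v : R) := v ^ 5 / 120 - v ^ 4 / 48 + v ^ 3 / 72 - v / 720.

(** Centred at [w = v - 1/2] the polynomial is odd and factors as
    [w (1/4 - w^2) (7/12 - w^2) / 120], so it suffices to treat [0 <= w <= 1/2]. *)
Lemma ber5_bound v : 0 <= v <= 1 -> Rabs (ber5 v) <= 246 / 1200000.
Proof.
  intros Hv.
  assert (K : forall w, 0 <= w <= 1 / 2 -> 0 <= w * (1 / 4 - w ^ 2) * (7 / 12 - w ^ 2) <= 246 / 10000).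
  { intros w Hw; split.
    - apply Rmult_le_pos; [apply Rmult_le_pos|]; nra.
    - (* Division by the square of [w - 0.26], close to the double root at the maximum. *)
      assert (H1 : 0 <= (w - 26 / 100) ^ 2) by apply pow2_ge_0.
      assert (Hw2 : 0 <= w * w <= w / 2) by nra.
      assert (Hw3 : 0 <= w * (w * w) <= w / 4) by nra.
      assert (H2 : 0 <= - w ^ 3 - 13 / 25 * w ^ 2 + 4729 / 7500 * w + 17017 / 46875) by (simpl; lra).
      generalize (Rmult_le_pos _ _ H1 H2); intros H3.
      apply Rle_trans with (246 / 10000 - (w - 26 / 100) ^ 2 *
        (- w ^ 3 - 13 / 25 * w ^ 2 + 4729 / 7500 * w + 17017 / 46875)); [|lra].
      apply Rminus_le. ring_simplify. lra. }
  set (w := v - 1 / 2).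
  assert (E : ber5 v = w * (1 / 4 - w ^ 2) * (7 / 12 - w ^ 2) / 120) by (unfold ber5, w; field).
  rewrite E. destruct (Rle_dec 0 w) as [H|H].
  - specialize (K w ltac:(unfold w in *; lra)). apply Rabs_le; lra.
  - specialize (K (- w) ltac:(unfold w in *; lra)).
    replace (- w * (1 / 4 - (- w) ^ 2) * (7 / 12 - (- w) ^ 2))
      with (- (w * (1 / 4 - w ^ 2) * (7 / 12 - w ^ 2))) in K by ring.
    apply Rabs_le; lra.
Qed.

(** Boundary terms of the expansion, divided by [u^(-s)]: the primitive [-u / (1 - s)] and the terms
    with [B_2 / 2! = 1/12] and [B_4 / 4! = -1/720]. Because [B_3] and [B_5] vanish, the fifth order
    formula has no further ones; the term of [B_1] is the halved last summand in [A5]. *)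
Definition EMmain (t u : R) : C :=
  Cplus (Cmult (RtoC (- u)) (Cinv (Cminus (RtoC 1) (sc t))))
    (Cplus (Cmult (RtoC (/ (12 * u))) (sc t))
      (Cmult (RtoC (- / (720 * u ^ 3))) (poch3 t))).

Definition A5 (t : R) (n : nat) : C :=
  Cplus (Cminus (Dsum t n) (Cmult (RtoC (1 / 2)) (pw t (INR n))))
    (Cmult (pw t (INR n)) (EMmain t (INR n))).

(* [pw t u * Gfun t x u] is the Euler-Maclaurin expansion on [x, x+1]; its derivative
   telescopes to the single term [cderiv_EM] because [ber_(j+1)' = ber_j]. *)
Definition Gfun (t x u : R) : C :=
  Cplus (Cmult (RtoC (- u)) (Cinv (Cminus (RtoC 1) (sc t))))
  (Cplus (RtoC (ber1 (u - x)))
  (Cplus (Cmult (RtoC (ber2 (u - x) / u)) (sc t))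
  (Cplus (Cmult (RtoC (ber3 (u - x) / u ^ 2)) (Cmult (sc t) (Cplus (sc t) (RtoC 1))))
  (Cplus (Cmult (RtoC (ber4 (u - x) / u ^ 3)) (poch3 t))
         (Cmult (RtoC (ber5 (u - x) / u ^ 4)) (Cmult (poch3 t) (Cplus (sc t) (RtoC 3)))))))).

Lemma one_minus_sc_neq_0 t : Cminus (RtoC 1) (sc t) <> RtoC 0.
Proof. intros H; apply (f_equal fst) in H; unfold sc in H; simpl in H; lra. Qed.

Lemma cderiv_scal (g : R -> R) (c : C) (x g' : R) :
  is_derive g x g' -> cderiv (fun u => Cmult (RtoC (g u)) c) x (Cmult (RtoC g') c).
Proof.
  intros H.
  refine (cderiv_eq _ _ _ _ (cderiv_mult _ _ _ _ _ (cderiv_real _ _ _ H) (cderiv_const c x)) _).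
  ring.
Qed.

Lemma cderiv_EM t x u : 0 < u ->
  cderiv (fun u => Cmult (pw t u) (Gfun t x u)) u
    (Cmult (RtoC (- (ber5 (u - x) / u ^ 5))) (Cmult (poch5 t) (pw t u))).
Proof.
  intros Hu.
  assert (D1 : is_derive (fun v => ber1 (v - x)) u 1) by (unfold ber1; auto_derive; [auto|ring]).
  assert (D2 : is_derive (fun v => ber2 (v - x) / v) u
     (ber1 (u - x) * / u - ber2 (u - x) * (/ u * / u))).
  { unfold ber1, ber2; auto_derive; [lra|field; lra]. }
  assert (D3 : is_derive (fun v => ber3 (v - x) / v ^ 2) u
     (ber2 (u - x) * (/ u * / u) - 2 * ber3 (u - x) * (/ u * / u * / u))).
  { unfold ber2, ber3; auto_derive; [repeat apply Rmult_integral_contrapositive_currified; lra|field; lra]. }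
  assert (Hn : u * (u * (u * 1)) <> 0) by (repeat apply Rmult_integral_contrapositive_currified; lra).
  assert (Hn4 : u * (u * (u * (u * 1))) <> 0) by (repeat apply Rmult_integral_contrapositive_currified; lra).
  assert (D4 : is_derive (fun v => ber4 (v - x) / v ^ 3) u
     (ber3 (u - x) * (/ u * / u * / u) - 3 * ber4 (u - x) * (/ u * / u * / u * / u))).
  { unfold ber3, ber4; auto_derive; [assumption|field; lra]. }
  assert (D5 : is_derive (fun v => ber5 (v - x) / v ^ 4) u
     (ber4 (u - x) * (/ u * / u * / u * / u) - 4 * ber5 (u - x) * (/ u * / u * / u * / u * / u))).
  { unfold ber4, ber5; auto_derive; [assumption|field; lra]. }
  assert (D0 : is_derive (fun v => - v) u (- 1)) by (auto_derive; [auto|ring]).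
  refine (cderiv_eq _ _ _ _ (cderiv_mult _ _ _ _ _ (cderiv_pw t u Hu)
    (cderiv_plus _ _ _ _ _ (cderiv_scal _ (Cinv (Cminus (RtoC 1) (sc t))) _ _ D0)
    (cderiv_plus _ _ _ _ _ (cderiv_real _ _ _ D1)
    (cderiv_plus _ _ _ _ _ (cderiv_scal _ (sc t) _ _ D2)
    (cderiv_plus _ _ _ _ _ (cderiv_scal _ (Cmult (sc t) (Cplus (sc t) (RtoC 1))) _ _ D3)
    (cderiv_plus _ _ _ _ _ (cderiv_scal _ (poch3 t) _ _ D4)
      (cderiv_scal _ (Cmult (poch3 t) (Cplus (sc t) (RtoC 3))) _ _ D5))))))) _).
  replace ((- (1 / 2), t) : C) with (Copp (sc t)).
  2:{ unfold sc, Copp; simpl; f_equal; ring. }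
  generalize (pw t u); intros P.
  unfold Gfun, poch3, poch5.
  generalize (ber1 (u - x)) (ber2 (u - x)) (ber3 (u - x)) (ber4 (u - x)) (ber5 (u - x)).
  intros b1 b2 b3 b4 b5.
  replace (b2 / u) with (b2 * / u) by reflexivity.
  replace (b3 / u ^ 2) with (b3 * (/ u * / u)) by (field; lra).
  replace (b4 / u ^ 3) with (b4 * (/ u * / u * / u)) by (field; lra).
  replace (b5 / u ^ 4) with (b5 * (/ u * / u * / u * / u)) by (field; lra).
  replace (- (b5 / u ^ 5)) with (- (b5 * (/ u * / u * / u * / u * / u))) by (field; lra).
  generalize (one_minus_sc_neq_0 t); generalize (sc t); intros s Hs.
  rewrite ?RtoC_plus, ?RtoC_minus, ?RtoC_mult, ?RtoC_opp, ?RtoC_mult, ?RtoC_inv by lra.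
  assert (Hu' : RtoC u <> RtoC 0) by (intros H; apply (f_equal fst) in H; simpl in H; lra).
  field. split; assumption.
Qed.

(** The remainder is at most [|poch5|] times the bound of [ber5] times the integral of [u^(-11/2)]
    over [[n, oo)], and that integral is [n^(-9/2) / (9/2)]. *)
Definition EMc (t : R) : R := Cmod (poch5 t) * (246 / 1200000) / (9 / 2).

Lemma EMc_nonneg t : 0 <= EMc t.
Proof. unfold EMc. generalize (Cmod_ge_0 (poch5 t)); lra. Qed.

Lemma Gfun_left t x : 0 < x -> Gfun t x x = Cplus (EMmain t x) (RtoC (- (1 / 2))).
Proof.
  intros Hx. unfold Gfun, EMmain.
  replace (x - x) with 0 by ring.
  replace (ber1 0) with (- (1 / 2)) by (unfold ber1; lra).
  replace (ber2 0 / x) with (/ (12 * x)) by (unfold ber2; field; lra).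
  replace (ber3 0 / x ^ 2) with 0 by (unfold ber3; field; lra).
  replace (ber4 0 / x ^ 3) with (- / (720 * x ^ 3)) by (unfold ber4; field; lra).
  replace (ber5 0 / x ^ 4) with 0 by (unfold ber5; field; lra).
  ring.
Qed.

Lemma Gfun_right t x : 0 < x + 1 ->
  Gfun t x (x + 1) = Cplus (EMmain t (x + 1)) (RtoC (1 / 2)).
Proof.
  intros Hx. unfold Gfun, EMmain.
  replace (x + 1 - x) with 1 by ring.
  replace (ber1 1) with (1 / 2) by (unfold ber1; lra).
  replace (ber2 1 / (x + 1)) with (/ (12 * (x + 1))) by (unfold ber2; field; lra).
  replace (ber3 1 / (x + 1) ^ 2) with 0 by (unfold ber3; field; lra).
  replace (ber4 1 / (x + 1) ^ 3) with (- / (720 * (x + 1) ^ 3)) by (unfold ber4; field; lra).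
  replace (ber5 1 / (x + 1) ^ 4) with 0 by (unfold ber5; field; lra).
  ring.
Qed.

Definition EMh (t u : R) : R := EMc t * (/ u ^ 4 * / sqrt u).

(** At the ends of [[x, x+1]] the expansion [Gfun] is [EMmain] shifted by [-1/2] and [1/2], the end
    values of [ber1]. These halves turn the halved last summand at [n] into a full one and leave the
    new last summand halved. *)
Lemma A5_step t n : (1 <= n)%nat ->
  Cmod (Cminus (A5 t (S n)) (A5 t n)) <= EMh t (INR n) - EMh t (INR (S n)).
Proof.
  intros Hn.
  assert (Hx : 1 <= INR n) by (apply (le_INR 1); lia).
  set (x := INR n) in *.
  assert (ES : INR (S n) = x + 1) by (rewrite S_INR; reflexivity).
  replace (Cminus (A5 t (S n)) (A5 t n)) with
    (Cminus (Cmult (pw t (x + 1)) (Gfun t x (x + 1))) (Cmult (pw t x) (Gfun t x x))).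
  2:{ rewrite Gfun_left, Gfun_right by lra. unfold A5. change (Dsum t (S n)) with (Cplus (Dsum t n) (pw t (INR (S n)))).
      fold x. rewrite ES.
      replace (RtoC (- (1 / 2))) with (Copp (RtoC (1 / 2))) by (rewrite RtoC_opp; reflexivity).
      set (h := RtoC (1 / 2)).
      assert (Eh : Cplus h h = RtoC 1) by (unfold h; rewrite <- RtoC_plus; f_equal; lra).
      set (P := pw t (x + 1)). set (D := Dsum t n).
      replace (Cplus D P) with (Cplus D (Cmult (Cplus h h) P)) by (rewrite Eh; ring).
      ring. }
  rewrite ES.
  replace (EMh t x - EMh t (x + 1)) with ((fun u => - EMh t u) (x + 1) - (fun u => - EMh t u) x) by ring.
  apply (cMVT (fun u => Cmult (pw t u) (Gfun t x u))
     (fun u => Cmult (RtoC (- (ber5 (u - x) / u ^ 5))) (Cmult (poch5 t) (pw t u)))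
     (fun u => - EMh t u) (fun u => Cmod (poch5 t) * (246 / 1200000) * (/ u ^ 5 * / sqrt u))).
  - lra.
  - intros u Hu; apply cderiv_EM; lra.
  - intros u Hu. unfold EMh, EMc.
    assert (Hs : 0 < sqrt u) by (apply sqrt_lt_R0; lra).
    assert (Eq : u = sqrt u * sqrt u) by (rewrite sqrt_sqrt; lra).
    auto_derive.
    { repeat split; try lra. repeat apply Rmult_integral_contrapositive_currified; lra. }
    replace (/ (sqrt u * sqrt u)) with (/ u) by (rewrite <- Eq; reflexivity).
    field. lra.
  - intros u Hu.
    rewrite !Cmod_mult, Cmod_pw, Cmod_R by lra.
    rewrite Rabs_Ropp. unfold Rdiv at 1. rewrite Rabs_mult.
    assert (Hp : 0 < / u ^ 5) by (apply Rinv_0_lt_compat, pow_lt; lra).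
    rewrite (Rabs_pos_eq (/ u ^ 5)) by lra.
    assert (B : Rabs (ber5 (u - x)) <= 246 / 1200000) by (apply ber5_bound; lra).
    assert (Hs : 0 < / sqrt u) by (apply Rinv_0_lt_compat, sqrt_lt_R0; lra).
    assert (0 <= Cmod (poch5 t)) by apply Cmod_ge_0.
    replace (Rabs (ber5 (u - x)) * / u ^ 5 * (Cmod (poch5 t) * / sqrt u)) with
      (Rabs (ber5 (u - x)) * (Cmod (poch5 t) * (/ u ^ 5 * / sqrt u))) by ring.
    replace (Cmod (poch5 t) * (246 / 1200000) * (/ u ^ 5 * / sqrt u)) with
      (246 / 1200000 * (Cmod (poch5 t) * (/ u ^ 5 * / sqrt u))) by ring.
    apply Rmult_le_compat_r; [|exact B].
    apply Rmult_le_pos; [lra|]. apply Rmult_le_pos; lra.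
Qed.

Lemma Un_cv_0_le (u v : nat -> R) :
  (forall n, Rabs (u n) <= v n) -> Un_cv v 0 -> Un_cv u 0.
Proof.
  intros H Hv e He. destruct (Hv e He) as [N HN]. exists N; intros n Hn.
  specialize (HN n Hn). unfold R_dist in *. rewrite Rminus_0_r in *.
  eapply Rle_lt_trans; [apply H|]. eapply Rle_lt_trans; [apply Rle_abs|exact HN].
Qed.

Lemma Un_cv_inv_sqrt : Un_cv (fun n => / sqrt (INR (S n))) 0.
Proof.
  intros e He. destruct (INR_unbounded (/ (e * e))) as [N HN].
  exists N; intros n Hn. unfold R_dist. rewrite Rminus_0_r.
  assert (Hi : INR N <= INR (S n)) by (apply le_INR; lia).
  assert (0 < / (e * e)) by (apply Rinv_0_lt_compat; nra).
  assert (H0 : 0 < sqrt (INR (S n))) by (apply sqrt_lt_R0; lra).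
  rewrite Rabs_pos_eq by (apply Rlt_le, Rinv_0_lt_compat, H0).
  rewrite <- (Rinv_inv e). apply Rinv_lt_contravar.
  - apply Rmult_lt_0_compat; [apply Rinv_0_lt_compat|]; lra.
  - rewrite <- (sqrt_square (/ e)) by (apply Rlt_le, Rinv_0_lt_compat; lra).
    apply sqrt_lt_1; try lra.
    + apply Rle_0_sqr.
    + rewrite <- Rinv_mult; lra.
Qed.

Lemma EMh_cv t : Un_cv (fun n => EMh t (INR (S n))) 0.
Proof.
  apply (Un_cv_0_le _ (fun n => EMc t * / sqrt (INR (S n)))).
  - intros n. unfold EMh.
    assert (H1 : 1 <= INR (S n)) by (apply (le_INR 1); lia).
    assert (Hs : 0 < / sqrt (INR (S n))) by (apply Rinv_0_lt_compat, sqrt_lt_R0; lra).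
    assert (Hp : 0 < / INR (S n) ^ 4 <= 1).
    { split; [apply Rinv_0_lt_compat, pow_lt; lra|].
      rewrite <- Rinv_1. apply Rinv_le_contravar; [lra|]. apply pow_R1_Rle; lra. }
    generalize (EMc_nonneg t); intros HE.
    rewrite Rabs_pos_eq.
    + apply Rmult_le_compat_l; [lra|]. nra.
    + apply Rmult_le_pos; [lra|]. nra.
  - replace 0 with (EMc t * 0) by ring.
    apply CV_mult; [|apply Un_cv_inv_sqrt].
    intros e He; exists 0%nat; intros. unfold R_dist. rewrite Rminus_diag, Rabs_R0; lra.
Qed.

(* [EMh] bounds the remainder of the fifth order Euler-Maclaurin formula, so this singles out
   the conjugate of [zeta (1/2 + it)]. *)
Definition is_zeta_conj (t : R) (z : C) : Prop :=
  forall n, (1 <= n)%nat -> Cmod (Cminus z (A5 t n)) <= EMh t (INR n).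

Lemma zeta_conj_exists t : exists z, is_zeta_conj t z.
Proof.
  destruct (Ccv_telescope (fun n => A5 t (S n)) (fun n => EMh t (INR (S n)))) as [l [_ Hl]].
  - intros n; apply A5_step; lia.
  - apply EMh_cv.
  - exists l; intros [|n] Hn; [lia|]. apply Hl.
Qed.

(** A coarse form of the expansion, with an error that merely tends to 0. This is all that the two
    limit arguments require, for the alternating series and for Poisson summation. *)
Lemma Dsum_asymp t z : is_zeta_conj t z -> exists B, forall n,
  Cmod (Cminus (Cminus (Dsum t (S n)) (Cmult (Cmult (RtoC (INR (S n))) (pw t (INR (S n))))
     (Cinv (Cminus (RtoC 1) (sc t))))) z) <= B * / sqrt (INR (S n)).
Proof.
  intros Hz. exists (EMc t + 1 / 2 + Cmod (sc t) + Cmod (poch3 t)). intros n.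
  specialize (Hz (S n) ltac:(lia)).
  assert (H1 : 1 <= INR (S n)) by (apply (le_INR 1); lia).
  unfold A5, EMmain, EMh in Hz.
  generalize dependent (INR (S n)). intros x Hz Hx.
  set (P := pw t x) in *. set (I := Cinv _) in *.
  assert (HP : Cmod P = / sqrt x) by (apply Cmod_pw; lra).
  assert (Hs : 0 < / sqrt x) by (apply Rinv_0_lt_compat, sqrt_lt_R0; lra).
  set (W := Cplus (RtoC (- (1 / 2))) (Cplus (Cmult (RtoC (/ (12 * x))) (sc t))
       (Cmult (RtoC (- / (720 * x ^ 3))) (poch3 t)))).
  match goal with |- Cmod (Cminus (Cminus ?D _) _) <= _ => set (DD := D) in * end.
  match type of Hz with Cmod ?A <= _ => set (AA := A) in * end.
  replace (Cminus (Cminus DD (Cmult (Cmult (RtoC x) P) I)) z) with (Copp (Cplus AA (Cmult P W))).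
  2:{ unfold AA, W. rewrite !RtoC_opp. ring. }
  rewrite Cmod_opp. eapply Rle_trans; [apply Cmod_triangle|].
  rewrite Cmod_mult, HP.
  assert (Hp4 : 0 < / x ^ 4 <= 1).
  { split; [apply Rinv_0_lt_compat, pow_lt; lra|].
    rewrite <- Rinv_1. apply Rinv_le_contravar; [lra|]. apply pow_R1_Rle; lra. }
  assert (HW : Cmod W <= 1 / 2 + Cmod (sc t) + Cmod (poch3 t)).
  { unfold W. eapply Rle_trans; [apply Cmod_triangle|].
    rewrite Cmod_R, Rabs_Ropp, Rabs_pos_eq by lra.
    rewrite Rplus_assoc. apply Rplus_le_compat_l.
    eapply Rle_trans; [apply Cmod_triangle|].
    rewrite !Cmod_mult, !Cmod_R, Rabs_Ropp.
    assert (K : forall y c, 1 <= y -> 0 <= c -> Rabs (/ y) * c <= c).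
    { intros y c Hy Hc. rewrite Rabs_pos_eq by (apply Rlt_le, Rinv_0_lt_compat; lra).
      rewrite <- (Rmult_1_l c) at 2. apply Rmult_le_compat_r; [lra|].
      rewrite <- Rinv_1. apply Rinv_le_contravar; lra. }
    apply Rplus_le_compat; apply K; try apply Cmod_ge_0; try lra.
    assert (1 <= x ^ 3) by (apply pow_R1_Rle; lra). lra. }
  generalize (EMc_nonneg t); intros HE.
  assert (EMc t * (/ x ^ 4 * / sqrt x) <= EMc t * / sqrt x).
  { apply Rmult_le_compat_l; [lra|]. nra. }
  nra.
Qed.

(** * The alternating series *)

Definition eta_term (t : R) (k : nat) : C := Cmult (RtoC ((-1) ^ k)) (pw t (INR (S k))).

Lemma eta_term_sum t N :
  csum (eta_term t) (S N) = (eta_half_re t N, - eta_half_im t N).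
Proof.
  assert (T : forall k, eta_term t k =
    ((-1) ^ k / sqrt (INR (S k)) * cos (t * ln (INR (S k))),
     (-1) ^ k / sqrt (INR (S k)) * sin (t * ln (INR (S k))))).
  { intros k; unfold eta_term, pw, cis, RtoC, Cmult; simpl fst; simpl snd.
    unfold Rdiv. apply injective_projections; simpl fst; simpl snd; ring. }
  induction N as [|N IH].
  - change (csum (eta_term t) 1) with (Cplus (RtoC 0) (eta_term t 0)). rewrite T.
    unfold eta_half_re, eta_half_im, sum_f_R0, Cplus, RtoC; apply injective_projections; simpl fst; simpl snd; ring.
  - change (csum (eta_term t) (S (S N))) with (Cplus (csum (eta_term t) (S N)) (eta_term t (S N))).
    rewrite IH, T. unfold eta_half_re, eta_half_im. rewrite !tech5.
    unfold Cplus; apply injective_projections; simpl fst; simpl snd; ring.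
Qed.

Definition two_pow (t : R) : C := Cmult (RtoC 2) (pw t 2).

(* [eta = (1 - 2^(1-s)) zeta] at the level of partial sums. *)
Lemma eta_even t m :
  csum (eta_term t) (2 * m) = Cminus (Dsum t (2 * m)) (Cmult (two_pow t) (Dsum t m)).
Proof.
  induction m as [|m IH]; [unfold Dsum; simpl; ring|].
  replace (2 * S m)%nat with (S (S (2 * m))) by lia.
  change (csum (eta_term t) (S (S (2 * m)))) with
    (Cplus (Cplus (csum (eta_term t) (2 * m)) (eta_term t (2 * m))) (eta_term t (S (2 * m)))).
  change (Dsum t (S (S (2 * m)))) with
    (Cplus (Cplus (Dsum t (2 * m)) (pw t (INR (S (2 * m))))) (pw t (INR (S (S (2 * m)))))).
  change (Dsum t (S m)) with (Cplus (Dsum t m) (pw t (INR (S m)))).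
  rewrite IH. unfold eta_term, two_pow.
  rewrite pow_1_odd, pow_1_even.
  replace (INR (S (S (2 * m)))) with (2 * INR (S m)).
  2:{ rewrite !S_INR, mult_INR. simpl. ring. }
  rewrite pw_mult by (try lra; apply lt_0_INR; lia).
  replace (RtoC (-1)) with (Copp (RtoC 1)) by (rewrite <- RtoC_opp; f_equal; lra).
  replace (RtoC 2) with (Cplus (RtoC 1) (RtoC 1)).
  2:{ rewrite <- RtoC_plus; f_equal; lra. }
  ring.
Qed.

Lemma eta_factor_eq t : Cmod (Cminus (RtoC 1) (two_pow t)) = eta_factor_abs t.
Proof.
  unfold eta_factor_abs, Cmod. f_equal.
  assert (Hs : 0 < sqrt 2) by (apply sqrt_lt_R0; lra).
  assert (E : 2 * / sqrt 2 = sqrt 2).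
  { apply (Rmult_eq_reg_r (sqrt 2)); [|lra]. rewrite sqrt_sqrt by lra. field; lra. }
  unfold two_pow, pw, cis, Cminus, Cmult, Cplus, Copp, RtoC; simpl fst; simpl snd.
  replace (1 + - (2 * (/ sqrt 2 * cos (t * ln 2) - 0 * sin (t * ln 2)) -
     0 * (/ sqrt 2 * sin (t * ln 2) + 0 * cos (t * ln 2))))
    with (1 - (2 * / sqrt 2) * cos (t * ln 2)) by ring.
  replace (0 + - (2 * (/ sqrt 2 * sin (t * ln 2) + 0 * cos (t * ln 2)) +
     0 * (/ sqrt 2 * cos (t * ln 2) - 0 * sin (t * ln 2))))
    with (- ((2 * / sqrt 2) * sin (t * ln 2))) by ring.
  rewrite E. ring.
Qed.

(** On the critical line [|2^(1-s)| = sqrt 2], so the factor is at least [sqrt 2 - 1]. *)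
Lemma eta_factor_pos t : 0 < eta_factor_abs t.
Proof.
  unfold eta_factor_abs. apply sqrt_lt_R0.
  assert (H2 : 1 < sqrt 2) by (rewrite <- sqrt_1; apply sqrt_lt_1; lra).
  assert (E : sqrt 2 * sqrt 2 = 2) by (apply sqrt_sqrt; lra).
  generalize (sin2_cos2 (t * ln 2)) (COS_bound (t * ln 2)); unfold Rsqr; intros E2 [B1 B2].
  assert (0 < (sqrt 2 - 1) ^ 2) by nra. nra.
Qed.

(** The growing main terms [n^(1-s) / (1-s)] of [Dsum] at [n = 2m] and, multiplied by [2^(1-s)], at
    [n = m] are equal and cancel. What survives is [(1 - 2^(1-s)) z]. *)
Lemma eta_limit_even t z : is_zeta_conj t z -> exists B, forall m,
  Cmod (Cminus (csum (eta_term t) (2 * S m)) (Cmult (Cminus (RtoC 1) (two_pow t)) z))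
    <= B * / sqrt (INR (S m)).
Proof.
  intros Hz. destruct (Dsum_asymp t z Hz) as [B HB].
  exists (Rabs B * (1 + Cmod (two_pow t))). intros m.
  rewrite eta_even.
  assert (H1 : 1 <= INR (S m)) by (apply (le_INR 1); lia).
  assert (Hs : 0 < / sqrt (INR (S m))) by (apply Rinv_0_lt_compat, sqrt_lt_R0; lra).
  assert (K1 := HB (2 * m + 1)%nat). assert (K2 := HB m).
  replace (S (2 * m + 1)) with (2 * S m)%nat in K1 by lia.
  assert (E : INR (2 * S m) = 2 * INR (S m)) by (rewrite mult_INR; reflexivity).
  rewrite E, pw_mult in K1 by lra.
  set (I := Cinv _) in *. set (x := INR (S m)) in *.
  match type of K1 with Cmod ?Q <= _ => set (Q1 := Q) in * end.
  match type of K2 with Cmod ?Q <= _ => set (Q2 := Q) in * end.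
  replace (Cminus _ _) with (Cminus Q1 (Cmult (two_pow t) Q2)).
  2:{ unfold Q1, Q2, two_pow. rewrite RtoC_mult. ring. }
  eapply Rle_trans; [apply Cmod_minus_le|]. rewrite Cmod_mult.
  assert (Hc := Cmod_ge_0 (two_pow t)).
  assert (HA : B <= Rabs B) by apply Rle_abs. assert (HA0 := Rabs_pos B).
  assert (K3 : / sqrt (2 * x) <= / sqrt x).
  { apply Rinv_le_contravar; [apply sqrt_lt_R0; lra|apply sqrt_le_1; lra]. }
  assert (K4 : 0 < / sqrt (2 * x)) by (apply Rinv_0_lt_compat, sqrt_lt_R0; lra).
  assert (Cmod Q1 <= Rabs B * / sqrt x) by nra.
  assert (Cmod Q2 <= Rabs B * / sqrt x) by nra.
  nra.
Qed.

(** Odd partial sums differ from even ones by a single term that tends to 0. The limit of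
    [eta_half_im] is [- Im w] because [z] is the conjugate value, and the sign disappears in the
    modulus. *)
Lemma is_zeta_conj_abs t z : is_zeta_conj t z -> is_abs_zeta_half t (Cmod z).
Proof.
  intros Hz. destruct (eta_limit_even t z Hz) as [B HB].
  set (w := Cmult (Cminus (RtoC 1) (two_pow t)) z) in *.
  assert (Hall : forall e, 0 < e -> exists N, forall n, (N <= n)%nat ->
     Cmod (Cminus (csum (eta_term t) (S n)) w) < e).
  { intros e He. assert (Hb : 0 < Rabs B + 1) by (generalize (Rabs_pos B); lra).
    destruct (Un_cv_inv_sqrt (e / (Rabs B + 1))) as [N HN].
    { apply Rdiv_lt_0_compat; lra. }
    exists (2 * N + 1)%nat; intros n Hn.
    destruct (Nat.Even_or_Odd (S n)) as [[m Hm]|[m Hm]].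
    - rewrite Hm. destruct m as [|m]; [lia|].
      specialize (HB m). specialize (HN m ltac:(lia)). unfold R_dist in HN.
      rewrite Rminus_0_r in HN. apply (Rle_lt_trans _ _ _ (Rle_abs _)) in HN.
      eapply Rle_lt_trans; [exact HB|].
      apply (Rmult_lt_compat_l (Rabs B + 1)) in HN; [|lra].
      replace ((Rabs B + 1) * (e / (Rabs B + 1))) with e in HN by (field; lra).
      assert (Hs : 0 < / sqrt (INR (S m))) by (apply Rinv_0_lt_compat, sqrt_lt_R0, lt_0_INR; lia).
      generalize (Rle_abs B); nra.
    - rewrite Hm. destruct m as [|m]; [lia|].
      specialize (HB m). specialize (HN m ltac:(lia)). unfold R_dist in HN.
      rewrite Rminus_0_r in HN. apply (Rle_lt_trans _ _ _ (Rle_abs _)) in HN.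
      replace (2 * S m + 1)%nat with (S (2 * S m)) by lia.
      change (csum (eta_term t) (S (2 * S m))) with
        (Cplus (csum (eta_term t) (2 * S m)) (eta_term t (2 * S m))).
      replace (Cminus (Cplus (csum (eta_term t) (2 * S m)) (eta_term t (2 * S m))) w) with
        (Cplus (Cminus (csum (eta_term t) (2 * S m)) w) (eta_term t (2 * S m))) by ring.
      eapply Rle_lt_trans; [apply Cmod_triangle|].
      assert (Hs : 0 < / sqrt (INR (S m))) by (apply Rinv_0_lt_compat, sqrt_lt_R0, lt_0_INR; lia).
      assert (Ht : Cmod (eta_term t (2 * S m)) <= / sqrt (INR (S m))).
      { unfold eta_term. rewrite pow_1_even, Cmod_mult, Cmod_1, Rmult_1_l, Cmod_pw.
        - apply Rinv_le_contravar; [apply sqrt_lt_R0, lt_0_INR; lia|].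
          apply sqrt_le_1; try apply pos_INR. apply le_INR; lia.
        - apply lt_0_INR; lia. }
      apply (Rmult_lt_compat_l (Rabs B + 1)) in HN; [|lra].
      replace ((Rabs B + 1) * (e / (Rabs B + 1))) with e in HN by (field; lra).
      generalize (Rle_abs B); nra. }
  exists (Re w), (- Im w). repeat split.
  - intros e He. destruct (Hall e He) as [N HN]. exists N; intros n Hn.
    specialize (HN n Hn). rewrite eta_term_sum in HN.
    eapply Rle_lt_trans; [|exact HN].
    apply (re_le_Cmod (Cminus (eta_half_re t n, - eta_half_im t n) w)).
  - intros e He. destruct (Hall e He) as [N HN]. exists N; intros n Hn.
    specialize (HN n Hn). rewrite eta_term_sum in HN.
    eapply Rle_lt_trans; [|exact HN].
    eapply Rle_trans; [|apply Rmax_Cmod]. eapply Rle_trans; [|apply Rmax_r].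
    unfold R_dist. rewrite <- Rabs_Ropp. apply Req_le. f_equal. unfold Im; simpl; ring.
  - rewrite <- eta_factor_eq.
    replace (sqrt (Re w ^ 2 + (- Im w) ^ 2)) with (Cmod w).
    2:{ unfold Cmod, Re, Im; f_equal; ring. }
    unfold w; rewrite Cmod_mult. field.
    rewrite eta_factor_eq. generalize (eta_factor_pos t); lra.
Qed.

Lemma abs_zeta_half_le (t : R) (B : R) :
  (forall z, is_zeta_conj t z -> Cmod z <= B) ->
  exists z, is_abs_zeta_half t z /\ z <= B.
Proof.
  intros H. destruct (zeta_conj_exists t) as [z Hz].
  exists (Cmod z); split; [apply is_zeta_conj_abs; exact Hz|auto].
Qed.

(** * Oscillatory integrals and Poisson summation *)

Lemma ex_RInt_pos (g : R -> R) (a b : R) :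
  0 < a -> 0 < b -> (forall u, 0 < u -> continuous g u) -> ex_RInt g a b.
Proof.
  intros Ha Hb Hg. apply (ex_RInt_continuous (V := R_CompleteNormedModule)).
  intros u Hu. apply Hg. revert Hu. unfold Rmin. destruct (Rle_dec a b); lra.
Qed.

Lemma is_derive_RInt_pos (g : R -> R) (a u : R) :
  0 < a -> 0 < u -> (forall v, 0 < v -> continuous g v) ->
  is_derive (fun x => RInt g a x) u (g u).
Proof.
  intros Ha Hu Hg. apply (is_derive_RInt g (fun x => RInt g a x) a u).
  - exists (mkposreal u Hu). intros y Hy.
    apply (RInt_correct (V := R_CompleteNormedModule)), ex_RInt_pos; auto.
    unfold ball in Hy; simpl in Hy; unfold AbsRing_ball, abs, minus, plus, opp in Hy; simpl in Hy.
    apply Rabs_def2 in Hy. lra.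
  - auto.
Qed.

(* First derivative test: for [h] monotone, [h * phi' * cos phi] differs from the
   derivative of [h * sin phi] by [h' * sin phi], whose integral is at most the variation of [h]. *)
Lemma first_derivative_core (G h dh phi dphi : R -> R) (a b : R) :
  a <= b ->
  (forall u, a <= u <= b -> is_derive G u (h u * dphi u * cos (phi u))) ->
  (forall u, a <= u <= b -> is_derive h u (dh u)) ->
  (forall u, a <= u <= b -> is_derive phi u (dphi u)) ->
  (forall u, a <= u <= b -> dh u <= 0) \/ (forall u, a <= u <= b -> 0 <= dh u) ->
  Rabs ((G b - h b * sin (phi b)) - (G a - h a * sin (phi a))) <= Rabs (h b - h a).
Proof.
  intros ab HG Hh Hp Hs.
  assert (Hd : forall u, a <= u <= b ->
    is_derive (fun u => G u - h u * sin (phi u)) u (- (dh u * sin (phi u)))).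
  { intros u Hu.
    assert (Hsin : is_derive (fun u => sin (phi u)) u (dphi u * cos (phi u))).
    { apply (is_derive_comp sin phi); [apply is_derive_sin|auto]. }
    refine (is_derive_eqR _ _ _ _ (is_derive_minusR _ _ _ _ _ (HG u Hu)
      (is_derive_multR _ _ _ _ _ (Hh u Hu) Hsin)) _). ring. }
  assert (Hb : forall u, Rabs (sin (phi u)) <= 1).
  { intros u; apply Rabs_le. destruct (SIN_bound (phi u)); lra. }
  destruct Hs as [Hs|Hs].
  - eapply Rle_trans; [apply (MVT_abs_le _ (fun u => - h u) _ (fun u => - dh u) a b ab Hd)|].
    + intros u Hu. apply (is_derive_opp h). auto.
    + intros u Hu. rewrite Rabs_Ropp, Rabs_mult.
      specialize (Hs u Hu); specialize (Hb u). rewrite Rabs_left1 by lra. nra.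
    + rewrite Rabs_minus_sym. eapply Rle_trans; [|apply Rle_abs]. lra.
  - eapply Rle_trans; [apply (MVT_abs_le _ h _ dh a b ab Hd Hh)|].
    + intros u Hu. rewrite Rabs_Ropp, Rabs_mult.
      specialize (Hs u Hu); specialize (Hb u). rewrite Rabs_pos_eq by lra. nra.
    + apply Rle_abs.
Qed.

Lemma first_derivative (G h dh phi dphi : R -> R) (a b : R) :
  a <= b ->
  (forall u, a <= u <= b -> is_derive G u (h u * dphi u * cos (phi u))) ->
  (forall u, a <= u <= b -> is_derive h u (dh u)) ->
  (forall u, a <= u <= b -> is_derive phi u (dphi u)) ->
  (forall u, a <= u <= b -> dh u <= 0) \/ (forall u, a <= u <= b -> 0 <= dh u) ->
  0 <= h a -> 0 <= h b ->
  Rabs (G b - G a) <= 2 * Rmax (h a) (h b).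
Proof.
  intros ab HG Hh Hp Hs H0 H1.
  assert (K := first_derivative_core G h dh phi dphi a b ab HG Hh Hp Hs).
  assert (S1 : Rabs (h b * sin (phi b)) <= h b).
  { rewrite Rabs_mult, Rabs_pos_eq by lra.
    assert (Rabs (sin (phi b)) <= 1) by (apply Rabs_le; destruct (SIN_bound (phi b)); lra). nra. }
  assert (S2 : Rabs (h a * sin (phi a)) <= h a).
  { rewrite Rabs_mult, Rabs_pos_eq by lra.
    assert (Rabs (sin (phi a)) <= 1) by (apply Rabs_le; destruct (SIN_bound (phi a)); lra). nra. }
  apply Rabs_le_between in S1. apply Rabs_le_between in S2. apply Rabs_le_between in K.
  (* The boundary values [h a + h b] together with the variation [|h b - h a|] make twice the larger
     of the two. *)
  apply Rabs_le. revert K. unfold Rmax. destruct (Rle_dec (h a) (h b)).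
  - rewrite Rabs_pos_eq by lra. lra.
  - rewrite Rabs_left1 by lra. lra.
Qed.

(* Partial sums of the Fourier series of the sawtooth [1/2 - u] on (0, 1) and, up to the
   constant term, the Dirichlet kernel. *)
Definition saw (K : nat) (u : R) : R :=
  rsum (fun j => sin (2 * PI * INR (S j) * u) / (PI * INR (S j))) K.
Definition dir (K : nat) (u : R) : R := rsum (fun j => 2 * cos (2 * PI * INR (S j) * u)) K.

Lemma is_derive_rsum (f df : nat -> R -> R) n u :
  (forall k, (k < n)%nat -> is_derive (f k) u (df k u)) ->
  is_derive (fun x => rsum (fun k => f k x) n) u (rsum (fun k => df k u) n).
Proof.
  induction n as [|n IH]; intros H; simpl; [apply is_derive_cst|].
  exact (is_derive_plusR _ _ _ _ _ (IH (fun k Hk => H k (Nat.lt_lt_succ_r _ _ Hk))) (H n (Nat.lt_succ_diag_r n))).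
Qed.

Lemma INR_S_pos j : 0 < INR (S j).
Proof. apply lt_0_INR; lia. Qed.

Lemma is_derive_saw K u : is_derive (saw K) u (dir K u).
Proof.
  apply (is_derive_rsum (fun j u => sin (2 * PI * INR (S j) * u) / (PI * INR (S j)))
    (fun j u => 2 * cos (2 * PI * INR (S j) * u))).
  intros j _. assert (H1 := INR_S_pos j). assert (H2 := PI_RGT_0).
  revert H1; generalize (INR (S j)); intros x H1.
  auto_derive; [auto|]. field; lra.
Qed.

Lemma sin_2PI_INR k : sin (2 * PI * INR k) = 0.
Proof.
  replace (2 * PI * INR k) with (0 + 2 * INR k * PI) by ring. rewrite sin_period; apply sin_0.
Qed.

Lemma sin_add_turns x k : sin (x + 2 * PI * INR k) = sin x.
Proof. replace (x + 2 * PI * INR k) with (x + 2 * INR k * PI) by ring. apply sin_period. Qed.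
Lemma cos_add_turns x k : cos (x + 2 * PI * INR k) = cos x.
Proof. replace (x + 2 * PI * INR k) with (x + 2 * INR k * PI) by ring. apply cos_period. Qed.

Lemma saw_shift K u n : saw K (u + INR n) = saw K u.
Proof.
  apply rsum_ext; intros j _. f_equal.
  replace (2 * PI * INR (S j) * (u + INR n)) with (2 * PI * INR (S j) * u + 2 * PI * INR (S j * n)).
  - apply sin_add_turns.
  - rewrite mult_INR; ring.
Qed.

Lemma saw_INR K n : saw K (INR n) = 0.
Proof.
  unfold saw. rewrite (rsum_ext _ (fun _ => 0)).
  - rewrite rsum_const; ring.
  - intros j _. replace (2 * PI * INR (S j) * INR n) with (2 * PI * INR (S j * n)).
    + rewrite sin_2PI_INR. unfold Rdiv; ring.
    + rewrite mult_INR; ring.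
Qed.

Lemma dirichlet K w : (1 + dir K w) * sin (PI * w) = sin ((2 * INR K + 1) * PI * w).
Proof.
  induction K as [|K IH].
  - unfold dir; simpl rsum. simpl INR. replace ((2 * 0 + 1) * PI * w) with (PI * w) by ring. ring.
  - change (dir (S K) w) with (dir K w + 2 * cos (2 * PI * INR (S K) * w)).
    replace ((1 + (dir K w + 2 * cos (2 * PI * INR (S K) * w))) * sin (PI * w)) with
      ((1 + dir K w) * sin (PI * w) + 2 * (cos (2 * PI * INR (S K) * w) * sin (PI * w))) by ring.
    rewrite IH, !S_INR.
    replace ((2 * INR K + 1) * PI * w) with (2 * PI * (INR K + 1) * w - PI * w) by ring.
    replace ((2 * (INR K + 1) + 1) * PI * w) with (2 * PI * (INR K + 1) * w + PI * w) by ring.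
    rewrite sin_plus, sin_minus. ring.
Qed.

(** By concavity the difference of the sides first increases and then decreases, and it vanishes at
    0 and at 1/2. The sign of its derivative at [x] decides which end to compare with. *)
Lemma sin_ge_chord x : 0 <= x <= 1 / 2 -> 2 * x <= sin (PI * x).
Proof.
  intros Hx. assert (Hpi := PI_RGT_0).
  assert (Hpi4 := PI_4). assert (H3 := PI2_3_2).
  set (h := fun v => sin (PI * v) - 2 * v).
  assert (D : forall v, is_derive h v (PI * cos (PI * v) - 2)).
  { intros v; unfold h; auto_derive; [auto|ring]. }
  destruct (Rle_dec 2 (PI * cos (PI * x))) as [Hc|Hc].
  - assert (h 0 <= h x).
    { apply (derive_nonneg_le h (fun v => PI * cos (PI * v) - 2)); [lra|auto|].
      intros v Hv. assert (cos (PI * x) <= cos (PI * v)); [|nra].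
      apply cos_decr_1; nra. }
    unfold h in H. rewrite Rmult_0_r, sin_0 in H. lra.
  - assert (- h x <= - h (1 / 2)).
    { apply (derive_nonneg_le (fun v => - h v) (fun v => - (PI * cos (PI * v) - 2))); [lra| |].
      - intros v _. apply (is_derive_opp h). auto.
      - intros v Hv. assert (cos (PI * v) <= cos (PI * x)); [|nra].
        apply cos_decr_1; nra. }
    unfold h in H. replace (PI * (1 / 2)) with (PI / 2) in H by field. rewrite sin_PI2 in H. lra.
Qed.

Lemma saw_half K : saw K (1 / 2) = 0.
Proof.
  unfold saw. rewrite (rsum_ext _ (fun _ => 0)).
  - rewrite rsum_const; ring.
  - intros j _. replace (2 * PI * INR (S j) * (1 / 2)) with (INR (S j) * PI) by field.
    rewrite (sin_eq_0_1 (INR (S j) * PI)).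
    + unfold Rdiv; ring.
    + exists (Z.of_nat (S j)). rewrite <- INR_IZR_INZ. reflexivity.
Qed.

Lemma saw_reflect K v : saw K (1 - v) = - saw K v.
Proof.
  replace (- saw K v) with ((-1) * saw K v) by ring.
  unfold saw. rewrite <- rsum_mult_l. apply rsum_ext; intros j _.
  replace (2 * PI * INR (S j) * (1 - v)) with (- (2 * PI * INR (S j) * v) + 2 * PI * INR (S j)) by ring.
  rewrite sin_add_turns, sin_neg. unfold Rdiv; ring.
Qed.

(** The derivative of the left side is [sin (c w) / sin (pi w)] with [c = (2K+1) pi], and the
    function vanishes at 1/2. Adding [cos (c w) / (c sin (pi w))] amounts to an integration by
    parts: it removes the oscillating derivative and leaves one of size [1/c], with an explicit
    primitive of its majorant. *)
Lemma sawtooth_far K v : (1 <= K)%nat -> 0 < v <= 1 / 2 ->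
  Rabs (v - 1 / 2 + saw K v) <= / (INR K * v).
Proof.
  intros HK Hv. assert (Hk : 1 <= INR K) by (apply (le_INR 1); lia).
  assert (Hpi := PI_RGT_0). assert (H3 := PI2_3_2).
  set (c := (2 * INR K + 1) * PI).
  assert (Hc : 6 * INR K <= c) by (unfold c; nra).
  assert (Hsin : forall w, v <= w <= 1 / 2 -> 2 * v <= sin (PI * w)).
  { intros w Hw. generalize (sin_ge_chord w ltac:(lra)). lra. }
  set (Phi := fun w => w - 1 / 2 + saw K w + cos (c * w) * / (c * sin (PI * w))).
  assert (HPhi : Rabs (Phi (1 / 2) - Phi v) <=
     (fun w => - / (c * sin (PI * w))) (1 / 2) - (fun w => - / (c * sin (PI * w))) v).
  { apply (MVT_abs_le Phi (fun w => - / (c * sin (PI * w)))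
      (fun w => - (cos (c * w) * (PI * cos (PI * w)) * / (c * (sin (PI * w) * sin (PI * w)))))
      (fun w => PI * cos (PI * w) * / (c * (sin (PI * w) * sin (PI * w))))); [lra| | |].
    - intros w Hw. specialize (Hsin w Hw).
      assert (D1 : is_derive (fun w => cos (c * w) * / (c * sin (PI * w))) w
         (- sin (c * w) * / sin (PI * w) -
           cos (c * w) * (PI * cos (PI * w)) * / (c * (sin (PI * w) * sin (PI * w))))).
      { auto_derive.
        - apply Rmult_integral_contrapositive_currified; lra.
        - field; lra. }
      assert (D2 : is_derive (fun w => w - 1 / 2) w 1) by (auto_derive; [auto|ring]).
      refine (is_derive_eqR _ _ _ _ (is_derive_plusR _ _ _ _ _
        (is_derive_plusR _ _ _ _ _ D2 (is_derive_saw K w)) D1) _).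
      assert (E := dirichlet K w). fold c in E. rewrite <- E. field. lra.
    - intros w Hw. specialize (Hsin w Hw).
      auto_derive.
      + apply Rmult_integral_contrapositive_currified; lra.
      + field; lra.
    - intros w Hw. specialize (Hsin w Hw). rewrite Rabs_Ropp, !Rabs_mult.
      assert (0 <= cos (PI * w)) by (apply cos_ge_0; nra).
      assert (Hi : 0 < / (c * (sin (PI * w) * sin (PI * w)))).
      { apply Rinv_0_lt_compat. apply Rmult_lt_0_compat; nra. }
      rewrite (Rabs_pos_eq PI), (Rabs_pos_eq (cos (PI * w))), (Rabs_pos_eq (/ _)) by lra.
      assert (Hc1 : Rabs (cos (c * w)) <= 1) by (apply Rabs_le; destruct (COS_bound (c * w)); lra).
      assert (0 <= PI * cos (PI * w) * / (c * (sin (PI * w) * sin (PI * w)))).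
      { apply Rmult_le_pos; [nra|lra]. }
      generalize (Rabs_pos (cos (c * w))). nra. }
  cbv beta in HPhi. unfold Phi in HPhi.
  replace (PI * (1 / 2)) with (PI / 2) in HPhi by field.
  rewrite sin_PI2, saw_half, !Rmult_1_r in HPhi.
  assert (Hcc : Rabs (cos (c * (1 / 2)) * / c) <= / c).
  { rewrite Rabs_mult, (Rabs_pos_eq (/ c)) by (apply Rlt_le, Rinv_0_lt_compat; lra).
    assert (Rabs (cos (c * (1 / 2))) <= 1) by (apply Rabs_le; destruct (COS_bound (c * (1 / 2))); lra).
    assert (0 < / c) by (apply Rinv_0_lt_compat; lra). nra. }
  specialize (Hsin v ltac:(lra)).
  assert (Hi : 0 < / (c * sin (PI * v))) by (apply Rinv_0_lt_compat, Rmult_lt_0_compat; lra).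
  assert (Hcv : Rabs (cos (c * v) * / (c * sin (PI * v))) <= / (c * sin (PI * v))).
  { rewrite Rabs_mult, (Rabs_pos_eq (/ _)) by lra.
    assert (Rabs (cos (c * v)) <= 1) by (apply Rabs_le; destruct (COS_bound (c * v)); lra). nra. }
  assert (Hf : 2 * / (c * sin (PI * v)) <= / (INR K * v)).
  { assert (K1 : / (c * sin (PI * v)) <= / (2 * (INR K * v))).
    { apply Rinv_le_contravar; [nra|]. assert (0 <= INR K * v) by nra.
      apply Rle_trans with (6 * INR K * (2 * v)); [nra|]. apply Rmult_le_compat; lra. }
    rewrite (Rinv_mult 2) in K1. lra. }
  apply Rabs_le_between in HPhi. apply Rabs_le_between in Hcc. apply Rabs_le_between in Hcv.
  apply Rabs_le. lra.
Qed.

Lemma saw_lin K v : 0 <= v -> Rabs (saw K v) <= 2 * INR K * v.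
Proof.
  intros Hv. assert (Hpi := PI_RGT_0).
  induction K as [|K IH].
  - unfold saw; simpl. rewrite Rabs_R0; lra.
  - change (saw (S K) v) with (saw K v + sin (2 * PI * INR (S K) * v) / (PI * INR (S K))).
    eapply Rle_trans; [apply Rabs_triang|].
    rewrite (S_INR K) at 3.
    assert (Rabs (sin (2 * PI * INR (S K) * v) / (PI * INR (S K))) <= 2 * v); [|lra].
    assert (Hp : 0 < PI * INR (S K)) by (generalize (INR_S_pos K); nra).
    unfold Rdiv. rewrite Rabs_mult, (Rabs_pos_eq (/ _)) by (apply Rlt_le, Rinv_0_lt_compat, Hp).
    apply (Rmult_le_reg_r (PI * INR (S K))); [exact Hp|].
    rewrite Rmult_assoc, Rinv_l, Rmult_1_r by lra.
    assert (Hx : 0 <= 2 * PI * INR (S K) * v) by nra.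
    assert (Hs : Rabs (sin (2 * PI * INR (S K) * v)) <= 2 * PI * INR (S K) * v); [|lra].
    generalize (2 * PI * INR (S K) * v) Hx. intros x Hx'.
    replace (sin x) with (sin x - sin 0) by (rewrite sin_0; ring).
    replace x with ((fun y : R => y) x - (fun y : R => y) 0) at 2 by ring.
    apply (MVT_abs_le sin (fun y => y) cos (fun _ => 1)); auto.
    + intros; apply is_derive_sin.
    + intros; apply (is_derive_id (K := R_AbsRing)).
    + intros y _; apply Rabs_le; destruct (COS_bound y); lra.
Qed.

(* [1/sqrt(Kv+1)] interpolates between the bounds [O(1)] near 0 and [1/(Kv)] away from 0,
   and has an elementary integral that tends to 0 with [K]. *)
Lemma sawtooth_bound_half K v : (1 <= K)%nat -> 0 <= v <= 1 / 2 ->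
  Rabs (v - 1 / 2 + saw K v) <= 4 * / sqrt (INR K * v + 1).
Proof.
  intros HK Hv. assert (Hk : 1 <= INR K) by (apply (le_INR 1); lia).
  assert (Hkv : 0 <= INR K * v) by nra.
  set (q := sqrt (INR K * v + 1)).
  assert (Hq0 : 0 < q) by (apply sqrt_lt_R0; lra).
  assert (Hq : q * q = INR K * v + 1) by (apply sqrt_sqrt; lra).
  destruct (Rle_dec (INR K * v) 1) as [H|H].
  - apply Rle_trans with (5 / 2).
    + eapply Rle_trans; [apply Rabs_triang|].
      generalize (saw_lin K v ltac:(lra)). rewrite (Rabs_left1 (v - 1 / 2)) by lra. nra.
    + apply (Rmult_le_reg_r q); [lra|]. rewrite Rmult_assoc, Rinv_l, Rmult_1_r by lra. nra.
  - assert (0 < v) by (apply Rnot_le_lt; intros; nra).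
    eapply Rle_trans; [apply sawtooth_far; [exact HK|lra]|].
    apply (Rmult_le_reg_r (INR K * v)); [lra|]. rewrite Rinv_l by lra.
    apply (Rmult_le_reg_r q); [lra|].
    replace (4 * / q * (INR K * v) * q) with (4 * (INR K * v)) by (field; lra). nra.
Qed.

Lemma sawtooth_bound K v : (1 <= K)%nat -> 0 <= v <= 1 ->
  Rabs (v - 1 / 2 + saw K v) <= 4 * / sqrt (INR K * v + 1) + 4 * / sqrt (INR K * (1 - v) + 1).
Proof.
  intros HK Hv. assert (Hk : 1 <= INR K) by (apply (le_INR 1); lia).
  assert (0 < / sqrt (INR K * v + 1)) by (apply Rinv_0_lt_compat, sqrt_lt_R0; nra).
  assert (0 < / sqrt (INR K * (1 - v) + 1)) by (apply Rinv_0_lt_compat, sqrt_lt_R0; nra).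
  destruct (Rle_dec v (1 / 2)) as [H1|H1].
  - generalize (sawtooth_bound_half K v HK ltac:(lra)); lra.
  - generalize (sawtooth_bound_half K (1 - v) HK ltac:(lra)).
    rewrite saw_reflect. rewrite <- Rabs_Ropp.
    replace (- (1 - v - 1 / 2 + - saw K v)) with (v - 1 / 2 + saw K v) by lra. lra.
Qed.

(** Integration by parts against [u - n - 1/2 + saw K u]. Since [saw] vanishes at the integers, this
    weight is [-1/2] and [1/2] at the ends and produces the trapezoidal mean, while its derivative
    [1 + dir K] produces [G]. Only the term with [df] remains, and there the weight is small away
    from the ends. *)
Lemma poisson_cell (f df G : R -> R) (K n : nat) (M : R) :
  (1 <= K)%nat ->
  (forall u, INR n <= u <= INR n + 1 -> is_derive f u (df u)) ->
  (forall u, INR n <= u <= INR n + 1 -> Rabs (df u) <= M) ->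
  (forall u, INR n <= u <= INR n + 1 -> is_derive G u (f u * (1 + dir K u))) ->
  Rabs (1 / 2 * (f (INR n) + f (INR n + 1)) - (G (INR n + 1) - G (INR n)))
    <= M * (16 / INR K * (sqrt (INR K + 1) - 1)).
Proof.
  intros HK Hf HM HG. assert (Hk : 1 <= INR K) by (apply (le_INR 1); lia).
  set (x := INR n) in *.
  set (Phi := fun u => (u - x - 1 / 2 + saw K u) * f u - G u).
  (* A primitive of [M] times the majorant of [sawtooth_bound]; its total increment is of order
     [M / sqrt K]. *)
  set (h := fun u => M * (8 / INR K * (sqrt (INR K * (u - x) + 1) - sqrt (INR K * (x + 1 - u) + 1)))).
  assert (Es : forall u, saw K u = saw K (u - x)).
  { intros u. rewrite <- (saw_shift K (u - x) n). f_equal. fold x. ring. }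
  assert (B : Rabs (Phi (x + 1) - Phi x) <= h (x + 1) - h x).
  { apply (MVT_abs_le Phi h (fun u => (u - x - 1 / 2 + saw K u) * df u)
      (fun u => M * (4 * / sqrt (INR K * (u - x) + 1) + 4 * / sqrt (INR K * (1 - (u - x)) + 1)))).
    - lra.
    - intros u Hu. unfold Phi.
      assert (D2 : is_derive (fun w => w - x - 1 / 2) u 1) by (auto_derive; [auto|ring]).
      refine (is_derive_eqR _ _ _ _ (is_derive_minusR _ _ _ _ _
        (is_derive_multR _ _ _ _ _ (is_derive_plusR _ _ _ _ _ D2 (is_derive_saw K u)) (Hf u Hu))
        (HG u Hu)) _). ring.
    - intros u Hu. unfold h.
      assert (0 < INR K * (u - x) + 1) by nra.
      assert (0 < INR K * (x + 1 - u) + 1) by nra.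
      assert (0 < sqrt (INR K * (u - x) + 1)) by (apply sqrt_lt_R0; lra).
      assert (0 < sqrt (INR K * (x + 1 - u) + 1)) by (apply sqrt_lt_R0; lra).
      auto_derive; [repeat split; lra|].
      replace (1 - (u - x)) with (x + 1 - u) by ring. unfold Rminus in *. field. lra.
    - intros u Hu. rewrite Rabs_mult, Es, Rmult_comm.
      apply Rmult_le_compat; try apply Rabs_pos; [auto|].
      apply sawtooth_bound; [exact HK|lra]. }
  unfold Phi, h in B.
  replace (x + 1 - x) with 1 in B by ring. replace (x - x) with 0 in B by ring.
  replace (x + 1 - (x + 1)) with 0 in B by ring.
  rewrite Rmult_0_r, Rmult_1_r, Rplus_0_l, sqrt_1 in B.
  assert (S0 : saw K x = 0) by (unfold x; apply saw_INR).
  assert (S1 : saw K (x + 1) = 0) by (unfold x; rewrite <- S_INR; apply saw_INR).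
  rewrite S0, S1 in B.
  replace (M * (16 / INR K * (sqrt (INR K + 1) - 1))) with
   (M * (8 / INR K * (sqrt (INR K + 1) - 1)) - M * (8 / INR K * (1 - sqrt (INR K + 1)))) by (field; lra).
  eapply Rle_trans; [|exact B]. apply Req_le. f_equal. lra.
Qed.

Lemma poisson_sum (f df G : R -> R) (K N m : nat) (M : R) :
  (1 <= K)%nat ->
  (forall u, INR N <= u -> is_derive f u (df u)) ->
  (forall u, INR N <= u -> Rabs (df u) <= M) ->
  (forall u, INR N <= u -> is_derive G u (f u * (1 + dir K u))) ->
  Rabs (rsum (fun j => 1 / 2 * (f (INR (N + j)) + f (INR (N + S j)))) m - (G (INR (N + m)) - G (INR N)))
    <= INR m * (M * (16 / INR K * (sqrt (INR K + 1) - 1))).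
Proof.
  intros HK Hf HM HG. induction m as [|m IH].
  - rewrite Nat.add_0_r. simpl. replace (0 - _) with 0 by ring. rewrite Rabs_R0; lra.
  - simpl rsum. rewrite S_INR, Rmult_plus_distr_r, Rmult_1_l.
    assert (Hn : INR N <= INR (N + m)) by (apply le_INR; lia).
    assert (C := poisson_cell f df G K (N + m) M HK
      (fun u Hu => Hf u ltac:(lra)) (fun u Hu => HM u ltac:(lra)) (fun u Hu => HG u ltac:(lra))).
    rewrite <- S_INR in C. replace (S (N + m)) with (N + S m)%nat in C by lia.
    eapply Rle_trans; [|apply Rplus_le_compat; [exact IH|exact C]].
    eapply Rle_trans; [|apply Rabs_triang]. apply Req_le; f_equal; ring.
Qed.

(** * Oscillatory integrals with amplitude [u^(-1/2)] *)

Lemma deriv_const_eq (f df : R -> R) (a b : R) : a <= b ->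
  (forall x, a <= x <= b -> is_derive f x (df x)) ->
  (forall x, a <= x <= b -> df x = 0) -> f b = f a.
Proof.
  intros ab Hf H0.
  assert (H : Rabs (f b - f a) <= (fun _ => 0) b - (fun _ => 0) a).
  { apply (MVT_abs_le f (fun _ => 0) df (fun _ => 0)); auto.
    - intros; apply is_derive_cst.
    - intros x Hx; rewrite H0, Rabs_R0; auto; lra. }
  assert (Rabs (f b - f a) <= 0) by lra.
  apply Rabs_le_between in H1. lra.
Qed.

(** The real part of [u^(-1/2+it) exp(i (a u + q))]. The free phase [q] makes one real bound,
    uniform in [q], a bound for the modulus of the complex integral. *)
Definition osc (t a q u : R) : R := / sqrt u * cos (t * ln u + a * u + q).

Lemma continuous_osc t a q u : 0 < u -> continuous (osc t a q) u.
Proof.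
  intros Hu. assert (0 < sqrt u) by (apply sqrt_lt_R0, Hu).
  apply (ex_derive_continuous (V := R_NormedModule)). unfold osc. auto_derive. repeat split; lra.
Qed.

Lemma ex_RInt_osc t a q x y : 0 < x -> 0 < y -> ex_RInt (osc t a q) x y.
Proof. intros Hx Hy. apply ex_RInt_pos; auto. apply continuous_osc. Qed.

Lemma is_derive_sqrt_over (c d u : R) : 0 < u -> c * u + d <> 0 ->
  is_derive (fun w => sqrt w / (c * w + d)) u ((d - c * u) / (2 * sqrt u * (c * u + d) ^ 2)).
Proof.
  intros Hu Hn. assert (Hs : 0 < sqrt u) by (apply sqrt_lt_R0, Hu).
  assert (Eq : u = sqrt u * sqrt u) by (rewrite sqrt_sqrt; lra).
  auto_derive; [repeat split; first [assumption|lra]|].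
  transitivity ((c * u + d - 2 * c * (sqrt u * sqrt u)) / (2 * sqrt u * (c * u + d) ^ 2)).
  - field. split; [assumption|lra].
  - rewrite <- Eq. f_equal. ring.
Qed.

Lemma is_derive_phase (t a q u : R) : 0 < u ->
  is_derive (fun w => t * ln w + a * w + q) u (t / u + a).
Proof. intros Hu. auto_derive; [lra|field; lra]. Qed.

Lemma osc_amplitude t a u : 0 < u -> a * u + t <> 0 ->
  sqrt u / (a * u + t) * (t / u + a) = / sqrt u.
Proof.
  intros Hu Hn. assert (Hs : 0 < sqrt u) by (apply sqrt_lt_R0, Hu).
  assert (Eq : u = sqrt u * sqrt u) by (rewrite sqrt_sqrt; lra).
  apply (Rmult_eq_reg_r (sqrt u * u * (a * u + t))); [|].
  2:{ repeat apply Rmult_integral_contrapositive_currified; lra. }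
  replace (sqrt u / (a * u + t) * (t / u + a) * (sqrt u * u * (a * u + t)))
    with ((sqrt u * sqrt u) * (a * u + t)) by (field; lra).
  rewrite <- Eq. field. lra.
Qed.

(* The amplitude [sqrt u / (a u + t)] is unimodal with maximum [1 / (2 sqrt (a t))]
   at [u = t / a]. *)
Lemma osc_plus t a q x y : 0 < t -> 0 < a -> 0 < x <= y ->
  Rabs (RInt (osc t a q) x y) <= / sqrt (a * t).
Proof.
  intros Ht Ha Hxy.
  set (h := fun w => sqrt w / (a * w + t)).
  set (m := / 2 * / sqrt (a * t)).
  assert (Hm : 0 < m) by (unfold m; apply Rmult_lt_0_compat; [lra|]; apply Rinv_0_lt_compat, sqrt_lt_R0; nra).
  assert (Hh : forall w, 0 < w -> 0 <= h w <= m).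
  { intros w Hw. unfold h, m. assert (Hs : 0 < sqrt w) by (apply sqrt_lt_R0, Hw).
    assert (Hd : 0 < a * w + t) by nra.
    split; [apply Rlt_le, Rdiv_lt_0_compat; lra|].
    rewrite <- Rinv_mult.
    assert (Hat : 0 < sqrt (a * t)) by (apply sqrt_lt_R0; nra).
    apply (Rmult_le_reg_r (a * w + t)); [lra|]. unfold Rdiv.
    rewrite Rmult_assoc, Rinv_l, Rmult_1_r by lra.
    apply (Rmult_le_reg_r (2 * sqrt (a * t))); [lra|].
    replace (/ (2 * sqrt (a * t)) * (a * w + t) * (2 * sqrt (a * t))) with (a * w + t) by (field; lra).
    rewrite sqrt_mult by lra.
    assert (Ea : sqrt a * sqrt a = a) by (apply sqrt_sqrt; lra).
    assert (Ew : sqrt w * sqrt w = w) by (apply sqrt_sqrt; lra).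
    assert (Et : sqrt t * sqrt t = t) by (apply sqrt_sqrt; lra).
    assert (E : (sqrt a * sqrt w - sqrt t) ^ 2 = (sqrt a * sqrt a) * (sqrt w * sqrt w) +
      sqrt t * sqrt t - sqrt w * (2 * (sqrt a * sqrt t))) by ring.
    rewrite Ea, Ew, Et in E.
    generalize (pow2_ge_0 (sqrt a * sqrt w - sqrt t)). lra. }
  set (G := fun w => RInt (osc t a q) x w).
  set (Phi := fun w => G w - h w * sin (t * ln w + a * w + q)).
  assert (HG : forall w, 0 < w -> is_derive G w (h w * (t / w + a) * cos (t * ln w + a * w + q))).
  { intros w Hw. unfold h. rewrite osc_amplitude; [|lra|nra].
    exact (is_derive_RInt_pos (osc t a q) x w (proj1 Hxy) Hw (continuous_osc t a q)). }
  assert (Hup : forall c d, 0 < c <= d -> d <= t / a -> Rabs (Phi d - Phi c) <= h d - h c).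
  { intros c d Hcd Hd. eapply Rle_trans.
    - apply (first_derivative_core G h (fun w => (t - a * w) / (2 * sqrt w * (a * w + t) ^ 2))
        (fun w => t * ln w + a * w + q) (fun w => t / w + a)); [lra| | | |right].
      + intros; apply HG; lra.
      + intros; apply is_derive_sqrt_over; nra.
      + intros; apply is_derive_phase; lra.
      + intros u Hu. assert (0 < sqrt u) by (apply sqrt_lt_R0; lra).
        assert (a * u <= t).
        { apply Rle_trans with (a * (t / a)); [apply Rmult_le_compat_l; lra|]. apply Req_le; field; lra. }
        apply Rmult_le_pos; [lra|]. apply Rlt_le, Rinv_0_lt_compat.
        apply Rmult_lt_0_compat; [lra|]. apply pow_lt; nra.
    - rewrite Rabs_pos_eq; [lra|].
      assert (h c <= h d); [|lra].
      apply (derive_nonneg_le h (fun w => (t - a * w) / (2 * sqrt w * (a * w + t) ^ 2))); [lra| |].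
      + intros; apply is_derive_sqrt_over; nra.
      + intros u Hu. assert (0 < sqrt u) by (apply sqrt_lt_R0; lra).
        assert (a * u <= t).
        { apply Rle_trans with (a * (t / a)); [apply Rmult_le_compat_l; lra|]. apply Req_le; field; lra. }
        apply Rmult_le_pos; [lra|]. apply Rlt_le, Rinv_0_lt_compat.
        apply Rmult_lt_0_compat; [lra|]. apply pow_lt; nra. }
  assert (Hdown : forall c d, 0 < c <= d -> t / a <= c -> Rabs (Phi d - Phi c) <= h c - h d).
  { intros c d Hcd Hd.
    assert (Hau : forall u, c <= u -> t <= a * u).
    { intros u Hu. apply Rle_trans with (a * (t / a)); [apply Req_le; field; lra|].
      apply Rmult_le_compat_l; lra. }
    eapply Rle_trans.
    - apply (first_derivative_core G h (fun w => (t - a * w) / (2 * sqrt w * (a * w + t) ^ 2))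
        (fun w => t * ln w + a * w + q) (fun w => t / w + a)); [lra| | | |left].
      + intros; apply HG; lra.
      + intros; apply is_derive_sqrt_over; nra.
      + intros; apply is_derive_phase; lra.
      + intros u Hu. assert (0 < sqrt u) by (apply sqrt_lt_R0; lra).
        specialize (Hau u ltac:(lra)).
        assert (0 < / (2 * sqrt u * (a * u + t) ^ 2)).
        { apply Rinv_0_lt_compat. apply Rmult_lt_0_compat; [lra|]. apply pow_lt; nra. }
        unfold Rdiv; nra.
    - rewrite Rabs_left1; [lra|].
      assert (- h c <= - h d); [|lra].
      apply (derive_nonneg_le (fun w => - h w) (fun w => - ((t - a * w) / (2 * sqrt w * (a * w + t) ^ 2)))); [lra| |].
      + intros; apply (is_derive_opp h), is_derive_sqrt_over; nra.
      + intros u Hu. assert (0 < sqrt u) by (apply sqrt_lt_R0; lra).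
        specialize (Hau u ltac:(lra)).
        assert (0 < / (2 * sqrt u * (a * u + t) ^ 2)).
        { apply Rinv_0_lt_compat. apply Rmult_lt_0_compat; [lra|]. apply pow_lt; nra. }
        unfold Rdiv; nra. }
  assert (Hta : 0 < t / a) by (apply Rdiv_lt_0_compat; lra).
  (* On each side of [t / a] the cost is the increment of [h], so the total is [2 m - h x - h y] at
     worst. The boundary terms [h x] and [h y] restored below bring it back to [2 m]. *)
  assert (HP : Rabs (Phi y - Phi x) <= 2 * m - h x - h y).
  { destruct (Rle_dec y (t / a)) as [H1|H1].
    - generalize (Hup x y ltac:(lra) H1) (Hh y ltac:(lra)); lra.
    - destruct (Rle_dec (t / a) x) as [H2|H2].
      + generalize (Hdown x y ltac:(lra) H2) (Hh x ltac:(lra)); lra.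
      + assert (A1 := Hup x (t / a) ltac:(lra) ltac:(lra)).
        assert (A2 := Hdown (t / a) y ltac:(lra) ltac:(lra)).
        assert (A3 := Hh (t / a) Hta).
        replace (Phi y - Phi x) with ((Phi y - Phi (t / a)) + (Phi (t / a) - Phi x)) by ring.
        eapply Rle_trans; [apply Rabs_triang|]. lra. }
  unfold Phi in HP. unfold G at 2 in HP.
  rewrite (RInt_point (V := R_CompleteNormedModule)) in HP. change (zero : R) with 0 in HP.
  assert (Hsy : Rabs (h y * sin (t * ln y + a * y + q)) <= h y).
  { rewrite Rabs_mult, (Rabs_pos_eq (h y)) by (apply Hh; lra).
    assert (Rabs (sin (t * ln y + a * y + q)) <= 1) by (apply Rabs_le; destruct (SIN_bound (t * ln y + a * y + q)); lra).
    generalize (Hh y ltac:(lra)); nra. }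
  assert (Hsx : Rabs (h x * sin (t * ln x + a * x + q)) <= h x).
  { rewrite Rabs_mult, (Rabs_pos_eq (h x)) by (apply Hh; lra).
    assert (Rabs (sin (t * ln x + a * x + q)) <= 1) by (apply Rabs_le; destruct (SIN_bound (t * ln x + a * x + q)); lra).
    generalize (Hh x ltac:(lra)); nra. }
  apply Rabs_le_between in HP, Hsy, Hsx. fold (G y).
  replace (/ sqrt (a * t)) with (2 * m) by (unfold m; field; apply Rgt_not_eq, sqrt_lt_R0; nra).
  apply Rabs_le. lra.
Qed.

(** To the left of the stationary point [t / (2 pi)] the amplitude increases, so its value at [y]
    governs the integral; to the right of it, in [osc_tail], the value at [x] does. *)
Lemma osc_low t q x y : 0 < x <= y -> 2 * PI * y < t ->
  Rabs (RInt (osc t (- (2 * PI)) q) x y) <= 2 * (sqrt y / (t - 2 * PI * y)).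
Proof.
  intros Hxy Hy. assert (Hpi := PI_RGT_0).
  set (a := - (2 * PI)).
  set (h := fun w => sqrt w / (a * w + t)).
  set (dh := fun w => (t - a * w) / (2 * sqrt w * (a * w + t) ^ 2)).
  assert (Hd : forall u, x <= u <= y -> 0 < a * u + t) by (intros u Hu; unfold a; nra).
  assert (Hdh : forall u, x <= u <= y -> 0 <= dh u).
  { intros u Hu. unfold dh. specialize (Hd u Hu). assert (0 < sqrt u) by (apply sqrt_lt_R0; lra).
    apply Rmult_le_pos; [unfold a; nra|]. apply Rlt_le, Rinv_0_lt_compat.
    apply Rmult_lt_0_compat; [lra|]. apply pow_lt; lra. }
  assert (Hh : forall u, x <= u <= y -> is_derive h u (dh u)).
  { intros u Hu. apply is_derive_sqrt_over; [lra|]. specialize (Hd u Hu). lra. }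
  assert (Hpos : forall u, x <= u <= y -> 0 <= h u).
  { intros u Hu. specialize (Hd u Hu). apply Rmult_le_pos; [apply sqrt_pos|].
    apply Rlt_le, Rinv_0_lt_compat; lra. }
  assert (Hmono : h x <= h y).
  { apply (derive_nonneg_le h dh); [lra|auto|auto]. }
  set (G := fun w => RInt (osc t a q) x w).
  assert (B : Rabs (G y - G x) <= 2 * Rmax (h x) (h y)).
  { apply (first_derivative G h dh (fun w => t * ln w + a * w + q) (fun w => t / w + a)); auto; try lra.
    - intros u Hu. unfold h. specialize (Hd u Hu). rewrite osc_amplitude; [|lra|lra].
      exact (is_derive_RInt_pos (osc t a q) x u (proj1 Hxy) ltac:(lra) (continuous_osc t a q)).
    - intros u Hu; apply is_derive_phase; lra.
    - apply Hpos; lra.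
    - apply Hpos; lra. }
  unfold G at 2 in B. rewrite (RInt_point (V := R_CompleteNormedModule)) in B. change (zero : R) with 0 in B.
  rewrite Rminus_0_r, Rmax_right in B by lra. unfold h in B.
  replace (a * y + t) with (t - 2 * PI * y) in B by (unfold a; ring). exact B.
Qed.

Lemma osc_tail t q x y : 0 < t -> 0 < x <= y -> t < 2 * PI * x ->
  Rabs (RInt (osc t (- (2 * PI)) q) x y) <= 2 * (sqrt x / (2 * PI * x - t)).
Proof.
  intros Ht Hxy Hx. assert (Hpi := PI_RGT_0).
  set (a := 2 * PI).
  set (h := fun w => sqrt w / (a * w + - t)).
  set (dh := fun w => (- t - a * w) / (2 * sqrt w * (a * w + - t) ^ 2)).
  assert (Hd : forall u, x <= u <= y -> 0 < a * u + - t) by (intros u Hu; unfold a; nra).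
  assert (Hdh : forall u, x <= u <= y -> dh u <= 0).
  { intros u Hu. unfold dh. specialize (Hd u Hu). assert (0 < sqrt u) by (apply sqrt_lt_R0; lra).
    assert (0 < / (2 * sqrt u * (a * u + - t) ^ 2)).
    { apply Rinv_0_lt_compat. apply Rmult_lt_0_compat; [lra|]. apply pow_lt; lra. }
    unfold Rdiv. assert (0 < a * u) by (unfold a; nra). nra. }
  assert (Hh : forall u, x <= u <= y -> is_derive h u (dh u)).
  { intros u Hu. apply is_derive_sqrt_over; [lra|]. specialize (Hd u Hu). lra. }
  assert (Hpos : forall u, x <= u <= y -> 0 <= h u).
  { intros u Hu. specialize (Hd u Hu). apply Rmult_le_pos; [apply sqrt_pos|].
    apply Rlt_le, Rinv_0_lt_compat; lra. }
  assert (Hmono : - h x <= - h y).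
  { apply (derive_nonneg_le (fun u => - h u) (fun u => - dh u)); [lra| |].
    - intros u Hu; apply (is_derive_opp h); auto.
    - intros u Hu; specialize (Hdh u Hu); lra. }
  set (G := fun w => RInt (osc t (- (2 * PI)) q) x w).
  assert (B : Rabs (G y - G x) <= 2 * Rmax (h x) (h y)).
  (* The phase is negated, which the cosine permits, in order to keep the amplitude [h] positive
     beyond the stationary point. *)
  { apply (first_derivative G h dh (fun w => - t * ln w + a * w + - q) (fun w => - t / w + a)); auto; try lra.
    - intros u Hu. unfold h. specialize (Hd u Hu). rewrite osc_amplitude; [|lra|lra].
      apply (is_derive_eqR _ _ (osc t (- (2 * PI)) q u)).
      + exact (is_derive_RInt_pos (osc t (- (2 * PI)) q) x u (proj1 Hxy) ltac:(lra) (continuous_osc t (- (2 * PI)) q)).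
      + unfold osc. f_equal. rewrite <- cos_neg. f_equal. unfold a. ring.
    - intros u Hu; apply is_derive_phase; lra.
    - apply Hpos; lra.
    - apply Hpos; lra. }
  unfold G at 2 in B. rewrite (RInt_point (V := R_CompleteNormedModule)) in B. change (zero : R) with 0 in B.
  rewrite Rminus_0_r, Rmax_left in B by lra. unfold h in B.
  replace (a * x + - t) with (2 * PI * x - t) in B by (unfold a; ring). exact B.
Qed.

Lemma RInt_Chasles_R (g : R -> R) (a b c : R) :
  ex_RInt g a b -> ex_RInt g b c -> RInt g a b + RInt g b c = RInt g a c.
Proof. intros H1 H2. exact (RInt_Chasles g a b c H1 H2). Qed.

Lemma is_derive_RInt_osc t a q x u : 0 < x -> 0 < u ->
  is_derive (fun w => RInt (osc t a q) x w) u (osc t a q u).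
Proof. intros Hx Hu. exact (is_derive_RInt_pos (osc t a q) x u Hx Hu (continuous_osc t a q)). Qed.

Lemma RInt_point_R (g : R -> R) a : RInt g a a = 0.
Proof. exact (RInt_point (V := R_CompleteNormedModule) a g). Qed.

(** The phase [-pi/2] turns the cosine into a sine, so this is the integral of
    [u^(-1/2+it) exp(i a u)] over [[x, y]]. *)
Definition oscC (t a x y : R) : C :=
  (RInt (osc t a 0) x y, RInt (osc t a (- (PI / 2))) x y).

Lemma osc_rot t a q x y : 0 < x <= y ->
  RInt (osc t a q) x y = Re (Cmult (cis q) (oscC t a x y)).
Proof.
  intros Hxy.
  set (F := fun w => RInt (osc t a q) x w - cos q * RInt (osc t a 0) x w
     + sin q * RInt (osc t a (- (PI / 2))) x w).
  assert (E : F y = F x).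
  { apply (deriv_const_eq F (fun w => osc t a q w - (0 * RInt (osc t a 0) x w + cos q * osc t a 0 w)
     + (0 * RInt (osc t a (- (PI / 2))) x w + sin q * osc t a (- (PI / 2)) w))); [lra| |].
    - intros w Hw.
      refine (is_derive_plusR _ _ _ _ _ (is_derive_minusR _ _ _ _ _ _ (is_derive_multR _ _ _ _ _ _ _)) (is_derive_multR _ _ _ _ _ _ _)).
      + apply is_derive_RInt_osc; lra.
      + apply is_derive_cst.
      + apply is_derive_RInt_osc; lra.
      + apply is_derive_cst.
      + apply is_derive_RInt_osc; lra.
    - intros w Hw. unfold osc.
      replace (t * ln w + a * w + - (PI / 2)) with (- (PI / 2 - (t * ln w + a * w))) by ring.
      rewrite cos_neg, cos_shift, Rplus_0_r, cos_plus. ring. }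
  unfold F in E. rewrite !RInt_point_R in E.
  unfold Re, oscC, cis; simpl. lra.
Qed.

Lemma oscC_bound t a x y B : 0 < x <= y ->
  (forall q, Rabs (RInt (osc t a q) x y) <= B) -> Cmod (oscC t a x y) <= B.
Proof.
  intros Hxy H. apply Cmod_le_rot; intros p. rewrite <- osc_rot by lra.
  eapply Rle_trans; [apply Rle_abs|apply H].
Qed.

Lemma oscC_Chasles t a x y z : 0 < x -> 0 < y -> 0 < z ->
  Cplus (oscC t a x y) (oscC t a y z) = oscC t a x z.
Proof.
  intros Hx Hy Hz. unfold oscC, Cplus; simpl fst; simpl snd.
  rewrite !RInt_Chasles_R by (apply ex_RInt_osc; assumption). reflexivity.
Qed.

(* [X] is [int_0^oo w^(-1/2+it) exp(-2 pi i w) dw], the improper integral at both ends. *)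
Definition is_X (t : R) (X : C) : Prop := forall x y, 0 < x <= y -> 2 * PI * x < t -> t < 2 * PI * y ->
  Cmod (Cminus X (oscC t (- (2 * PI)) x y))
    <= 2 * (sqrt x / (t - 2 * PI * x)) + 2 * (sqrt y / (2 * PI * y - t)).

Lemma X_exists t : 0 < t -> exists X, is_X t X.
Proof.
  intros Ht. assert (Hpi := PI_RGT_0). assert (H3 := PI2_3_2). assert (H4 := PI_4).
  (* With this offset every interval [[1/m, m]] contains the stationary point with room to spare:
     [2 pi / m <= t / 2] and [t < m]. Enlarging the interval then only adds pieces covered by
     [osc_low] and [osc_tail]. *)
  destruct (INR_unbounded (4 * PI / t + t + 1)) as [n0 Hn0].
  assert (Hq : 0 < 4 * PI / t) by (apply Rdiv_lt_0_compat; lra).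
  set (m := fun n => INR (n + n0)).
  assert (Hm : forall n, 1 < m n /\ t < m n /\ 2 * PI * / m n <= t / 2).
  { intros n. assert (INR n0 <= m n) by (apply le_INR; lia).
    repeat split; try lra.
    apply (Rmult_le_reg_r (m n)); [lra|]. rewrite Rmult_assoc, Rinv_l by lra.
    apply (Rmult_le_reg_l (/ t)); [apply Rinv_0_lt_compat; lra|].
    replace (/ t * (t / 2 * m n)) with (m n / 2) by (field; lra).
    replace (/ t * (2 * PI * 1)) with (4 * PI / t / 2) by (field; lra). lra. }
  set (a := fun n => oscC t (- (2 * PI)) (/ m n) (m n)).
  assert (Hinv : forall n, 0 < / m n < 1).
  { intros n. destruct (Hm n) as [A _]. split; [apply Rinv_0_lt_compat; lra|].
    rewrite <- Rinv_1. apply Rinv_lt_contravar; lra. }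
  destruct (Ccv_cauchy a (fun n => (4 / t + 2) * / sqrt (m n))) as [X [HX _]].
  { intros n k. destruct (Hm n) as [A1 [A2 A3]]. destruct (Hm (n + k)%nat) as [B1 [B2 B3]].
    assert (Hmn : m n <= m (n + k)%nat) by (apply le_INR; lia).
    assert (Hin : / m (n + k)%nat <= / m n) by (apply Rinv_le_contravar; lra).
    assert (I1 := Hinv n). assert (I2 := Hinv (n + k)%nat).
    unfold a.
    rewrite <- (oscC_Chasles t (- (2 * PI)) (/ m (n + k)%nat) (/ m n) (m (n + k)%nat)) by lra.
    rewrite <- (oscC_Chasles t (- (2 * PI)) (/ m n) (m n) (m (n + k)%nat)) by lra.
    replace (Cminus _ _) with (Cplus (oscC t (- (2 * PI)) (/ m (n + k)%nat) (/ m n))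
       (oscC t (- (2 * PI)) (m n) (m (n + k)%nat))) by ring.
    eapply Rle_trans; [apply Cmod_triangle|].
    assert (Hs : 0 < sqrt (m n)) by (apply sqrt_lt_R0; lra).
    assert (C1 : Cmod (oscC t (- (2 * PI)) (/ m (n + k)%nat) (/ m n)) <= 4 / t * / sqrt (m n)).
    { apply oscC_bound; [lra|]. intros q. eapply Rle_trans; [apply osc_low; lra|].
      rewrite sqrt_inv.
      replace (4 / t * / sqrt (m n)) with (2 * (/ sqrt (m n) * / (t / 2))) by (field; lra).
      apply Rmult_le_compat_l; [lra|]. apply Rmult_le_compat_l; [apply Rlt_le, Rinv_0_lt_compat; lra|].
      apply Rinv_le_contravar; lra. }
    assert (C2 : Cmod (oscC t (- (2 * PI)) (m n) (m (n + k)%nat)) <= 2 * / sqrt (m n)).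
    { assert (m n <= 2 * PI * m n - t) by nra.
      apply oscC_bound; [lra|]. intros q. eapply Rle_trans; [apply osc_tail; nra|].
      apply Rmult_le_compat_l; [lra|].
      apply Rle_trans with (sqrt (m n) * / m n).
      - apply Rmult_le_compat_l; [lra|]. apply Rinv_le_contravar; lra.
      - rewrite <- (sqrt_sqrt (m n)) at 2 by lra. apply Req_le; field; lra. }
    lra. }
  { intros e He. assert (Hc : 0 < 4 / t + 2) by (assert (0 < 4 / t) by (apply Rdiv_lt_0_compat; lra); lra).
    destruct (Un_cv_inv_sqrt (e / (4 / t + 2))) as [N HN]; [apply Rdiv_lt_0_compat; lra|].
    exists (S N); intros n Hn. specialize (HN (pred n + n0)%nat ltac:(lia)).
    replace (S (pred n + n0)) with (n + n0)%nat in HN by lia. fold (m n) in HN.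
    unfold R_dist in *. rewrite Rminus_0_r in *.
    rewrite Rabs_mult, (Rabs_pos_eq (4 / t + 2)) by lra.
    apply (Rmult_lt_compat_l (4 / t + 2)) in HN; [|lra].
    replace ((4 / t + 2) * (e / (4 / t + 2))) with e in HN by (field; repeat split; try lra). exact HN. }
  exists X. intros x y Hxy Hx Hy.
  apply Rnot_lt_le; intros Hlt.
  match type of Hlt with ?A < ?B => set (eps := B - A) in * end.
  destruct (HX eps ltac:(unfold eps; lra)) as [N HN].
  destruct (INR_unbounded (/ x + y)) as [M HM].
  assert (0 < / x) by (apply Rinv_0_lt_compat; lra).
  specialize (HN (N + M)%nat ltac:(lia)).
  set (n := (N + M)%nat) in *. destruct (Hm n) as [A1 [A2 A3]].
  assert (HMn : INR M <= m n) by (apply le_INR; unfold n; lia).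
  assert (Hx1 : / m n <= x).
  { rewrite <- (Rinv_inv x). apply Rinv_le_contravar; lra. }
  assert (I1 := Hinv n).
  assert (Cmod (Cminus X (oscC t (- (2 * PI)) x y)) <= Cmod (Cminus (a n) X) +
     (Cmod (oscC t (- (2 * PI)) (/ m n) x) + Cmod (oscC t (- (2 * PI)) y (m n)))).
  { replace (Cminus X (oscC t (- (2 * PI)) x y)) with
     (Cminus (Cplus (oscC t (- (2 * PI)) (/ m n) x) (oscC t (- (2 * PI)) y (m n))) (Cminus (a n) X)).
    - eapply Rle_trans; [apply Cmod_minus_le|]. rewrite Rplus_comm. apply Rplus_le_compat_l, Cmod_triangle.
    - unfold a. rewrite <- (oscC_Chasles t (- (2 * PI)) (/ m n) x (m n)) by lra.
      rewrite <- (oscC_Chasles t (- (2 * PI)) x y (m n)) by lra. ring. }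
  assert (Cmod (oscC t (- (2 * PI)) (/ m n) x) <= 2 * (sqrt x / (t - 2 * PI * x))).
  { apply oscC_bound; [lra|]. intros q; apply osc_low; lra. }
  assert (Cmod (oscC t (- (2 * PI)) y (m n)) <= 2 * (sqrt y / (2 * PI * y - t))).
  { apply oscC_bound; [lra|]. intros q; apply osc_tail; lra. }
  unfold eps in HN. lra.
Qed.

(* The frequency [nu] integral is reduced to frequency one by [w = nu u]. *)
Lemma osc_scale t q nu x y : 0 < nu -> 0 < x <= y ->
  RInt (osc t (- (2 * PI * nu)) q) x y =
    / sqrt nu * RInt (osc t (- (2 * PI)) (q - t * ln nu)) (nu * x) (nu * y).
Proof.
  intros Hnu Hxy. assert (Hs : 0 < sqrt nu) by (apply sqrt_lt_R0; lra).
  set (F := fun w => RInt (osc t (- (2 * PI * nu)) q) x w -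
     / sqrt nu * RInt (osc t (- (2 * PI)) (q - t * ln nu)) (nu * x) (nu * w)).
  assert (E : F y = F x).
  { apply (deriv_const_eq F (fun w => osc t (- (2 * PI * nu)) q w -
     (0 * RInt (osc t (- (2 * PI)) (q - t * ln nu)) (nu * x) (nu * w) +
      / sqrt nu * (nu * osc t (- (2 * PI)) (q - t * ln nu) (nu * w))))); [lra| |].
    - intros w Hw.
      refine (is_derive_minusR _ _ _ _ _ _ (is_derive_multR _ _ _ _ _ _ _)).
      + apply is_derive_RInt_osc; lra.
      + apply is_derive_cst.
      + apply (is_derive_comp (fun w => RInt (osc t (- (2 * PI)) (q - t * ln nu)) (nu * x) w)
          (fun w => nu * w)).
        * apply is_derive_RInt_osc; nra.
        * auto_derive; [auto|ring].
    - intros w Hw. unfold osc.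
      rewrite ln_mult, sqrt_mult, Rinv_mult by lra.
      replace (t * (ln nu + ln w) + - (2 * PI) * (nu * w) + (q - t * ln nu))
        with (t * ln w + - (2 * PI * nu) * w + q) by ring.
      replace (/ sqrt nu * (nu * (/ sqrt nu * / sqrt w * cos (t * ln w + - (2 * PI * nu) * w + q))))
        with ((nu / (sqrt nu * sqrt nu)) * (/ sqrt w * cos (t * ln w + - (2 * PI * nu) * w + q))).
      2:{ field. split; [apply Rgt_not_eq, sqrt_lt_R0; lra|lra]. }
      rewrite sqrt_sqrt by lra. replace (nu / nu) with 1 by (field; lra). ring. }
  unfold F in E. rewrite !RInt_point_R in E. lra.
Qed.

(** * The factor of the functional equation has modulus at most one *)

Definition tpoly (c : nat -> C) (K : nat) (u : R) : C :=
  csum (fun j => Cmult (c j) (cis (2 * PI * INR (S j) * u))) K.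

Lemma cis_conj x : Cconj (cis x) = cis (- x).
Proof. symmetry; apply cis_opp. Qed.

Lemma is_derive_trig_primitive (a b x u : R) : x <> 0 ->
  is_derive (fun u => (a * sin (x * u) + b * cos (x * u)) / x) u (a * cos (x * u) - b * sin (x * u)).
Proof. intros Hx. auto_derive; [auto|field; exact Hx]. Qed.

(** Orthogonality of different frequencies on [[0, 1]], expressed by a primitive with equal end
    values. The frequencies in [tpoly c n] are at most [n <= K], hence differ from [K + 1].
    Parseval's identity for [tpoly] follows by induction. *)
Lemma tpoly_cross_primitive (c : nat -> C) (d : C) (n K : nat) : (n <= K)%nat ->
  exists B, B 1 = B 0 /\
    forall u, is_derive B u (Re (Cmult (tpoly c n u) (Cconj (Cmult d (cis (2 * PI * INR (S K) * u)))))).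
Proof.
  intros Hn. induction n as [|n IH].
  - exists (fun _ => 0); split; [reflexivity|]. intros u.
    replace (Re _) with 0; [apply is_derive_cst|].
    unfold tpoly; simpl csum. unfold Re, Cmult; simpl; ring.
  - destruct IH as [B [B01 HB]]; [lia|].
    assert (Hx : 0 < INR (S K) - INR (S n)) by (apply Rlt_0_minus, lt_INR; lia).
    assert (Hpi := PI_RGT_0).
    set (x := 2 * PI * (INR (S n) - INR (S K))).
    assert (Hxn : x <> 0) by (unfold x; apply Rlt_not_eq; nra).
    set (e := Cmult (c n) (Cconj d)).
    exists (fun u => B u + (Re e * sin (x * u) + Im e * cos (x * u)) / x). split.
    + rewrite B01, Rmult_0_r, Rmult_1_r, sin_0, cos_0. f_equal.
      assert (Ex : x = - (2 * PI * INR (K - n))).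
      { unfold x. rewrite minus_INR by lia. rewrite !S_INR. ring. }
      replace (sin x) with 0. replace (cos x) with 1; [reflexivity|].
      * rewrite Ex, cos_neg. rewrite <- (Rplus_0_l (2 * PI * INR (K - n))), cos_add_turns, cos_0; reflexivity.
      * rewrite Ex, sin_neg, sin_2PI_INR; ring.
    + intros u.
      assert (D : is_derive (fun u => (Re e * sin (x * u) + Im e * cos (x * u)) / x) u
         (Re e * cos (x * u) - Im e * sin (x * u))) by (apply is_derive_trig_primitive; exact Hxn).
      refine (is_derive_eqR _ _ _ _ (is_derive_plusR _ _ _ _ _ (HB u) D) _).
      change (tpoly c (S n) u) with (Cplus (tpoly c n u) (Cmult (c n) (cis (2 * PI * INR (S n) * u)))).
      set (w := Cconj (Cmult d (cis (2 * PI * INR (S K) * u)))).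
      replace (Re (Cmult (Cplus (tpoly c n u) (Cmult (c n) (cis (2 * PI * INR (S n) * u)))) w)) with
        (Re (Cmult (tpoly c n u) w) + Re (Cmult (Cmult (c n) (cis (2 * PI * INR (S n) * u))) w)).
      2:{ unfold Re; simpl; ring. }
      f_equal.
      replace (Cmult (Cmult (c n) (cis (2 * PI * INR (S n) * u))) w) with (Cmult e (cis (x * u))).
      * unfold Re, Im, cis; simpl; ring.
      * unfold w, e. rewrite Cmult_conj, cis_conj.
        replace (x * u) with (2 * PI * INR (S n) * u + - (2 * PI * INR (S K) * u)) by (unfold x; ring).
        rewrite cis_add. ring.
Qed.

Lemma Cmod2_plus (a b : C) :
  Cmod (Cplus a b) ^ 2 = Cmod a ^ 2 + 2 * Re (Cmult a (Cconj b)) + Cmod b ^ 2.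
Proof. rewrite !Cmod2_alt. unfold Re, Im; simpl; ring. Qed.

Lemma tpoly_norm_primitive (c : nat -> C) (K : nat) :
  exists A, A 1 - A 0 = rsum (fun j => Cmod (c j) ^ 2) K /\
    forall u, is_derive A u (Cmod (tpoly c K u) ^ 2).
Proof.
  induction K as [|K IH].
  - exists (fun _ => 0); split; [simpl; ring|]. intros u.
    unfold tpoly; simpl csum. rewrite Cmod_0. replace (0 ^ 2) with 0 by ring. apply is_derive_cst.
  - destruct IH as [A [A01 HA]].
    destruct (tpoly_cross_primitive c (c K) K K (le_n K)) as [B [B01 HB]].
    exists (fun u => A u + 2 * B u + Cmod (c K) ^ 2 * u). split.
    + change (rsum (fun j => Cmod (c j) ^ 2) (S K)) with (rsum (fun j => Cmod (c j) ^ 2) K + Cmod (c K) ^ 2).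
      rewrite <- A01, B01. ring.
    + intros u.
      change (tpoly c (S K) u) with (Cplus (tpoly c K u) (Cmult (c K) (cis (2 * PI * INR (S K) * u)))).
      rewrite Cmod2_plus.
      assert (D : is_derive (fun u => Cmod (c K) ^ 2 * u) u (Cmod (c K) ^ 2)) by (auto_derive; [auto|ring]).
      refine (is_derive_eqR _ _ _ _ (is_derive_plusR _ _ _ _ _ (is_derive_plusR _ _ _ _ _ (HA u)
         (is_derive_multR _ _ _ _ _ (is_derive_cst 2 u) (HB u))) D) _).
      rewrite (Cmod_mult (c K)), Cmod_cis, Rmult_1_r. ring.
Qed.

Lemma pw_mult_cis t a u :
  Cmult (pw t u) (cis (a * u)) = (osc t a 0 u, osc t a (- (PI / 2)) u).
Proof.
  unfold osc, pw.
  replace (t * ln u + a * u + - (PI / 2)) with (- (PI / 2 - (t * ln u + a * u))) by ring.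
  rewrite cos_neg, cos_shift, Rplus_0_r.
  rewrite <- Cmult_assoc, <- cis_add. unfold cis, RtoC, Cmult; simpl.
  apply injective_projections; simpl; ring.
Qed.

(** The integral over [[e, 1]] of [|pw - tpoly|^2], with the Fourier coefficients of [pw] as
    coefficients of [tpoly], is nonnegative. The square [|pw|^2 = 1/u] contributes [-ln e], and [H]
    is a primitive of the cross term. *)
Lemma bessel t e K : 0 < e <= 1 ->
  rsum (fun j => Cmod (oscC t (- (2 * PI * INR (S j))) e 1) ^ 2) K <= - ln e.
Proof.
  intros He.
  set (c := fun j => oscC t (- (2 * PI * INR (S j))) e 1).
  destruct (tpoly_norm_primitive c K) as [A [A01 HA]].
  set (H := fun u => rsum (fun j => Re (c j) * RInt (osc t (- (2 * PI * INR (S j))) 0) e u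
      + Im (c j) * RInt (osc t (- (2 * PI * INR (S j))) (- (PI / 2))) e u) K).
  assert (HH : forall u, 0 < u -> is_derive H u (Re (Cmult (pw t u) (Cconj (tpoly c K u))))).
  { intros u Hu.
    apply (is_derive_eqR _ _ (rsum (fun j => Re (c j) * osc t (- (2 * PI * INR (S j))) 0 u
      + Im (c j) * osc t (- (2 * PI * INR (S j))) (- (PI / 2)) u) K)).
    - apply (is_derive_rsum (fun j u => Re (c j) * RInt (osc t (- (2 * PI * INR (S j))) 0) e u
        + Im (c j) * RInt (osc t (- (2 * PI * INR (S j))) (- (PI / 2))) e u)
       (fun j u => Re (c j) * osc t (- (2 * PI * INR (S j))) 0 u
        + Im (c j) * osc t (- (2 * PI * INR (S j))) (- (PI / 2)) u)).
      intros j _.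
      refine (is_derive_eqR _ _ _ _ (is_derive_plusR _ _ _ _ _
        (is_derive_multR _ _ _ _ _ (is_derive_cst (Re (c j)) u) (is_derive_RInt_osc _ _ _ _ _ _ Hu))
        (is_derive_multR _ _ _ _ _ (is_derive_cst (Im (c j)) u) (is_derive_RInt_osc _ _ _ _ _ _ Hu))) _); try lra.
    - unfold tpoly. generalize K. intros n; induction n as [|n IH].
      + simpl. unfold Re; simpl; ring.
      + change (rsum ?f (S n)) with (rsum f n + f n). cbv beta. rewrite IH.
        change (csum (fun j => Cmult (c j) (cis (2 * PI * INR (S j) * u))) (S n)) with
          (Cplus (csum (fun j => Cmult (c j) (cis (2 * PI * INR (S j) * u))) n)
             (Cmult (c n) (cis (2 * PI * INR (S n) * u)))).
        set (s := csum _ n).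
        replace (Re (Cmult (pw t u) (Cconj (Cplus s (Cmult (c n) (cis (2 * PI * INR (S n) * u))))))) with
          (Re (Cmult (pw t u) (Cconj s)) + Re (Cmult (Cconj (c n)) (Cmult (pw t u) (cis (- (2 * PI * INR (S n)) * u))))).
        * f_equal. rewrite pw_mult_cis. generalize (c n) (INR (S n)); intros z r.
          unfold Re, Im; simpl fst; simpl snd. ring.
        * generalize (c n) (INR (S n)); intros z r. replace (- (2 * PI * r) * u) with (- (2 * PI * r * u)) by ring.
          rewrite <- cis_conj. unfold Re; simpl; ring. }
  assert (He1 : H e = 0).
  { unfold H. rewrite (rsum_ext _ (fun _ => 0)); [rewrite rsum_const; ring|].
    intros j _. rewrite !RInt_point_R. ring. }
  assert (H1 : H 1 = rsum (fun j => Cmod (c j) ^ 2) K).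
  { unfold H. apply rsum_ext; intros j _. rewrite Cmod2_alt. unfold c, oscC. generalize (INR (S j)); intros r.
    unfold Re, Im; simpl; ring. }
  assert (M : ln e - 2 * H e + A e <= ln 1 - 2 * H 1 + A 1).
  { apply (derive_nonneg_le (fun u => ln u - 2 * H u + A u)
      (fun u => / u - (0 * H u + 2 * Re (Cmult (pw t u) (Cconj (tpoly c K u)))) + Cmod (tpoly c K u) ^ 2)); [lra| |].
    - intros u Hu.
      refine (is_derive_plusR _ _ _ _ _ (is_derive_minusR _ _ _ _ _ _
        (is_derive_multR _ _ _ _ _ (is_derive_cst 2 u) (HH u _))) (HA u)); [|lra].
      apply is_derive_ln; lra.
    - intros u Hu. generalize (pow2_ge_0 (Cmod (Cplus (pw t u) (Copp (tpoly c K u))))).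
      rewrite Cmod2_plus, Cmod_opp, Cmod_pw by lra.
      assert (Hs : 0 < sqrt u) by (apply sqrt_lt_R0; lra).
      replace ((/ sqrt u) ^ 2) with (/ u).
      2:{ rewrite <- (sqrt_sqrt u) at 1 by lra. field; lra. }
      replace (Re (Cmult (pw t u) (Cconj (Copp (tpoly c K u))))) with
        (- Re (Cmult (pw t u) (Cconj (tpoly c K u)))) by (unfold Re; simpl; ring). lra. }
  (* The integral of [|tpoly|^2] over [[e, 1]] is at most the one over the full period [[0, 1]],
     which Parseval's identity evaluates. *)
  assert (A0 : A 0 <= A e).
  { apply (derive_nonneg_le A (fun u => Cmod (tpoly c K u) ^ 2)); [lra|auto|].
    intros; apply pow2_ge_0. }
  rewrite ln_1, He1, H1 in M. fold c. unfold c in *. lra.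
Qed.

Lemma oscC_scale t nu x y : 0 < nu -> 0 < x <= y ->
  Cmod (oscC t (- (2 * PI * nu)) x y) = / sqrt nu * Cmod (oscC t (- (2 * PI)) (nu * x) (nu * y)).
Proof.
  intros Hnu Hxy. assert (Hs : 0 < / sqrt nu) by (apply Rinv_0_lt_compat, sqrt_lt_R0; lra).
  replace (oscC t (- (2 * PI * nu)) x y) with
    (Cmult (RtoC (/ sqrt nu)) (Cmult (cis (- (t * ln nu))) (oscC t (- (2 * PI)) (nu * x) (nu * y)))).
  - rewrite !Cmod_mult, Cmod_cis, Cmod_R, Rabs_pos_eq by lra. ring.
  - unfold oscC at 2. rewrite !osc_scale by lra.
    rewrite !osc_rot by nra.
    replace (0 - t * ln nu) with (- (t * ln nu)) by ring.
    replace (- (PI / 2) - t * ln nu) with (- (PI / 2) + - (t * ln nu)) by ring.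
    rewrite (cis_add (- (PI / 2))).
    replace (cis (- (PI / 2))) with ((0, -1) : C).
    2:{ unfold cis. rewrite cos_neg, sin_neg, cos_PI2, sin_PI2. reflexivity. }
    apply injective_projections; unfold Re; simpl; ring.
Qed.

Lemma sum_inv_sqrt_le K : rsum (fun j => / sqrt (INR (S j))) K <= 2 * sqrt (INR K).
Proof.
  induction K as [|K IH]; [simpl; rewrite sqrt_0; lra|].
  rewrite rsum_S. assert (H0 := pos_INR K). assert (H1 := S_INR K).
  assert (Hs : 0 < sqrt (INR (S K))) by (apply sqrt_lt_R0; lra).
  assert (E1 : sqrt (INR (S K)) * sqrt (INR (S K)) = INR (S K)) by (apply sqrt_sqrt; lra).
  assert (E2 : sqrt (INR K) * sqrt (INR K) = INR K) by (apply sqrt_sqrt; lra).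
  assert (H2 := sqrt_pos (INR K)).
  assert (/ sqrt (INR (S K)) <= 2 * (sqrt (INR (S K)) - sqrt (INR K))); [|lra].
  apply (Rmult_le_reg_r (sqrt (INR (S K)))); [lra|]. rewrite Rinv_l by lra. nra.
Qed.

Lemma sum_inv_pow32_le m n : (1 <= n)%nat ->
  rsum (fun j => / INR (S (n + j)) * / sqrt (INR (S (n + j)))) m
    <= 2 * / sqrt (INR n) - 2 * / sqrt (INR (n + m)).
Proof.
  intros Hn. induction m as [|m IH]; [rewrite Nat.add_0_r; simpl; lra|].
  rewrite rsum_S, Nat.add_succ_r.
  assert (H0 : 0 < INR (n + m)) by (apply lt_0_INR; lia). assert (H1 := S_INR (n + m)).
  set (x := INR (n + m)) in *. set (y := INR (S (n + m))) in *.
  assert (Hx : 0 < sqrt x) by (apply sqrt_lt_R0; lra).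
  assert (Hy : 0 < sqrt y) by (apply sqrt_lt_R0; lra).
  assert (E1 : sqrt x * sqrt x = x) by (apply sqrt_sqrt; lra).
  assert (E2 : sqrt y * sqrt y = y) by (apply sqrt_sqrt; lra).
  assert (/ y * / sqrt y <= 2 * / sqrt x - 2 * / sqrt y); [|lra].
  rewrite <- E2 at 1.
  apply (Rmult_le_reg_r (sqrt y * sqrt y * sqrt y * sqrt x)); [repeat apply Rmult_lt_0_compat; lra|].
  replace (/ (sqrt y * sqrt y) * / sqrt y * (sqrt y * sqrt y * sqrt y * sqrt x)) with (sqrt x) by (field; lra).
  replace ((2 * / sqrt x - 2 * / sqrt y) * (sqrt y * sqrt y * sqrt y * sqrt x))
    with (2 * (sqrt y * sqrt y) * (sqrt y - sqrt x)) by (field; lra).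
  assert (sqrt x <= sqrt y) by (apply sqrt_le_1; lra).
  assert ((sqrt y - sqrt x) * (sqrt y + sqrt x) = 1).
  { replace ((sqrt y - sqrt x) * (sqrt y + sqrt x)) with (sqrt y * sqrt y - sqrt x * sqrt x) by ring. lra. }
  assert (sqrt x * (sqrt y + sqrt x) <= 2 * (sqrt y * sqrt y)) by nra.
  apply (Rmult_le_reg_r (sqrt y + sqrt x)); [lra|]. nra.
Qed.

Lemma sum_inv_ge m n : (1 <= n)%nat ->
  ln (INR (n + m)) - ln (INR n) <= rsum (fun j => / INR (n + j)) m.
Proof.
  intros Hn. induction m as [|m IH]; [rewrite Nat.add_0_r; simpl; lra|].
  rewrite rsum_S, Nat.add_succ_r.
  assert (H0 : 0 < INR (n + m)) by (apply lt_0_INR; lia). rewrite S_INR.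
  set (x := INR (n + m)) in *.
  assert (ln (x + 1) - ln x <= / x); [|lra].
  replace (x + 1) with (x * (1 + / x)) by (field; lra).
  assert (0 < / x) by (apply Rinv_0_lt_compat; lra).
  rewrite ln_mult by lra.
  assert (ln (1 + / x) <= / x); [|lra].
  apply Rnot_lt_le; intros Hlt. apply exp_increasing in Hlt. rewrite exp_ln in Hlt by lra.
  generalize (exp_ineq1_le (/ x)); lra.
Qed.

(* The Fourier coefficient of [u^(-1/2+it)] on [e, 1] at frequency [nu] has modulus about
   [|X| / sqrt nu] for [nu <= K = O(1/e)], so Bessel's inequality compares [|X|^2 ln K] with
   [ln (1/e)]. *)
Lemma X_bound t X : 0 < t -> is_X t X -> Cmod X <= 1.
Proof.
  intros Ht HX. apply Rnot_lt_le; intros HX1.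
  assert (Hpi := PI_RGT_0). assert (H3 := PI2_3_2). assert (H4 := PI_4).
  destruct (INR_unbounded (t + 1)) as [n0 Hn0].
  assert (Hn1 : (1 <= n0)%nat) by (destruct n0; [simpl in Hn0; lra|lia]).
  (* [D] bounds the errors [P1 + 2 P2] below, and [C0] collects everything that stays bounded as [K]
     grows. If [|X| > 1], an [ln K] above [C0 / (|X|^2 - 1)] contradicts Bessel's inequality. *)
  set (D := 2 * (8 * / sqrt t) + 4).
  set (C0 := Cmod X ^ 2 * ln (INR (S n0)) + 2 * Cmod X * D + Rabs (ln (t * / (4 * PI)))).
  destruct (INR_unbounded (exp (C0 / (Cmod X ^ 2 - 1)) + t)) as [m0 Hm].
  assert (Hm0 : (1 <= m0)%nat).
  { destruct m0; [|lia]. change (INR 0) with 0 in Hm. generalize (exp_pos (C0 / (Cmod X ^ 2 - 1))). lra. }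
  set (m := m0). set (K := (n0 + m)%nat).
  assert (HmK : INR m <= INR K) by (apply le_INR; unfold K; lia).
  assert (HK : 1 <= INR K) by (apply (le_INR 1); unfold K, m; lia).
  (* This choice gives [2 pi nu e <= t / 2] for every [nu <= K], so after rescaling the lower limit
     [nu e] stays to the left of the stationary point. *)
  set (e := t * / (4 * PI) * / INR K).
  assert (HiK : 0 < / INR K) by (apply Rinv_0_lt_compat; lra).
  assert (Hi4 : 0 < / (4 * PI)) by (apply Rinv_0_lt_compat; lra).
  assert (He0 : 0 < e) by (unfold e; apply Rmult_lt_0_compat; [apply Rmult_lt_0_compat; lra|lra]).
  assert (He1 : e <= 1).
  { unfold e. apply (Rmult_le_reg_r (4 * PI * INR K)); [nra|].
    replace (t * / (4 * PI) * / INR K * (4 * PI * INR K)) with t by (field; lra).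
    generalize (exp_pos (C0 / (Cmod X ^ 2 - 1))). fold m in Hm. nra. }
  assert (HB := bessel t e K ltac:(lra)).
  (* The first [n0] frequencies are discarded: for the others [nu > t + 1], so the upper limit [nu]
     of the rescaled integral lies beyond the stationary point. *)
  unfold K in HB. rewrite rsum_app in HB.
  match type of HB with ?A + ?B <= _ => assert (HA0 : 0 <= A) by (apply rsum_nonneg; intros; apply pow2_ge_0);
    set (S1 := B) in * end.
  assert (Hst : 0 < / sqrt t) by (apply Rinv_0_lt_compat, sqrt_lt_R0; lra).
  assert (HL : Cmod X ^ 2 * rsum (fun j => / INR (S n0 + j)) m -
     2 * Cmod X * (8 * / sqrt t * / sqrt (INR K) * rsum (fun j => / sqrt (INR (S (n0 + j)))) m +
        2 * rsum (fun j => / INR (S (n0 + j)) * / sqrt (INR (S (n0 + j)))) m) <= S1).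
  { unfold S1. rewrite <- !rsum_mult_l, <- rsum_plus, <- rsum_mult_l.
    match goal with |- rsum ?f _ - rsum ?g _ <= _ =>
      replace (rsum f m - rsum g m) with (rsum (fun j => f j - g j) m) by (apply rsum_minus) end.
    apply rsum_le. intros j Hj.
    replace (S n0 + j)%nat with (S (n0 + j)) by lia.
    set (nu := INR (S (n0 + j))).
    assert (Hnu1 : t + 1 < nu).
    { apply Rlt_le_trans with (INR n0); [exact Hn0|]. apply le_INR; lia. }
    assert (HnuK : nu <= INR K) by (apply le_INR; unfold K; lia).
    rewrite (oscC_scale t nu e 1) by lra. rewrite Rmult_1_r.
    set (O := Cmod (oscC t (- (2 * PI)) (nu * e) nu)).
    assert (Hsn : 0 < sqrt nu) by (apply sqrt_lt_R0; lra).
    assert (En : sqrt nu * sqrt nu = nu) by (apply sqrt_sqrt; lra).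
    assert (Hd : Cmod X - O <= 8 * / sqrt t * / sqrt (INR K) * sqrt nu + 2 * / sqrt nu).
    { assert (Hne : 2 * PI * (nu * e) <= t / 2).
      { unfold e. replace (2 * PI * (nu * (t * / (4 * PI) * / INR K))) with (t / 2 * (nu * / INR K)) by (field; lra).
        assert (nu * / INR K <= 1).
        { apply (Rmult_le_reg_r (INR K)); [lra|]. rewrite Rmult_assoc, Rinv_l; lra. }
        nra. }
      assert (Hxy : 0 < nu * e <= nu) by (split; nra).
      assert (Hlow : 2 * PI * (nu * e) < t) by lra.
      assert (Hhigh : t < 2 * PI * nu) by nra.
      specialize (HX (nu * e) nu Hxy Hlow Hhigh).
      apply Rle_trans with (Cmod (Cminus X (oscC t (- (2 * PI)) (nu * e) nu))).
      { unfold O. generalize (Cmod_triangle (Cminus X (oscC t (- (2 * PI)) (nu * e) nu)) (oscC t (- (2 * PI)) (nu * e) nu)).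
        replace (Cplus (Cminus X (oscC t (- (2 * PI)) (nu * e) nu)) (oscC t (- (2 * PI)) (nu * e) nu)) with X by ring.
        lra. }
      eapply Rle_trans; [exact HX|]. apply Rplus_le_compat.
      - apply Rle_trans with (2 * (sqrt (nu * e) * / (t / 2))).
        { apply Rmult_le_compat_l; [lra|]. apply Rmult_le_compat_l; [apply sqrt_pos|].
          apply Rinv_le_contravar; lra. }
        assert (Hse : sqrt e <= sqrt t * / sqrt (INR K)).
        { rewrite <- sqrt_inv, <- sqrt_mult by lra. apply sqrt_le_1; [lra|nra|].
          unfold e. apply Rmult_le_compat_r; [lra|].
          assert (/ (4 * PI) <= 1) by (rewrite <- Rinv_1; apply Rinv_le_contravar; lra). nra. }
        rewrite sqrt_mult by lra.
        replace (8 * / sqrt t * / sqrt (INR K) * sqrt nu) with (8 * sqrt nu * (sqrt t * / sqrt (INR K)) * / (sqrt t * sqrt t)).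
        2:{ field. split; apply Rgt_not_eq, sqrt_lt_R0; lra. }
        rewrite sqrt_sqrt by lra.
        replace (2 * (sqrt nu * sqrt e * / (t / 2))) with (4 * sqrt nu * sqrt e * / t) by (field; lra).
        assert (0 < / t) by (apply Rinv_0_lt_compat; lra).
        apply Rmult_le_compat_r; [lra|].
        assert (0 <= sqrt t * / sqrt (INR K)).
        { apply Rmult_le_pos; [apply sqrt_pos|]. apply Rlt_le, Rinv_0_lt_compat, sqrt_lt_R0; lra. }
        nra.
      - apply Rmult_le_compat_l; [lra|].
        apply Rle_trans with (sqrt nu * / nu).
        + apply Rmult_le_compat_l; [lra|]. apply Rinv_le_contravar; nra.
        + rewrite <- En at 2. apply Req_le; field; lra. }
    assert (HO : 0 <= O) by apply Cmod_ge_0.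
    set (d := 8 * / sqrt t * / sqrt (INR K) * sqrt nu + 2 * / sqrt nu) in *.
    assert (Hq : Cmod X ^ 2 - 2 * Cmod X * d <= O ^ 2).
    { generalize (pow2_ge_0 O) (pow2_ge_0 d). intros.
      destruct (Rle_dec (Cmod X) d) as [Hc|Hc]; [nra|].
      apply Rle_trans with ((Cmod X - d) ^ 2); [simpl; nra|]. apply pow_incr; lra. }
    replace ((/ sqrt nu * O) ^ 2) with (O ^ 2 * / nu).
    2:{ rewrite <- En at 1. field; lra. }
    apply Rle_trans with ((Cmod X ^ 2 - 2 * Cmod X * d) * / nu).
    - apply Req_le. unfold d. clear - Hsn En HiK Hst HK Ht. set (r := sqrt nu) in *.
      clearbody r. rewrite <- En. field.
      repeat split; try lra; apply Rgt_not_eq, sqrt_lt_R0; lra.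
    - apply Rmult_le_compat_r; [apply Rlt_le, Rinv_0_lt_compat; lra|exact Hq]. }
  assert (L1 := sum_inv_ge m (S n0) ltac:(lia)).
  assert (L2 : rsum (fun j => / sqrt (INR (S (n0 + j)))) m <= 2 * sqrt (INR K)).
  { eapply Rle_trans; [|apply (sum_inv_sqrt_le K)]. unfold K. rewrite rsum_app.
    assert (0 <= rsum (fun j => / sqrt (INR (S j))) n0); [|lra].
    apply rsum_nonneg; intros. apply Rlt_le, Rinv_0_lt_compat, sqrt_lt_R0, INR_S_pos. }
  assert (L3 := sum_inv_pow32_le m n0 Hn1).
  assert (L3' : rsum (fun j => / INR (S (n0 + j)) * / sqrt (INR (S (n0 + j)))) m <= 2).
  { assert (/ sqrt (INR n0) <= 1).
    { rewrite <- Rinv_1. apply Rinv_le_contravar; [lra|]. rewrite <- sqrt_1. apply sqrt_le_1; lra. }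
    assert (0 < / sqrt (INR (n0 + m))) by (apply Rinv_0_lt_compat, sqrt_lt_R0; unfold K in HK; lra). lra. }
  assert (LnK : ln (INR K) <= ln (INR (S n0 + m))).
  { destruct (Rle_lt_or_eq_dec (INR K) (INR (S n0 + m))) as [H|H].
    - apply le_INR; unfold K; lia.
    - apply Rlt_le, ln_increasing; lra.
    - rewrite H; lra. }
  assert (Hle : ln e = ln (t * / (4 * PI)) - ln (INR K)).
  { unfold e. rewrite ln_mult, ln_Rinv by nra. ring. }
  assert (Hlm : C0 / (Cmod X ^ 2 - 1) < ln (INR K)).
  { rewrite <- (ln_exp (C0 / (Cmod X ^ 2 - 1))). apply ln_increasing; [apply exp_pos|]. fold m in Hm. lra. }
  assert (HX2 : 0 < Cmod X ^ 2 - 1) by nra.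
  apply (Rmult_lt_compat_l (Cmod X ^ 2 - 1)) in Hlm; [|lra].
  replace ((Cmod X ^ 2 - 1) * (C0 / (Cmod X ^ 2 - 1))) with C0 in Hlm by (field; lra).
  assert (L2' : 8 * / sqrt t * / sqrt (INR K) * rsum (fun j => / sqrt (INR (S (n0 + j)))) m <= 16 * / sqrt t).
  { assert (Hsk : 0 < sqrt (INR K)) by (apply sqrt_lt_R0; lra).
    replace (16 * / sqrt t) with (8 * / sqrt t * / sqrt (INR K) * (2 * sqrt (INR K))) by (field; repeat split; apply Rgt_not_eq, sqrt_lt_R0; lra).
    apply Rmult_le_compat_l; [|exact L2]. apply Rmult_le_pos; [lra|]. apply Rlt_le, Rinv_0_lt_compat; lra. }
  assert (Habs : - ln (t * / (4 * PI)) <= Rabs (ln (t * / (4 * PI)))).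
  { rewrite <- Rabs_Ropp. apply Rle_abs. }
  assert (Q1 : Cmod X ^ 2 * (ln (INR K) - ln (INR (S n0))) <= Cmod X ^ 2 * rsum (fun j => / INR (S n0 + j)) m).
  { apply Rmult_le_compat_l; [apply pow2_ge_0|]. lra. }
  set (P1 := 8 * / sqrt t * / sqrt (INR K) * rsum (fun j => / sqrt (INR (S (n0 + j)))) m) in *.
  set (P2 := rsum (fun j => / INR (S (n0 + j)) * / sqrt (INR (S (n0 + j)))) m) in *.
  assert (Q2 : 2 * Cmod X * (P1 + 2 * P2) <= 2 * Cmod X * D).
  { apply Rmult_le_compat_l; [lra|]. unfold D. lra. }
  unfold C0 in Hlm. lra.
Qed.

(** * The approximate functional equation *)

(** The amplitude [u^(-3/2)] arises from one integration by parts of [osc]. In [osc_high] it is used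
    with [t] and with [- t]. *)
Definition osc3 (t a q u : R) : R := / (u * sqrt u) * cos (t * ln u + a * u + q).

Lemma continuous_osc3 t a q u : 0 < u -> continuous (osc3 t a q) u.
Proof.
  intros Hu. assert (0 < sqrt u) by (apply sqrt_lt_R0, Hu).
  apply (ex_derive_continuous (V := R_NormedModule)). unfold osc3. auto_derive.
  repeat split; try lra. apply Rgt_not_eq; nra.
Qed.

Lemma is_derive_RInt_osc3 t a q x u : 0 < x -> 0 < u ->
  is_derive (fun w => RInt (osc3 t a q) x w) u (osc3 t a q u).
Proof. intros Hx Hu. exact (is_derive_RInt_pos (osc3 t a q) x u Hx Hu (continuous_osc3 t a q)). Qed.

Lemma osc3_bound t a q x y : 0 < a -> 0 < x <= y -> 0 < a * x + t ->
  Rabs (RInt (osc3 t a q) x y) <= 2 * / (sqrt x * (a * x + t)).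
Proof.
  intros Ha Hxy Hx.
  set (h := fun w => / (sqrt w * (a * w + t))).
  set (dh := fun w => - ((3 * a * w + t) / (2 * sqrt w)) / (sqrt w * (a * w + t)) ^ 2).
  assert (Hd : forall u, x <= u -> 0 < a * u + t) by (intros u Hu; nra).
  assert (Hdh : forall u, x <= u <= y -> dh u <= 0).
  { intros u Hu. unfold dh. assert (H1 := Hd u ltac:(lra)). assert (0 < sqrt u) by (apply sqrt_lt_R0; lra).
    assert (0 < / (sqrt u * (a * u + t)) ^ 2) by (apply Rinv_0_lt_compat, pow_lt; nra).
    assert (0 < (3 * a * u + t) / (2 * sqrt u)) by (apply Rdiv_lt_0_compat; nra).
    unfold Rdiv at 1. nra. }
  assert (Hh : forall u, x <= u <= y -> is_derive h u (dh u)).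
  { intros u Hu. unfold h, dh. assert (H1 := Hd u ltac:(lra)). assert (Hs : 0 < sqrt u) by (apply sqrt_lt_R0; lra).
    auto_derive; [repeat split; try lra; apply Rgt_not_eq; nra|].
    transitivity (- ((2 * a * (sqrt u * sqrt u) + (a * u + t)) / (2 * sqrt u)) / (sqrt u * (a * u + t)) ^ 2).
    - field. split; lra.
    - rewrite sqrt_sqrt by lra. replace (2 * a * u + (a * u + t)) with (3 * a * u + t) by ring. reflexivity. }
  assert (Hpos : forall u, x <= u <= y -> 0 < h u).
  { intros u Hu. assert (H1 := Hd u ltac:(lra)). assert (0 < sqrt u) by (apply sqrt_lt_R0; lra).
    apply Rinv_0_lt_compat; nra. }
  assert (Hmono : - h x <= - h y).
  { apply (derive_nonneg_le (fun u => - h u) (fun u => - dh u)); [lra| |].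
    - intros u Hu; apply (is_derive_opp h); auto.
    - intros u Hu; specialize (Hdh u Hu); lra. }
  set (G := fun w => RInt (osc3 t a q) x w).
  assert (B : Rabs (G y - G x) <= 2 * Rmax (h x) (h y)).
  { apply (first_derivative G h dh (fun w => t * ln w + a * w + q) (fun w => t / w + a)); auto; try lra.
    - intros u Hu. apply (is_derive_eqR _ _ (osc3 t a q u)).
      + exact (is_derive_RInt_osc3 t a q x u (proj1 Hxy) ltac:(lra)).
      + unfold osc3, h. f_equal. assert (H1 := Hd u ltac:(lra)). assert (0 < sqrt u) by (apply sqrt_lt_R0; lra).
        field. repeat split; lra.
    - intros u Hu; apply is_derive_phase; lra.
    - apply Rlt_le, Hpos; lra.
    - apply Rlt_le, Hpos; lra. }
  unfold G at 2 in B. rewrite RInt_point_R in B.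
  rewrite Rminus_0_r, Rmax_left in B by lra. exact B.
Qed.

Lemma is_derive_osc0 t p u : 0 < u ->
  is_derive (osc t 0 p) u (- (/ (u * sqrt u) * (1 / 2 * cos (t * ln u + 0 * u + p) + t * sin (t * ln u + 0 * u + p)))).
Proof.
  intros Hu. unfold osc. assert (Hs : 0 < sqrt u) by (apply sqrt_lt_R0, Hu).
  assert (Eq : u = sqrt u * sqrt u) by (rewrite sqrt_sqrt; lra).
  auto_derive; [repeat split; lra|].
  replace (/ (sqrt u * sqrt u)) with (/ u) by (rewrite <- Eq; reflexivity).
  field. lra.
Qed.

Lemma osc_pair t a p u : osc t a p u + osc t (- a) p u = 2 * cos (a * u) * osc t 0 p u.
Proof.
  unfold osc.
  replace (t * ln u + a * u + p) with ((t * ln u + 0 * u + p) + a * u) by ring.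
  replace (t * ln u + - a * u + p) with ((t * ln u + 0 * u + p) - a * u) by ring.
  rewrite cos_plus, cos_minus. ring.
Qed.

(** The frequencies [n] and [-n] are taken together: their sum is [2 cos (a u)] times the term of
    frequency 0. Integrating the cosine gives [sin (a u)], which vanishes at the integers [N] and
    [b], so there are no boundary terms. The derivative of the other factor is [|s| u^(-3/2)] times
    a cosine shifted by the argument [g] of [1/2 + it], and the product splits into two [osc3]
    without stationary point. The gain [1/n] makes the sum over [n] converge. *)
Lemma osc_high t p (n N b : nat) : 0 < t -> (1 <= n)%nat -> (1 <= N <= b)%nat ->
  t < 2 * PI * INR n * INR N ->
  Rabs (RInt (osc t (2 * PI * INR n) p) (INR N) (INR b) + RInt (osc t (- (2 * PI * INR n)) p) (INR N) (INR b))
   <= Cmod (sc t) / (PI * sqrt (INR N)) *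
     (/ INR n * (/ (2 * PI * INR n * INR N - t) + / (2 * PI * INR n * INR N + t))).
Proof.
  intros Ht Hn HN Hlt. assert (Hpi := PI_RGT_0).
  assert (Hn1 : 1 <= INR n) by (apply (le_INR 1); lia).
  assert (HN1 : 1 <= INR N) by (apply (le_INR 1); lia).
  assert (HNb : INR N <= INR b) by (apply le_INR; lia).
  set (a := 2 * PI * INR n) in *.
  assert (Ha : 0 < a) by (unfold a; nra).
  destruct (polar ((1 / 2, t) : C)) as [g Hg].
  assert (HS : Cmod (1 / 2, t) = Cmod (sc t)).
  { unfold sc, Cmod; simpl; f_equal; ring. }
  rewrite HS in Hg. set (S := Cmod (sc t)) in *.
  assert (Hc : 1 / 2 = S * cos g) by (apply (f_equal fst) in Hg; unfold cis in Hg; simpl in Hg; lra).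
  assert (Hs : t = S * sin g) by (apply (f_equal snd) in Hg; unfold cis in Hg; simpl in Hg; lra).
  assert (HS0 : 0 <= S) by apply Cmod_ge_0.
  set (q1 := p - g - PI / 2). set (q2 := - (p - g) - PI / 2).
  set (Psi := fun u => (RInt (osc t a p) (INR N) u + RInt (osc t (- a) p) (INR N) u)
     - 2 / a * sin (a * u) * osc t 0 p u
     - S / a * (RInt (osc3 t a q1) (INR N) u + RInt (osc3 (- t) a q2) (INR N) u)).
  assert (E : Psi (INR b) = Psi (INR N)).
  { apply (deriv_const_eq Psi (fun u => (osc t a p u + osc t (- a) p u)
      - (2 * cos (a * u) * osc t 0 p u + 2 / a * sin (a * u) *
         (- (/ (u * sqrt u) * (1 / 2 * cos (t * ln u + 0 * u + p) + t * sin (t * ln u + 0 * u + p)))))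
      - (0 * (RInt (osc3 t a q1) (INR N) u + RInt (osc3 (- t) a q2) (INR N) u) +
         S / a * (osc3 t a q1 u + osc3 (- t) a q2 u)))); [lra| |].
    - intros u Hu.
      refine (is_derive_minusR _ _ _ _ _ (is_derive_minusR _ _ _ _ _ (is_derive_plusR _ _ _ _ _ _ _)
        (is_derive_multR _ _ _ _ _ _ _)) (is_derive_multR _ _ _ _ _ (is_derive_cst _ _) (is_derive_plusR _ _ _ _ _ _ _))).
      + apply is_derive_RInt_osc; lra.
      + apply is_derive_RInt_osc; lra.
      + clear - Ha. auto_derive; [auto|field; lra].
      + apply is_derive_osc0; lra.
      + apply is_derive_RInt_osc3; lra.
      + apply is_derive_RInt_osc3; lra.
    - intros u Hu. rewrite osc_pair. unfold osc3, q1, q2.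
      replace (t * ln u + a * u + (p - g - PI / 2)) with (- (PI / 2 - (a * u + ((t * ln u + 0 * u + p) - g)))) by ring.
      replace (- t * ln u + a * u + (- (p - g) - PI / 2)) with (- (PI / 2 - (a * u - ((t * ln u + 0 * u + p) - g)))) by ring.
      rewrite !cos_neg, !cos_shift.
      set (be := t * ln u + 0 * u + p).
      assert (Eb : 1 / 2 * cos be + t * sin be = S * cos (be - g)).
      { rewrite cos_minus. replace (t * sin be) with (S * sin g * sin be) by (rewrite <- Hs; ring).
        rewrite Hc. ring. }
      rewrite Eb, (sin_plus (a * u) (be - g)), (sin_minus (a * u) (be - g)).
      assert (0 < u * sqrt u) by (apply Rmult_lt_0_compat; [lra|apply sqrt_lt_R0; lra]).
      generalize (u * sqrt u) H. intros w Hw. field. lra. }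
  unfold Psi in E. rewrite !RInt_point_R in E.
  assert (Sb : sin (a * INR b) = 0).
  { unfold a. rewrite Rmult_assoc, <- mult_INR. apply sin_2PI_INR. }
  assert (SN : sin (a * INR N) = 0).
  { unfold a. rewrite Rmult_assoc, <- mult_INR. apply sin_2PI_INR. }
  rewrite Sb, SN in E.
  assert (B1 := osc3_bound t a q1 (INR N) (INR b) Ha ltac:(lra) ltac:(nra)).
  assert (B2 := osc3_bound (- t) a q2 (INR N) (INR b) Ha ltac:(lra) ltac:(nra)).
  match goal with |- Rabs ?x <= _ => replace x with
    (S / a * (RInt (osc3 t a q1) (INR N) (INR b) + RInt (osc3 (- t) a q2) (INR N) (INR b))) by lra end.
  assert (HSa : 0 <= S / a) by (apply Rmult_le_pos; [lra|apply Rlt_le, Rinv_0_lt_compat; lra]).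
  rewrite Rabs_mult, (Rabs_pos_eq (S / a)) by lra.
  apply Rle_trans with (S / a * (2 * / (sqrt (INR N) * (a * INR N + t)) + 2 * / (sqrt (INR N) * (a * INR N + - t)))).
  - apply Rmult_le_compat_l; [lra|]. eapply Rle_trans; [apply Rabs_triang|]. lra.
  - apply Req_le. assert (0 < sqrt (INR N)) by (apply sqrt_lt_R0; lra).
    replace (/ INR n) with (2 * PI / a) by (unfold a; field; lra).
    assert (0 < a * INR N) by nra.
    field. repeat split; lra.
Qed.

(* Partial sum of zeta with halved last term and without the main term [N^(1-s)/(1-s)]. *)
Definition Qsum (t : R) (n : nat) : C :=
  Cminus (Cminus (Dsum t n) (Cmult (RtoC (1 / 2)) (pw t (INR n))))
    (Cmult (Cmult (RtoC (INR n)) (pw t (INR n))) (Cinv (Cminus (RtoC 1) (sc t)))).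

Lemma osc_Re t p u : 0 < u -> osc t 0 p u = Re (Cmult (cis p) (pw t u)).
Proof.
  intros Hu. unfold osc, pw.
  replace (Cmult (cis p) (Cmult (RtoC (/ sqrt u)) (cis (t * ln u)))) with
    (Cmult (RtoC (/ sqrt u)) (cis (t * ln u + 0 * u + p))).
  - unfold Re, cis, RtoC; simpl; ring.
  - replace (t * ln u + 0 * u + p) with (p + t * ln u) by ring. rewrite cis_add. ring.
Qed.

Lemma cderiv_pw_primitive t u : 0 < u ->
  cderiv (fun u => Cmult (Cmult (RtoC u) (pw t u)) (Cinv (Cminus (RtoC 1) (sc t)))) u (pw t u).
Proof.
  intros Hu.
  refine (cderiv_eq _ _ _ _ (cderiv_mult _ _ _ _ _ (cderiv_mult _ _ _ _ _
    (cderiv_real (fun u => u) u 1 _) (cderiv_pw t u Hu)) (cderiv_const _ u)) _).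
  - auto_derive; auto.
  - replace ((- (1 / 2), t) : C) with (Copp (sc t)).
    2:{ unfold sc, Copp; simpl; f_equal; ring. }
    rewrite RtoC_inv by lra.
    assert (Hu' : RtoC u <> RtoC 0) by (intros H; apply (f_equal fst) in H; simpl in H; lra).
    generalize (one_minus_sc_neq_0 t). intros Hn. field. split; assumption.
Qed.

Lemma Re_cis_cderiv p F F' u : cderiv F u F' ->
  is_derive (fun u => Re (Cmult (cis p) (F u))) u (Re (Cmult (cis p) F')).
Proof.
  intros H.
  destruct (cderiv_mult (fun _ => cis p) F u _ _ (cderiv_const (cis p) u) H) as [A _].
  refine (is_derive_eqR _ _ _ _ A _). f_equal. ring.
Qed.

Lemma trapezoid_sum t p N m : (1 <= N)%nat ->
  rsum (fun j => 1 / 2 * (osc t 0 p (INR (N + j)) + osc t 0 p (INR (N + S j)))) m =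
  Re (Cmult (cis p) (Cminus (Cminus (Dsum t (N + m)) (Cmult (RtoC (1 / 2)) (pw t (INR (N + m)))))
     (Cminus (Dsum t N) (Cmult (RtoC (1 / 2)) (pw t (INR N)))))).
Proof.
  intros HN. induction m as [|m IH].
  - rewrite Nat.add_0_r. simpl rsum. unfold Re; simpl; ring.
  - rewrite rsum_S, IH, !osc_Re by (apply lt_0_INR; lia).
    replace (N + S m)%nat with (S (N + m)) by lia.
    change (Dsum t (S (N + m))) with (Cplus (Dsum t (N + m)) (pw t (INR (S (N + m))))).
    generalize (pw t (INR (S (N + m)))) (pw t (INR (N + m))) (pw t (INR N)) (Dsum t N) (Dsum t (N + m)).
    intros a b c d e. unfold Re; simpl; field.
Qed.

(** The frequency 0 contributes the primitive [u^(1-s) / (1-s)], which is exactly what [Qsum]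
    subtracts. *)
Lemma finite_poisson t p N m K : (1 <= N)%nat -> (1 <= K)%nat ->
  Rabs (Re (Cmult (cis p) (Cminus (Qsum t (N + m)) (Qsum t N))) -
    rsum (fun j => RInt (osc t (2 * PI * INR (S j)) p) (INR N) (INR (N + m)) +
       RInt (osc t (- (2 * PI * INR (S j))) p) (INR N) (INR (N + m))) K)
  <= INR m * ((1 / 2 + Rabs t) * (16 / INR K * (sqrt (INR K + 1) - 1))).
Proof.
  intros HN HK. assert (HN1 : 1 <= INR N) by (apply (le_INR 1); lia).
  set (P := fun u => Cmult (Cmult (RtoC u) (pw t u)) (Cinv (Cminus (RtoC 1) (sc t)))).
  set (G := fun u => Re (Cmult (cis p) (P u)) + rsum (fun j => RInt (osc t (2 * PI * INR (S j)) p) (INR N) u +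
       RInt (osc t (- (2 * PI * INR (S j))) p) (INR N) u) K).
  assert (H := poisson_sum (osc t 0 p)
    (fun u => - (/ (u * sqrt u) * (1 / 2 * cos (t * ln u + 0 * u + p) + t * sin (t * ln u + 0 * u + p))))
    G K N m (1 / 2 + Rabs t) HK).
  rewrite trapezoid_sum in H by exact HN.
  eapply Rle_trans; [|apply H; clear H].
  - apply Req_le; f_equal. unfold G.
    replace (rsum (fun j => RInt (osc t (2 * PI * INR (S j)) p) (INR N) (INR N) +
       RInt (osc t (- (2 * PI * INR (S j))) p) (INR N) (INR N)) K) with 0.
    2:{ symmetry. rewrite (rsum_ext _ (fun _ => 0)); [rewrite rsum_const; ring|].
        intros j _. rewrite !RInt_point_R; ring. }
    unfold Qsum. fold (P (INR N)) (P (INR (N + m))).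
    generalize (P (INR (N + m))) (P (INR N)) (pw t (INR (N + m))) (pw t (INR N)) (Dsum t N) (Dsum t (N + m)).
    intros a b c d e f. unfold Re; simpl; ring.
  - intros u Hu; apply is_derive_osc0; lra.
  - intros u Hu. rewrite Rabs_Ropp, Rabs_mult.
    assert (Hs : 1 <= sqrt u) by (rewrite <- sqrt_1; apply sqrt_le_1; lra).
    assert (Hi : 0 < / (u * sqrt u) <= 1).
    { split; [apply Rinv_0_lt_compat; nra|]. rewrite <- Rinv_1. apply Rinv_le_contravar; nra. }
    rewrite (Rabs_pos_eq (/ _)) by lra.
    set (be := t * ln u + 0 * u + p).
    assert (Rabs (1 / 2 * cos be + t * sin be) <= 1 / 2 + Rabs t).
    { eapply Rle_trans; [apply Rabs_triang|]. rewrite !Rabs_mult, (Rabs_pos_eq (1 / 2)) by lra.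
      assert (Rabs (cos be) <= 1) by (apply Rabs_le; destruct (COS_bound be); lra).
      assert (Rabs (sin be) <= 1) by (apply Rabs_le; destruct (SIN_bound be); lra).
      generalize (Rabs_pos t). nra. }
    generalize (Rabs_pos (1 / 2 * cos be + t * sin be)). nra.
  - intros u Hu.
    refine (is_derive_eqR _ _ _ _ (is_derive_plusR _ _ _ _ _
      (Re_cis_cderiv p P _ u (cderiv_pw_primitive t u _))
      (is_derive_rsum (fun j u => RInt (osc t (2 * PI * INR (S j)) p) (INR N) u +
         RInt (osc t (- (2 * PI * INR (S j))) p) (INR N) u)
        (fun j u => osc t (2 * PI * INR (S j)) p u + osc t (- (2 * PI * INR (S j))) p u) K u _)) _).
    + lra.
    + intros j _. apply is_derive_plusR; apply is_derive_RInt_osc; lra.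
    + rewrite <- osc_Re by lra. unfold dir.
      rewrite (rsum_ext _ (fun j => osc t 0 p u * (2 * cos (2 * PI * INR (S j) * u)))).
      * rewrite rsum_mult_l. ring.
      * intros j _. rewrite osc_pair. ring.
Qed.

Lemma Qsum_limit t z : is_zeta_conj t z -> exists B, forall n,
  Cmod (Cminus (Qsum t (S n)) z) <= B * / sqrt (INR (S n)).
Proof.
  intros Hz. destruct (Dsum_asymp t z Hz) as [B HB]. exists (B + 1 / 2). intros n.
  specialize (HB n). unfold Qsum.
  match type of HB with Cmod ?x <= _ => set (A := x) in * end.
  replace (Cminus _ z) with (Cplus A (Copp (Cmult (RtoC (1 / 2)) (pw t (INR (S n)))))) by (unfold A; ring).
  eapply Rle_trans; [apply Cmod_triangle|].
  rewrite Cmod_opp, Cmod_mult, Cmod_pw, Cmod_R, Rabs_pos_eq by (try lra; apply INR_S_pos). lra.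
Qed.

Lemma sqrt_scale_div nu x d : 0 < nu -> 0 < x ->
  / sqrt nu * (2 * (sqrt (nu * x) / d)) = 2 * sqrt x / d.
Proof.
  intros Hnu Hx. rewrite sqrt_mult by lra.
  assert (0 < sqrt nu) by (apply sqrt_lt_R0; lra).
  unfold Rdiv. transitivity ((/ sqrt nu * sqrt nu) * (2 * sqrt x * / d)); [ring|].
  rewrite Rinv_l by lra. ring.
Qed.

(** The stationary contributions add up to a rotation of [X] times the conjugate of [Dsum t k]. The
    phase of [X] is therefore irrelevant to the bound. *)
Lemma dual_sum_le t p X k : Cmod X <= 1 ->
  rsum (fun j => / sqrt (INR (S j)) * Re (Cmult (cis (p - t * ln (INR (S j)))) X)) k <= Cmod (Dsum t k).
Proof.
  intros HX.
  assert (E : forall n, rsum (fun j => / sqrt (INR (S j)) * Re (Cmult (cis (p - t * ln (INR (S j)))) X)) n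
     = Re (Cmult (cis p) (Cmult X (Cconj (Dsum t n))))).
  { induction n as [|n IH].
    - unfold Dsum; simpl. unfold Re; simpl; ring.
    - rewrite rsum_S, IH. change (Dsum t (S n)) with (Cplus (Dsum t n) (pw t (INR (S n)))).
      unfold Rminus. rewrite cis_add, cis_opp. unfold pw.
      generalize (INR (S n)) (Dsum t n); intros r d. unfold Re, cis; simpl; ring. }
  rewrite E. eapply Rle_trans; [apply Re_rot_le|].
  rewrite Cmod_mult, Cmod_conj. generalize (Cmod_ge_0 (Dsum t k)). nra.
Qed.

(** The stationary point [t / (2 pi n)] of the frequency [-n] lies between [N] and [b], so rescaling
    turns that integral into [X] up to its two tails. The frequency [n] has no stationary point and
    costs [1 / sqrt (2 pi n t)]. *)
Lemma osc_stationary t p X (n N b : nat) : 0 < t -> is_X t X -> (1 <= n)%nat -> (1 <= N <= b)%nat ->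
  2 * PI * INR n * INR N < t -> t < INR b ->
  RInt (osc t (2 * PI * INR n) p) (INR N) (INR b) + RInt (osc t (- (2 * PI * INR n)) p) (INR N) (INR b)
  <= / sqrt (INR n) * Re (Cmult (cis (p - t * ln (INR n))) X) + / sqrt (2 * PI * INR n * t)
     + 2 * sqrt (INR N) / (t - 2 * PI * INR n * INR N) + 2 * / sqrt (INR b).
Proof.
  intros Ht HX Hn HN Hlt Htb. assert (Hpi := PI_RGT_0). assert (H3 := PI2_3_2).
  assert (Hn1 : 1 <= INR n) by (apply (le_INR 1); lia).
  assert (HN1 : 1 <= INR N) by (apply (le_INR 1); lia).
  assert (HNb : INR N <= INR b) by (apply le_INR; lia).
  set (nu := INR n) in *. set (x := INR N) in *. set (y := INR b) in *.
  assert (A1 := osc_plus t (2 * PI * nu) p x y Ht ltac:(nra) ltac:(lra)).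
  apply Rabs_le_between in A1.
  rewrite osc_scale, (osc_rot t (- (2 * PI))) by nra.
  assert (Hxy : 0 < nu * x <= nu * y) by (split; nra).
  assert (Hlt' : 2 * PI * (nu * x) < t) by lra.
  assert (Hny : 6 * (1 * y) <= 2 * PI * (nu * y)) by (apply Rmult_le_compat; nra).
  assert (Htb' : t < 2 * PI * (nu * y)) by lra.
  specialize (HX (nu * x) (nu * y) Hxy Hlt' Htb').
  set (O := oscC t (- (2 * PI)) (nu * x) (nu * y)) in *.
  set (q := p - t * ln nu).
  assert (A2 : Re (Cmult (cis q) O) <= Re (Cmult (cis q) X) + Cmod (Cminus X O)).
  { generalize (Re_rot_le (Copp (Cminus X O)) q). rewrite Cmod_opp.
    replace (Re (Cmult (cis q) (Copp (Cminus X O)))) with (Re (Cmult (cis q) O) - Re (Cmult (cis q) X)).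
    - lra.
    - unfold Re; simpl; ring. }
  assert (Hs : 0 < / sqrt nu) by (apply Rinv_0_lt_compat, sqrt_lt_R0; lra).
  assert (A3 : / sqrt nu * Re (Cmult (cis q) O) <= / sqrt nu * Re (Cmult (cis q) X) +
    (/ sqrt nu * (2 * (sqrt (nu * x) / (t - 2 * PI * (nu * x)))) +
     / sqrt nu * (2 * (sqrt (nu * y) / (2 * PI * (nu * y) - t))))).
  { assert (A2' := Rplus_le_compat_l (Re (Cmult (cis q) X)) _ _ HX).
    assert (A2'' := Rmult_le_compat_l _ _ _ (Rlt_le _ _ Hs) (Rle_trans _ _ _ A2 A2')).
    eapply Rle_trans; [exact A2''|]. apply Req_le; ring. }
  rewrite !sqrt_scale_div in A3 by lra.
  assert (A4 : 2 * sqrt y / (2 * PI * (nu * y) - t) <= 2 * / sqrt y).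
  { assert (Hsy : 0 < sqrt y) by (apply sqrt_lt_R0; lra).
    apply Rle_trans with (2 * sqrt y * / y).
    - apply Rmult_le_compat_l; [lra|]. apply Rinv_le_contravar; lra.
    - rewrite <- (sqrt_sqrt y) at 2 by lra. apply Req_le; field; lra. }
  replace (2 * PI * (nu * x)) with (2 * PI * nu * x) in A3 by ring.  lra.
Qed.

(** Two limits are taken in turn. For a fixed end point [N + m] the number of frequencies grows
    until the sawtooth error is negligible; then [m] grows and [Qsum t (N + m)] tends to [z]. The
    bound [V] of the high frequencies is left abstract because the later ranges estimate it
    differently. *)
Lemma approximate_functional_equation t z (N k : nat) V : is_zeta_conj t z -> 0 < t -> (1 <= N)%nat ->
  2 * PI * INR k * INR N < t -> t < 2 * PI * INR (S k) * INR N ->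
  (forall m, rsum (fun j => / INR (S (k + j)) *
     (/ (2 * PI * INR (S (k + j)) * INR N - t) + / (2 * PI * INR (S (k + j)) * INR N + t))) m <= V) ->
  Cmod (Cminus z (Qsum t N)) <= Cmod (Dsum t k)
    + rsum (fun j => / sqrt (2 * PI * INR (S j) * t)) k
    + rsum (fun j => 2 * sqrt (INR N) / (t - 2 * PI * INR (S j) * INR N)) k
    + Cmod (sc t) / (PI * sqrt (INR N)) * V.
Proof.
  intros Hz Ht HN Hk HSk HV. assert (Hpi := PI_RGT_0).
  assert (HN1 : 1 <= INR N) by (apply (le_INR 1); lia).
  destruct (X_exists t Ht) as [X HX]. assert (HX1 := X_bound t X Ht HX).
  destruct (Qsum_limit t z Hz) as [B HB].
  apply Cmod_le_rot; intros p.
  match goal with |- _ <= ?R => set (RHS := R) end.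
  set (Cs := Cmod (sc t) / (PI * sqrt (INR N))) in *.
  assert (HCs : 0 <= Cs).
  { unfold Cs. apply Rmult_le_pos; [apply Cmod_ge_0|]. apply Rlt_le, Rinv_0_lt_compat.
    apply Rmult_lt_0_compat; [lra|apply sqrt_lt_R0; lra]. }
  (* the bound for finite [b = N + m], after the number of frequencies tends to infinity *)
  assert (Hfin : forall m, t < INR (N + m) ->
    Re (Cmult (cis p) (Cminus (Qsum t (N + m)) (Qsum t N))) <= RHS + INR k * (2 * / sqrt (INR (N + m)))).
  { intros m Hm. apply le_epsilon. intros e He.
    set (c := INR m * ((1 / 2 + Rabs t) * 32)).
    assert (Hc : 0 <= c) by (unfold c; generalize (pos_INR m) (Rabs_pos t); nra).
    destruct (Un_cv_inv_sqrt (e / (c + 1))) as [K0 HK0]; [apply Rdiv_lt_0_compat; lra|].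
    specialize (HK0 (k + K0)%nat ltac:(lia)). unfold R_dist in HK0.
    rewrite Rminus_0_r in HK0. apply (Rle_lt_trans _ _ _ (Rle_abs _)) in HK0.
    set (K := S (k + K0)) in *.
    assert (HK1 : 1 <= INR K) by (apply (le_INR 1); unfold K; lia).
    assert (FP := finite_poisson t p N m K HN ltac:(unfold K; lia)).
    assert (Heps : INR m * ((1 / 2 + Rabs t) * (16 / INR K * (sqrt (INR K + 1) - 1))) <= e).
    { assert (HsK : 0 < sqrt (INR K)) by (apply sqrt_lt_R0; lra).
      assert (EK : sqrt (INR K) * sqrt (INR K) = INR K) by (apply sqrt_sqrt; lra).
      assert (Hs2 : sqrt (INR K + 1) <= 2 * sqrt (INR K)).
      { replace (2 * sqrt (INR K)) with (sqrt (4 * INR K)).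
        - apply sqrt_le_1; lra.
        - rewrite sqrt_mult by lra. replace 4 with (2 * 2) by ring. rewrite sqrt_square by lra. reflexivity. }
      assert (Hin : 16 / INR K * (sqrt (INR K + 1) - 1) <= 32 * / sqrt (INR K)).
      { replace (32 * / sqrt (INR K)) with (16 / INR K * (2 * sqrt (INR K))).
        - apply Rmult_le_compat_l; [|lra]. apply Rmult_le_pos; [lra|apply Rlt_le, Rinv_0_lt_compat; lra].
        - rewrite <- EK at 1. field; lra. }
      apply Rle_trans with (c * / sqrt (INR K)).
      - unfold c. rewrite !Rmult_assoc. apply Rmult_le_compat_l; [apply pos_INR|].
        apply Rmult_le_compat_l; [generalize (Rabs_pos t); lra|exact Hin].
      - assert (0 < / sqrt (INR K)) by (apply Rinv_0_lt_compat; lra).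
        apply (Rmult_lt_compat_l (c + 1)) in HK0; [|lra].
        replace ((c + 1) * (e / (c + 1))) with e in HK0 by (field; lra). nra. }
    unfold K in FP at 1. rewrite <- Nat.add_succ_r, rsum_app in FP.
    match type of FP with Rabs (_ - (?a + ?b)) <= _ => set (low := a) in *; set (high := b) in * end.
    assert (Hhigh : high <= Cs * V).
    { apply Rle_trans with (Cs * rsum (fun j => / INR (S (k + j)) *
       (/ (2 * PI * INR (S (k + j)) * INR N - t) + / (2 * PI * INR (S (k + j)) * INR N + t))) (S K0)).
      - rewrite <- rsum_mult_l. apply rsum_le. intros j _.
        eapply Rle_trans; [apply Rle_abs|]. apply osc_high; try lia; try lra.
        apply Rlt_le_trans with (2 * PI * INR (S k) * INR N); [exact HSk|].
        apply Rmult_le_compat_r; [lra|]. apply Rmult_le_compat_l; [lra|]. apply le_INR; lia.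
      - apply Rmult_le_compat_l; [exact HCs|apply HV]. }
    assert (Hlow : low <= rsum (fun j => / sqrt (INR (S j)) * Re (Cmult (cis (p - t * ln (INR (S j)))) X)) k
      + rsum (fun j => / sqrt (2 * PI * INR (S j) * t)) k
      + rsum (fun j => 2 * sqrt (INR N) / (t - 2 * PI * INR (S j) * INR N)) k
      + INR k * (2 * / sqrt (INR (N + m)))).
    { rewrite <- rsum_const, <- !rsum_plus. apply rsum_le. intros j Hj.
      apply osc_stationary; try lia; try assumption.
      apply Rle_lt_trans with (2 * PI * INR k * INR N); [|exact Hk].
      apply Rmult_le_compat_r; [lra|]. apply Rmult_le_compat_l; [lra|]. apply le_INR; lia. }
    assert (Hdual := dual_sum_le t p X k HX1).
    apply Rabs_le_between in FP. unfold RHS. lra. }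
  apply le_epsilon. intros e He.
  set (B' := Rabs B + 2 * INR k).
  assert (HB' : 0 <= B') by (unfold B'; generalize (Rabs_pos B) (pos_INR k); lra).
  destruct (Un_cv_inv_sqrt (e / (B' + 1))) as [M0 HM0]; [apply Rdiv_lt_0_compat; lra|].
  destruct (INR_unbounded t) as [M1 HM1].
  set (m := S (M0 + M1)).
  assert (Hb : (N + m)%nat = S (N + M0 + M1)) by (unfold m; lia).
  specialize (Hfin m). specialize (HB (N + M0 + M1)%nat). specialize (HM0 (N + M0 + M1)%nat ltac:(lia)).
  rewrite <- Hb in *. unfold R_dist in HM0.
  rewrite Rminus_0_r in HM0. apply (Rle_lt_trans _ _ _ (Rle_abs _)) in HM0.
  assert (t < INR (N + m)).
  { eapply Rlt_le_trans; [exact HM1|]. apply le_INR; lia. }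
  specialize (Hfin H).
  assert (Hsm : 0 < / sqrt (INR (N + m))) by (apply Rinv_0_lt_compat, sqrt_lt_R0, lt_0_INR; lia).
  assert (A : Re (Cmult (cis p) (Cminus z (Qsum t N))) <=
     Re (Cmult (cis p) (Cminus (Qsum t (N + m)) (Qsum t N))) + Cmod (Cminus (Qsum t (N + m)) z)).
  { generalize (Re_rot_le (Copp (Cminus (Qsum t (N + m)) z)) p). rewrite Cmod_opp.
    replace (Re (Cmult (cis p) (Copp (Cminus (Qsum t (N + m)) z)))) with
      (Re (Cmult (cis p) (Cminus z (Qsum t N))) - Re (Cmult (cis p) (Cminus (Qsum t (N + m)) (Qsum t N)))).
    - lra.
    - unfold Re; simpl; ring. }
  apply (Rmult_lt_compat_l (B' + 1)) in HM0; [|lra].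
  replace ((B' + 1) * (e / (B' + 1))) with e in HM0 by (field; lra).
  assert (B * / sqrt (INR (N + m)) <= Rabs B * / sqrt (INR (N + m))).
  { apply Rmult_le_compat_r; [lra|apply Rle_abs]. }
  unfold B' in HM0. lra.
Qed.

(** * Van der Corput's method *)

Lemma cis_turns x z : cis (x + 2 * PI * IZR z) = cis x.
Proof.
  assert (H : forall n, cis (x + 2 * PI * INR n) = cis x).
  { intros n; unfold cis; rewrite cos_add_turns, sin_add_turns; reflexivity. }
  assert (H' : forall y n, cis (y + 2 * PI * INR n) = cis y).
  { intros y n; unfold cis; rewrite cos_add_turns, sin_add_turns; reflexivity. }
  destruct (Z_le_gt_dec 0 z) as [Hz|Hz].
  - rewrite <- (Z2Nat.id z Hz), <- INR_IZR_INZ. apply H.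
  - replace z with (- Z.of_nat (Z.to_nat (- z)))%Z by (rewrite Z2Nat.id; lia).
    rewrite opp_IZR, <- INR_IZR_INZ.
    rewrite <- (H' (x + 2 * PI * - INR (Z.to_nat (- z))) (Z.to_nat (- z))).
    f_equal. ring.
Qed.

Lemma abel_telescope (E c : nat -> C) L :
  csum (fun n => Cmult (Cminus (E n) (E (S n))) (c n)) (S L) =
  Cplus (Cminus (Cmult (E O) (c O)) (Cmult (E (S L)) (c L)))
    (csum (fun n => Cmult (E (S n)) (Cminus (c (S n)) (c n))) L).
Proof.
  induction L as [|L IH].
  - simpl. ring.
  - rewrite csum_S, IH, (csum_S _ L). ring.
Qed.

(** The left side is [cot (x/2)]. Cleared of denominators the claim is [2 sin x - x - x cos x >= 0],
    which follows from two differentiations. *)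
Lemma half_angle_bound x : 0 < x <= PI / 2 -> (1 + cos x) / sin x <= 2 / x.
Proof.
  intros Hx. assert (Hs : 0 < sin x) by (apply sin_gt_0; lra).
  assert (D2 : forall y, 0 <= y <= x -> 0 <= cos y - 1 + y * sin y).
  { intros y Hy.
    replace 0 with ((fun y => cos y - 1 + y * sin y) 0) at 1 by (rewrite cos_0; ring).
    apply (derive_nonneg_le (fun y => cos y - 1 + y * sin y) (fun y => y * cos y)); [lra| |].
    - intros u Hu. auto_derive; [auto|ring].
    - intros u Hu. apply Rmult_le_pos; [lra|apply cos_ge_0; lra]. }
  assert (D1 : 0 <= 2 * sin x - x - x * cos x).
  { replace 0 with ((fun y => 2 * sin y - y - y * cos y) 0) at 1 by (rewrite sin_0, cos_0; ring).
    apply (derive_nonneg_le (fun y => 2 * sin y - y - y * cos y) (fun y => cos y - 1 + y * sin y)); [lra| |].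
    - intros u Hu. auto_derive; [auto|ring].
    - intros u Hu. apply D2; lra. }
  apply (Rmult_le_reg_r (sin x * x)); [nra|].
  replace ((1 + cos x) / sin x * (sin x * x)) with ((1 + cos x) * x) by (field; lra).
  replace (2 / x * (sin x * x)) with (2 * sin x) by (field; lra). lra.
Qed.

(* [1 / (1 - cis (2 pi g))] *)
Definition kl_coef (g : R) : C := (1 / 2, cos (PI * g) / (2 * sin (PI * g))).

Lemma kl_coef_spec g : sin (PI * g) <> 0 ->
  Cmult (Cminus (RtoC 1) (cis (2 * PI * g))) (kl_coef g) = RtoC 1.
Proof.
  intros Hs. unfold kl_coef, cis. replace (2 * PI * g) with (2 * (PI * g)) by ring.
  rewrite cos_2a, sin_2a. generalize (sin2_cos2 (PI * g)). unfold Rsqr.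
  set (s := sin (PI * g)) in *. set (c := cos (PI * g)). intros E.
  assert (Ec : c * c = 1 - s * s) by lra.
  apply injective_projections; unfold RtoC, Cmult, Cminus, Cplus, Copp; simpl.
  - replace (c * c - s * s) with (1 - 2 * (s * s)) by lra. field_simplify; [|exact Hs].
    replace (c ^ 2) with (1 - s * s) by (simpl; lra). field; exact Hs.
  - replace (c * c - s * s) with (1 - 2 * (s * s)) by lra. field. exact Hs.
Qed.

Lemma Cmod_kl_coef g : 0 < sin (PI * g) -> Cmod (kl_coef g) = / (2 * sin (PI * g)).
Proof.
  intros Hs. unfold Cmod, kl_coef; simpl fst; simpl snd.
  generalize (sin2_cos2 (PI * g)). unfold Rsqr.
  set (s := sin (PI * g)) in *. set (c := cos (PI * g)). intros E.
  replace ((1 / 2) ^ 2 + (c / (2 * s)) ^ 2) with ((/ (2 * s)) * (/ (2 * s))).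
  - apply sqrt_square. apply Rlt_le, Rinv_0_lt_compat; lra.
  - transitivity ((s * s + c * c) * (/ (2 * s) * / (2 * s))).
    + rewrite E; ring.
    + field; lra.
Qed.

Lemma cot_decr x y : 0 < x <= y -> y < PI -> cos y / (2 * sin y) <= cos x / (2 * sin x).
Proof.
  intros Hxy Hy. assert (Hs : forall u, x <= u <= y -> 0 < sin u) by (intros; apply sin_gt_0; lra).
  assert (- (cos x / (2 * sin x)) <= - (cos y / (2 * sin y))); [|lra].
  apply (derive_nonneg_le (fun u => - (cos u / (2 * sin u))) (fun u => / (2 * (sin u * sin u)))); [lra| |].
  - intros u Hu. specialize (Hs u Hu). auto_derive; [lra|].
    generalize (sin2_cos2 u); unfold Rsqr; intros E.
    transitivity ((sin u * sin u + cos u * cos u) * / (2 * (sin u * sin u))).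
    + field; lra.
    + rewrite E; ring.
  - intros u Hu. specialize (Hs u Hu). apply Rlt_le, Rinv_0_lt_compat; nra.
Qed.

(** Every term is a difference of consecutive terms times [kl_coef (g n)], and Abel summation moves
    the differences to the coefficients. These have constant real part 1/2, so their variation is
    that of the monotone cotangent and telescopes. The total [1 / sin (pi d) + cot (pi d)] equals
    [cot (pi d / 2)]. *)
Lemma kusmin_landau0 (phi : nat -> R) (L : nat) (d : R) :
  0 < d <= 1 / 2 ->
  (forall n, (n < L)%nat -> d <= phi (S n) - phi n <= 1 - d) ->
  (forall n, (S n < L)%nat -> phi (S n) - phi n <= phi (S (S n)) - phi (S n)) ->
  Cmod (csum (fun n => cis (2 * PI * phi n)) L) <= 2 / (PI * d).
Proof.
  intros Hd Hg Hm. assert (Hpi := PI_RGT_0).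
  destruct L as [|L].
  { simpl. rewrite Cmod_0. apply Rlt_le, Rdiv_lt_0_compat; nra. }
  set (g := fun n => phi (S n) - phi n) in *.
  assert (Hrange : forall n, (n < S L)%nat -> PI * d <= PI * g n <= PI - PI * d).
  { intros n Hn. specialize (Hg n Hn). unfold g. nra. }
  assert (Hsin : forall n, (n < S L)%nat -> sin (PI * d) <= sin (PI * g n)).
  { intros n Hn. specialize (Hrange n Hn). assert (HdP : PI * d <= PI / 2) by nra.
    destruct (Rle_dec (PI * g n) (PI / 2)).
    - apply sin_incr_1; nra.
    - rewrite <- (sin_PI_x (PI * g n)). apply sin_incr_1; nra. }
  assert (Hsd : 0 < sin (PI * d)) by (apply sin_gt_0; nra).
  rewrite (csum_ext _ (fun n => Cmult (Cminus (cis (2 * PI * phi n)) (cis (2 * PI * phi (S n)))) (kl_coef (g n)))).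
  2:{ intros n Hn. replace (2 * PI * phi (S n)) with (2 * PI * phi n + 2 * PI * g n) by (unfold g; ring).
      rewrite cis_add. specialize (Hsin n Hn).
      transitivity (Cmult (cis (2 * PI * phi n)) (Cmult (Cminus (RtoC 1) (cis (2 * PI * g n))) (kl_coef (g n)))).
      - rewrite kl_coef_spec by lra. ring.
      - ring. }
  rewrite (abel_telescope (fun n => cis (2 * PI * phi n)) (fun n => kl_coef (g n))).
  eapply Rle_trans; [apply Cmod_triangle|].
  assert (B1 : forall n, (n < S L)%nat -> Cmod (kl_coef (g n)) <= / (2 * sin (PI * d))).
  { intros n Hn. specialize (Hsin n Hn). rewrite Cmod_kl_coef by lra. apply Rinv_le_contravar; lra. }
  assert (B2 : Cmod (Cminus (Cmult (cis (2 * PI * phi 0%nat)) (kl_coef (g 0%nat)))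
      (Cmult (cis (2 * PI * phi (S L))) (kl_coef (g L)))) <= / sin (PI * d)).
  { eapply Rle_trans; [apply Cmod_minus_le|]. rewrite !Cmod_mult, !Cmod_cis, !Rmult_1_l.
    generalize (B1 0%nat ltac:(lia)) (B1 L ltac:(lia)).
    replace (/ sin (PI * d)) with (/ (2 * sin (PI * d)) + / (2 * sin (PI * d))) by (field; lra). lra. }
  set (ct := fun x => cos (PI * x) / (2 * sin (PI * x))).
  assert (B3 : forall l, (l <= L)%nat ->
    Cmod (csum (fun n => Cmult (cis (2 * PI * phi (S n))) (Cminus (kl_coef (g (S n))) (kl_coef (g n)))) l)
     <= ct (g 0%nat) - ct (g l)).
  { induction l as [|l IH]; intros Hl.
    - simpl. rewrite Cmod_0; lra.
    - rewrite csum_S. eapply Rle_trans; [apply Cmod_triangle|].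
      specialize (IH ltac:(lia)). rewrite Cmod_mult, Cmod_cis, Rmult_1_l.
      replace (Cminus (kl_coef (g (S l))) (kl_coef (g l))) with (Cmult (0, 1) (RtoC (ct (g (S l)) - ct (g l)))).
      2:{ unfold kl_coef, ct. apply injective_projections; simpl; ring. }
      rewrite Cmod_mult, Cmod_R. replace (Cmod (0, 1)) with 1 by (symmetry; exact Cmod_Ci).
      assert (ct (g (S l)) <= ct (g l)).
      { apply cot_decr.
        - generalize (Hrange l ltac:(lia)) (Hm l ltac:(lia)). unfold g. nra.
        - generalize (Hrange (S l) ltac:(lia)). nra. }
      rewrite Rabs_left1 by lra. lra. }
  specialize (B3 L ltac:(lia)).
  assert (C0 : ct (g 0%nat) <= ct d).
  { apply cot_decr; generalize (Hrange 0%nat ltac:(lia)); nra. }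
  assert (CL : - ct d <= ct (g L)).
  { replace (- ct d) with (ct (1 - d)).
    - apply cot_decr; generalize (Hrange L ltac:(lia)); nra.
    - unfold ct. replace (PI * (1 - d)) with (PI - PI * d) by ring.
      rewrite <- sin_PI_x. replace (PI - (PI - PI * d)) with (PI * d) by ring.
      replace (cos (PI - PI * d)) with (- cos (PI * d)).
      + field; lra.
      + replace (PI - PI * d) with (- (PI * d) + PI) by ring. rewrite neg_cos, cos_neg; reflexivity. }
  assert (HB := half_angle_bound (PI * d) ltac:(nra)).
  assert (Ef : / sin (PI * d) + 2 * ct d = (1 + cos (PI * d)) / sin (PI * d)) by (unfold ct; field; lra).
  lra.
Qed.

Lemma kusmin_landau (phi : nat -> R) (L : nat) (d : R) (z : Z) :
  0 < d <= 1 / 2 ->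
  (forall n, (n < L)%nat -> IZR z + d <= phi (S n) - phi n <= IZR z + 1 - d) ->
  (forall n, (S n < L)%nat -> phi (S n) - phi n <= phi (S (S n)) - phi (S n)) ->
  Cmod (csum (fun n => cis (2 * PI * phi n)) L) <= 2 / (PI * d).
Proof.
  intros Hd Hg Hm.
  rewrite (csum_ext _ (fun n => cis (2 * PI * (phi n - INR n * IZR z)))).
  - apply kusmin_landau0; [exact Hd| |].
    + intros n Hn. specialize (Hg n Hn). rewrite S_INR. lra.
    + intros n Hn. specialize (Hm n Hn). rewrite !S_INR. lra.
  - intros n _. rewrite INR_IZR_INZ, <- mult_IZR.
    rewrite <- (cis_turns (2 * PI * (phi n - IZR (Z.of_nat n * z))) (Z.of_nat n * z)). f_equal; ring.
Qed.

Lemma monotone_split (g : nat -> R) (c : R) (L : nat) :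
  (forall n, (S n < L)%nat -> g n <= g (S n)) ->
  exists l, (l <= L)%nat /\ (forall n, (n < l)%nat -> g n < c) /\
    (forall n, (l <= n < L)%nat -> c <= g n).
Proof.
  induction L as [|L IH]; intros Hm.
  - exists 0%nat; repeat split; intros; lia.
  - destruct IH as [l [Hl [H1 H2]]]; [intros; apply Hm; lia|].
    destruct (Nat.eq_dec l L) as [->|Hne].
    + destruct (Rlt_dec (g L) c) as [Hc|Hc].
      * exists (S L); repeat split; [lia| |intros; lia].
        intros n Hn. destruct (Nat.eq_dec n L) as [->|]; [exact Hc|apply H1; lia].
      * exists L; repeat split; [lia|exact H1|].
        intros n Hn. replace n with L by lia. lra.
    + exists l; repeat split; [lia|exact H1|].
      intros n Hn. destruct (Nat.eq_dec n L) as [->|]; [|apply H2; lia].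
      destruct L as [|L']; [lia|]. apply Rle_trans with (g L').
      * apply H2; lia.
      * apply Hm; lia.
Qed.

Lemma Cmod_csum_cis_le (f : nat -> R) n : Cmod (csum (fun k => cis (f k)) n) <= INR n.
Proof.
  eapply Rle_trans; [apply Cmod_csum|]. rewrite (rsum_ext _ (fun _ => 1)).
  - rewrite rsum_const; lra.
  - intros; apply Cmod_cis.
Qed.

Lemma gap_count (g : nat -> R) (lam : R) L : (1 <= L)%nat ->
  (forall n, (S n < L)%nat -> g n + lam <= g (S n)) ->
  (INR L - 1) * lam <= g (pred L) - g 0%nat.
Proof.
  destruct L as [|L]; [lia|]. intros _. simpl pred. rewrite S_INR.
  induction L as [|L IH]; intros H.
  - simpl; lra.
  - specialize (IH (fun n Hn => H n ltac:(lia))). specialize (H L ltac:(lia)). rewrite S_INR. lra.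
Qed.

(* For each integer [z], the differences in [z - d, z + d) are few because they are [lam]-spaced,
   and those in [z + d, z + 1 - d) are treated by Kusmin-Landau. *)
Lemma second_derivative_pieces (lam d : R) (p : nat) : 0 < lam -> 0 < d <= 1 / 2 ->
  forall (phi : nat -> R) (L : nat) (z : Z),
  (forall n, (S n < L)%nat -> (phi (S n) - phi n) + lam <= phi (S (S n)) - phi (S n)) ->
  (forall n, (n < L)%nat -> IZR z - d <= phi (S n) - phi n < IZR z + INR p - d) ->
  Cmod (csum (fun n => cis (2 * PI * phi n)) L) <= INR p * (2 * d / lam + 1 + 2 / (PI * d)).
Proof.
  intros Hlam Hd. assert (Hpi := PI_RGT_0).
  induction p as [|p IH]; intros phi L z Hstep Hran.
  - destruct L as [|L]; [simpl; rewrite Cmod_0; lra|].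
    specialize (Hran 0%nat ltac:(lia)). simpl INR in Hran. lra.
  - set (g := fun n => phi (S n) - phi n) in *.
    assert (Hmono : forall n, (S n < L)%nat -> g n <= g (S n)).
    { intros n Hn. specialize (Hstep n Hn). unfold g. lra. }
    destruct (monotone_split g (IZR z + 1 - d) L Hmono) as [l1 [Hl1 [A1 A2]]].
    destruct (monotone_split g (IZR z + d) l1) as [l0 [Hl0 [B1 B2]]].
    { intros; apply Hmono; lia. }
    replace L with (l0 + (l1 - l0) + (L - l1))%nat by lia.
    rewrite !csum_app. rewrite S_INR, Rmult_plus_distr_r, Rmult_1_l.
    eapply Rle_trans; [apply Cmod_triangle|]. rewrite Rplus_comm. apply Rplus_le_compat.
    + replace (l0 + (l1 - l0))%nat with l1 by lia.
      apply (IH (fun k => phi (l1 + k)%nat) (L - l1)%nat (z + 1)%Z).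
      * intros n Hn. rewrite !Nat.add_succ_r. apply Hstep; lia.
      * intros n Hn. rewrite !Nat.add_succ_r, plus_IZR.
        generalize (A2 (l1 + n)%nat ltac:(lia)) (Hran (l1 + n)%nat ltac:(lia)). rewrite S_INR. unfold g. lra.
    + eapply Rle_trans; [apply Cmod_triangle|]. apply Rplus_le_compat.
      * eapply Rle_trans; [apply (Cmod_csum_cis_le (fun k => 2 * PI * phi k))|].
        destruct l0 as [|l0].
        { simpl INR. assert (0 < 2 * d / lam) by (apply Rdiv_lt_0_compat; lra). lra. }
        assert (G := gap_count g lam (S l0) ltac:(lia)
          (fun n Hn => Hstep n ltac:(lia))). simpl pred in G.
        assert (g l0 < IZR z + d) by (apply B1; lia).
        assert (IZR z - d <= g 0%nat) by (apply Hran; lia).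
        assert (INR (S l0) - 1 <= 2 * d / lam); [|lra].
        apply (Rmult_le_reg_r lam); [lra|]. unfold Rdiv. rewrite Rmult_assoc, Rinv_l; lra.
      * apply (kusmin_landau (fun k => phi (l0 + k)%nat) (l1 - l0) d z Hd).
        -- intros n Hn. rewrite Nat.add_succ_r.
           generalize (B2 (l0 + n)%nat ltac:(lia)) (A1 (l0 + n)%nat ltac:(lia)). unfold g. lra.
        -- intros n Hn. rewrite !Nat.add_succ_r. apply Hmono; lia.
Qed.

Lemma second_derivative_test (phi : nat -> R) (L : nat) (lam Del : R) : 0 < lam -> 0 <= Del ->
  (forall n, (S n < L)%nat -> (phi (S n) - phi n) + lam <= phi (S (S n)) - phi (S n)) ->
  (forall n, (n < L)%nat -> (phi (S n) - phi n) - (phi 1%nat - phi 0%nat) <= Del) ->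
  Cmod (csum (fun n => cis (2 * PI * phi n)) L) <= (Del + 2) * (4 / sqrt (PI * lam) + 1).
Proof.
  intros Hlam HDel Hstep Hran. assert (Hpi := PI_RGT_0). assert (Hpi4 := PI_4).
  set (r := sqrt (PI * lam)). assert (Hr : 0 < r) by (apply sqrt_lt_R0; nra).
  assert (Er : r * r = PI * lam) by (apply sqrt_sqrt; nra).
  assert (HP : 0 < 4 / r) by (apply Rdiv_lt_0_compat; lra).
  set (g := fun n => phi (S n) - phi n) in *.
  assert (Hmono : forall n, (n < L)%nat -> g 0%nat <= g n).
  { induction n as [|n IH]; intros Hn; [lra|].
    specialize (IH ltac:(lia)). specialize (Hstep n Hn). unfold g in *. lra. }
  destruct (Rle_dec lam (PI / 4)) as [Hl|Hl].
  (* This [d] balances the two costs of a piece: [2 d / lam] and [2 / (pi d)] both become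
     [2 / r]. *)
  - set (d := r / PI).
    assert (Hd : 0 < d <= 1 / 2).
    { unfold d. split; [apply Rdiv_lt_0_compat; lra|].
      apply (Rmult_le_reg_r PI); [lra|]. unfold Rdiv at 1. rewrite Rmult_assoc, Rinv_l by lra. nra. }
    (* [z] is the integer part of [g 0 + d], so the differences start at or above [z - d]. They then
       stay below [z + p - d] with [p] one more than [up Del], hence at most [Del + 2]. *)
    destruct (archimed (g 0%nat + d)) as [U1 U2]. set (z := (up (g 0%nat + d) - 1)%Z).
    assert (Hz : IZR z = IZR (up (g 0%nat + d)) - 1) by (unfold z; rewrite minus_IZR; lra).
    destruct (archimed Del) as [V1 V2].
    assert (Hup : (0 < up Del)%Z) by (apply lt_IZR; lra).
    set (p := S (Z.to_nat (up Del))).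
    assert (Ep : INR p = IZR (up Del) + 1).
    { unfold p. rewrite S_INR, INR_IZR_INZ, Z2Nat.id by lia. reflexivity. }
    eapply Rle_trans.
    + apply (second_derivative_pieces lam d p Hlam Hd phi L z Hstep).
      intros n Hn. specialize (Hmono n Hn). specialize (Hran n Hn). rewrite Ep.
      fold (g n). change (phi 1%nat - phi 0%nat) with (g 0%nat) in Hran. fold (g n) in Hran. lra.
    + replace (2 * d / lam + 1 + 2 / (PI * d)) with (4 / r + 1).
      * apply Rmult_le_compat_r; lra.
      * unfold d. replace (2 * (r / PI) / lam) with (2 * r / (PI * lam)) by (field; lra).
        rewrite <- Er. field. lra.
  (* For large [lam] the spacing leaves at most [Del / lam + 1] terms, and the trivial bound is
     enough. *)
  - destruct L as [|L]; [simpl; rewrite Cmod_0; nra|].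
    eapply Rle_trans; [apply (Cmod_csum_cis_le (fun k => 2 * PI * phi k))|].
    assert (G := gap_count g lam (S L) ltac:(lia) Hstep). simpl pred in G.
    specialize (Hran L ltac:(lia)).
    assert (INR (S L) - 1 <= Del / lam).
    { apply (Rmult_le_reg_r lam); [lra|]. unfold Rdiv. rewrite Rmult_assoc, Rinv_l by lra.
      change (phi 1%nat - phi 0%nat) with (g 0%nat) in Hran. fold (g L) in Hran. lra. }
    assert (H3 := PI2_3_2).
    assert (Hil : / lam <= 4 / r + 1).
    { apply (Rmult_le_reg_r (lam * r)); [nra|].
      replace (/ lam * (lam * r)) with r by (field; lra).
      replace ((4 / r + 1) * (lam * r)) with (4 * lam + lam * r) by (field; lra).
      assert (3 / 4 < lam) by lra.
      destruct (Rle_dec r (4 * lam)); [nra|]. nra. }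
    unfold Rdiv at 1 in H. nra.
Qed.

(** * Weyl differencing *)

Lemma csum_zero f n : (forall k, (k < n)%nat -> f k = RtoC 0) -> csum f n = RtoC 0.
Proof.
  intros H. induction n as [|n IH]; [reflexivity|].
  rewrite csum_S, IH, H; [ring|lia|intros; apply H; lia].
Qed.

Lemma csum_support f p q r :
  (forall k, (k < p)%nat -> f k = RtoC 0) -> (forall k, (p + q <= k)%nat -> f k = RtoC 0) ->
  csum f (p + q + r) = csum (fun n => f (p + n)%nat) q.
Proof.
  intros H1 H2. rewrite !csum_app, (csum_zero f p H1).
  rewrite (csum_zero (fun k => f (p + q + k)%nat)); [ring|].
  intros; apply H2; lia.
Qed.

Lemma rsum_sq_le g n : (rsum g n) ^ 2 <= INR n * rsum (fun k => g k ^ 2) n.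
Proof.
  induction n as [|n IH]; [simpl; lra|].
  rewrite !rsum_S, S_INR. set (s := rsum g n) in *. set (q := rsum (fun k => g k ^ 2) n) in *.
  destruct n as [|n].
  - unfold s, q. simpl. lra.
  - assert (Hn : 1 <= INR (S n)) by (apply (le_INR 1); lia).
    set (N := INR (S n)) in *. set (x := g (S n)).
    assert (2 * s * x <= q + N * x ^ 2); [|nra].
    apply (Rmult_le_reg_l N); [lra|].
    assert (0 <= (s - N * x) ^ 2) by apply pow2_ge_0. nra.
Qed.

Definition autocorr (a : nat -> C) (N m : nat) : C :=
  csum (fun n => Cmult (a n) (Cconj (a (n + m)%nat))) (N - m).

(** The sequence is moved right by [M] and extended by 0, so that each of its shifts by [j <= M] has
    its whole support in the window [k < N + M]. *)
Definition padded (a : nat -> C) (N M k : nat) : C :=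
  if (Nat.leb M k && Nat.ltb k (M + N))%bool then a (k - M)%nat else RtoC 0.

Lemma padded_out a N M k : (k < M \/ M + N <= k)%nat -> padded a N M k = RtoC 0.
Proof.
  intros H. unfold padded.
  destruct (Nat.leb_spec M k); destruct (Nat.ltb_spec k (M + N)); simpl; auto; lia.
Qed.

Lemma padded_in a N M n : (n < N)%nat -> padded a N M (M + n) = a n.
Proof.
  intros H. unfold padded.
  destruct (Nat.leb_spec M (M + n)); destruct (Nat.ltb_spec (M + n) (M + N)); simpl; try lia.
  f_equal; lia.
Qed.

Lemma padded_sum a N M j : (j <= M)%nat ->
  csum (fun k => padded a N M (k + j)) (N + M) = csum a N.
Proof.
  intros Hj. replace (N + M)%nat with ((M - j) + N + j)%nat by lia.
  rewrite csum_support.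
  - apply csum_ext; intros n Hn. replace (M - j + n + j)%nat with (M + n)%nat by lia.
    apply padded_in; exact Hn.
  - intros k Hk; apply padded_out; lia.
  - intros k Hk; apply padded_out; lia.
Qed.

Lemma padded_autocorr a N M j m : (j + m <= M)%nat ->
  csum (fun k => Cmult (padded a N M (k + j)) (Cconj (padded a N M (k + (j + m))))) (N + M)
   = autocorr a N m.
Proof.
  intros Hj. unfold autocorr.
  assert (Z : forall k, (k < M - j)%nat \/ ((M - j) + (N - m) <= k)%nat ->
    Cmult (padded a N M (k + j)) (Cconj (padded a N M (k + (j + m)))) = RtoC 0).
  { intros k Hk. destruct (Nat.lt_ge_cases (k + j) M) as [H|H].
    - rewrite (padded_out a N M (k + j)) by lia. ring.
    - rewrite (padded_out a N M (k + (j + m))) by lia.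
      apply injective_projections; simpl; ring. }
  replace (N + M)%nat with ((M - j) + (N - m) + (N + M - (M - j) - (N - m)))%nat by lia.
  rewrite csum_support; [|intros; apply Z; lia|intros; apply Z; lia].
  apply csum_ext; intros n Hn.
  replace (M - j + n + j)%nat with (M + n)%nat by lia.
  replace (M - j + n + (j + m))%nat with (M + (n + m))%nat by lia.
  rewrite !padded_in by lia. reflexivity.
Qed.

(** Adding shift number [J] to the previous ones adds a diagonal term [N] and the correlations with
    lags 1 to [J], each twice. The double sum on the right records this induction and stands for the
    usual weights [M - m]. *)
Lemma shifts_norm a N M J : (J <= M)%nat -> (forall n, Cmod (a n) = 1) ->
  rsum (fun k => Cmod (csum (fun j => padded a N M (k + j)) J) ^ 2) (N + M) <=
  INR J * INR N + 2 * rsum (fun J => rsum (fun i => Cmod (autocorr a N (S i))) J) J.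
Proof.
  intros HJ Ha. induction J as [|J IH].
  - simpl rsum at 2. rewrite (rsum_ext _ (fun _ => 0)).
    + rewrite rsum_const. simpl. lra.
    + intros k _. simpl csum. rewrite Cmod_0. simpl; ring.
  - specialize (IH ltac:(lia)). rewrite (rsum_S (fun J => rsum _ J)), S_INR.
    rewrite (rsum_ext _ (fun k => (Cmod (csum (fun j => padded a N M (k + j)) J) ^ 2 +
       2 * Re (Cmult (csum (fun j => padded a N M (k + j)) J) (Cconj (padded a N M (k + J))))) +
       Cmod (padded a N M (k + J)) ^ 2)).
    2:{ intros k _. rewrite csum_S, !Cmod2_alt. unfold Re, Im; simpl; ring. }
    rewrite !rsum_plus, rsum_mult_l.
    assert (E1 : rsum (fun k => Cmod (padded a N M (k + J)) ^ 2) (N + M) = INR N).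
    { assert (E := padded_autocorr a N M J 0 ltac:(lia)).
      apply (f_equal Re) in E. unfold autocorr in E. rewrite !Re_csum in E.
      rewrite (rsum_ext _ (fun k => Re (Cmult (padded a N M (k + J)) (Cconj (padded a N M (k + (J + 0))))))).
      - rewrite E. rewrite Nat.sub_0_r. rewrite (rsum_ext _ (fun _ => 1)).
        + rewrite rsum_const; ring.
        + intros n _. rewrite Nat.add_0_r. transitivity (Cmod (a n) ^ 2).
          * rewrite Cmod2_alt. unfold Re, Im; simpl; ring.
          * rewrite Ha; ring.
      - intros k _. rewrite Nat.add_0_r, Cmod2_alt. unfold Re, Im; simpl; ring. }
    rewrite E1.
    assert (E2 : forall l, (l <= J)%nat ->
      rsum (fun k => Re (Cmult (csum (fun j => padded a N M (k + j)) l) (Cconj (padded a N M (k + J))))) (N + M)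
      <= rsum (fun j => Cmod (autocorr a N (J - j))) l).
    { induction l as [|l IHl]; intros Hl.
      - rewrite (rsum_ext _ (fun _ => 0)); [rewrite rsum_const; simpl; lra|].
        intros k _. simpl csum. unfold Re; simpl; ring.
      - specialize (IHl ltac:(lia)). rewrite (rsum_S (fun j => Cmod _)).
        rewrite (rsum_ext _ (fun k => Re (Cmult (csum (fun j => padded a N M (k + j)) l) (Cconj (padded a N M (k + J))))
          + Re (Cmult (padded a N M (k + l)) (Cconj (padded a N M (k + (l + (J - l)))))))).
        + rewrite rsum_plus. apply Rplus_le_compat; [exact IHl|].
          rewrite <- Re_csum, padded_autocorr by lia.
          eapply Rle_trans; [apply Rle_abs|apply re_le_Cmod].
        + intros k _. rewrite csum_S. replace (l + (J - l))%nat with J by lia.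
          unfold Re; simpl; ring. }
    assert (E3 : forall l, (l <= J)%nat -> rsum (fun j => Cmod (autocorr a N (J - j))) l =
       rsum (fun i => Cmod (autocorr a N (S i))) J - rsum (fun i => Cmod (autocorr a N (S i))) (J - l)).
    { induction l as [|l IHl]; intros Hl.
      - rewrite Nat.sub_0_r. simpl; ring.
      - rewrite rsum_S, IHl by lia. assert (El : (J - l)%nat = S (J - S l)) by lia.
        rewrite El, (rsum_S _ (J - S l)). ring. }
    specialize (E2 J (le_n J)). rewrite E3 in E2 by lia. rewrite Nat.sub_diag in E2. simpl (rsum _ 0) in E2.
    lra.
Qed.

(** [M] times the sum is the sum over all [N + M] positions of the window of the [M] shifted copies;
    the Cauchy-Schwarz inequality over the positions introduces the correlations. *)
Lemma weyl_differencing a N M : (forall n, Cmod (a n) = 1) ->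
  INR M ^ 2 * Cmod (csum a N) ^ 2 <= (INR N + INR M) * (INR M * INR N +
     2 * rsum (fun J => rsum (fun i => Cmod (autocorr a N (S i))) J) M).
Proof.
  intros Ha.
  assert (E : forall J, (J <= M)%nat ->
    csum (fun k => csum (fun j => padded a N M (k + j)) J) (N + M) = Cmult (RtoC (INR J)) (csum a N)).
  { induction J as [|J IH]; intros HJ.
    - rewrite csum_zero; [simpl; ring|reflexivity].
    - rewrite S_INR, RtoC_plus.
      rewrite (csum_ext _ (fun k => Cplus (csum (fun j => padded a N M (k + j)) J) (padded a N M (k + J)))) by reflexivity.
      rewrite csum_plus, IH, padded_sum by lia. ring. }
  specialize (E M (le_n M)).
  replace (INR M ^ 2 * Cmod (csum a N) ^ 2) with ((Cmod (Cmult (RtoC (INR M)) (csum a N))) ^ 2).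
  2:{ rewrite Cmod_mult, Cmod_R, Rabs_pos_eq by apply pos_INR. ring. }
  rewrite <- E.
  apply Rle_trans with ((rsum (fun k => Cmod (csum (fun j => padded a N M (k + j)) M)) (N + M)) ^ 2).
  { apply pow_incr; split; [apply Cmod_ge_0|apply Cmod_csum]. }
  eapply Rle_trans; [apply rsum_sq_le|].
  rewrite plus_INR. apply Rmult_le_compat_l.
  - generalize (pos_INR N) (pos_INR M); lra.
  - apply shifts_norm; auto.
Qed.

(** The leading constants of these power sums are those of the corresponding integrals, since they
    enter the constant of the block bound. Each induction step uses [(b - a) (a + b) = 1] for
    consecutive square roots [a], [b]. *)
Lemma sum_sqrt_le J : rsum (fun i => sqrt (INR (S i))) J <= 2 / 3 * (INR J * sqrt (INR J)) + 1 / 2 * sqrt (INR J).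
Proof.
  induction J as [|J IH]; [simpl; rewrite sqrt_0; lra|].
  rewrite rsum_S. assert (H0 := pos_INR J). assert (H1 := S_INR J).
  set (x := INR J) in *. set (y := INR (S J)) in *.
  assert (Ex : sqrt x * sqrt x = x) by (apply sqrt_sqrt; lra).
  assert (Ey : sqrt y * sqrt y = y) by (apply sqrt_sqrt; lra).
  assert (Ha := sqrt_pos x). assert (Hb : 0 < sqrt y) by (apply sqrt_lt_R0; lra).
  set (a := sqrt x) in *. set (b := sqrt y) in *.
  assert (1 / 2 * (a + b) <= 2 / 3 * (y * b - x * a)); [|lra].
  assert (Hab : (b - a) * (a + b) = 1) by nra.
  replace (y * b - x * a) with ((b - a) * (a * a + a * b + b * b)) by (rewrite <- Ex, <- Ey; ring).
  apply (Rmult_le_reg_l (a + b)); [lra|].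
  replace ((a + b) * (2 / 3 * ((b - a) * (a * a + a * b + b * b)))) with
    (2 / 3 * (((b - a) * (a + b)) * (a * a + a * b + b * b))) by ring.
  rewrite Hab. assert (0 <= (a - b) ^ 2) by apply pow2_ge_0. nra.
Qed.

Lemma sum_sum_sqrt_le M : rsum (fun J => rsum (fun i => sqrt (INR (S i))) J) M <=
  4 / 15 * (INR M ^ 2 * sqrt (INR M)).
Proof.
  induction M as [|J IH]; [simpl; rewrite sqrt_0; lra|].
  rewrite rsum_S. generalize (sum_sqrt_le J). assert (H0 := pos_INR J). assert (H1 := S_INR J).
  set (x := INR J) in *. set (y := INR (S J)) in *.
  assert (Ex : sqrt x * sqrt x = x) by (apply sqrt_sqrt; lra).
  assert (Ey : sqrt y * sqrt y = y) by (apply sqrt_sqrt; lra).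
  assert (Ha := sqrt_pos x). assert (Hb : 0 < sqrt y) by (apply sqrt_lt_R0; lra).
  set (a := sqrt x) in *. set (b := sqrt y) in *. intros HS.
  assert (2 / 3 * (x * a) + 1 / 2 * a <= 4 / 15 * (y ^ 2 * b - x ^ 2 * a)); [|lra].
  assert (Hab : (b - a) * (a + b) = 1) by nra.
  replace (y ^ 2 * b - x ^ 2 * a) with
    ((b - a) * (x * x + a * b * (x + y) + x * y + y * y)).
  2:{ rewrite <- Ex, <- Ey. ring. }
  apply (Rmult_le_reg_l (a + b)); [lra|].
  replace ((a + b) * (4 / 15 * ((b - a) * (x * x + a * b * (x + y) + x * y + y * y)))) with
    (4 / 15 * (((b - a) * (a + b)) * (x * x + a * b * (x + y) + x * y + y * y))) by ring.
  rewrite Hab, H1.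
  replace ((a + b) * (2 / 3 * (x * a) + 1 / 2 * a)) with
    (2 / 3 * (x * (a * a)) + 1 / 2 * (a * a) + a * b * (2 / 3 * x + 1 / 2)) by ring.
  rewrite Ex.
  assert (a * b <= x + 1 / 2) by (assert (0 <= (a - b) ^ 2) by apply pow2_ge_0; nra).
  assert (0 <= a * b) by nra.
  nra.
Qed.

Lemma sum_sum_id_le M : rsum (fun J => rsum (fun i => INR (S i)) J) M <= INR M ^ 3 / 6.
Proof.
  assert (E : forall J, rsum (fun i => INR (S i)) J = INR J * (INR J + 1) / 2).
  { induction J as [|J IH]; [simpl; lra|]. rewrite rsum_S, IH, S_INR. field. }
  induction M as [|J IH]; [simpl; lra|].
  rewrite rsum_S, E, S_INR. generalize (pos_INR J). nra.
Qed.

Lemma sum_sum_inv_sqrt_le M : rsum (fun J => rsum (fun i => / sqrt (INR (S i))) J) M <=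
  4 / 3 * (INR M * sqrt (INR M)).
Proof.
  induction M as [|J IH]; [simpl; rewrite sqrt_0; lra|].
  rewrite rsum_S. generalize (sum_inv_sqrt_le J). assert (H0 := pos_INR J). assert (H1 := S_INR J).
  set (x := INR J) in *. set (y := INR (S J)) in *.
  assert (Ex : sqrt x * sqrt x = x) by (apply sqrt_sqrt; lra).
  assert (Ey : sqrt y * sqrt y = y) by (apply sqrt_sqrt; lra).
  assert (Ha := sqrt_pos x). assert (Hb : 0 < sqrt y) by (apply sqrt_lt_R0; lra).
  set (a := sqrt x) in *. set (b := sqrt y) in *. intros HS.
  assert (2 * a <= 4 / 3 * (y * b - x * a)); [|lra].
  assert (Hab : (b - a) * (a + b) = 1) by nra.
  assert (a <= b) by nra.
  replace (y * b - x * a) with ((b - a) * (a * a + a * b + b * b)) by (rewrite <- Ex, <- Ey; ring).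
  apply (Rmult_le_reg_l (a + b)); [lra|].
  replace ((a + b) * (4 / 3 * ((b - a) * (a * a + a * b + b * b)))) with
    (4 / 3 * (((b - a) * (a + b)) * (a * a + a * b + b * b))) by ring.
  rewrite Hab. nra.
Qed.

(** Up to the factor [t / (2 pi)], the increment from [u] to [u + 1] of the phase of the correlation
    with lag [m]. *)
Definition logdiff (m u : R) : R := (ln (u + 1 + m) - ln (u + 1)) - (ln (u + m) - ln u).

Lemma log_second_derivative (m w : R) : 0 <= m -> 0 < w ->
  2 * m / (w + m) ^ 3 <= / w ^ 2 - / (w + m) ^ 2 <= 2 * m / w ^ 3.
Proof.
  intros Hm Hw. set (W := w + m). assert (HW : w <= W) by (unfold W; lra).
  assert (Hp : forall k, 0 < w ^ k) by (intros; apply pow_lt; lra).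
  assert (Hq : forall k, 0 < W ^ k) by (intros; apply pow_lt; lra).
  assert (E : / w ^ 2 - / W ^ 2 = m * (w + W) / (w ^ 2 * W ^ 2)).
  { unfold W in *. field. lra. }
  rewrite E. split.
  - apply (Rmult_le_reg_r (W ^ 3 * w ^ 2)); [apply Rmult_lt_0_compat; auto|].
    replace (2 * m / W ^ 3 * (W ^ 3 * w ^ 2)) with (2 * m * w ^ 2) by (field; lra).
    replace (m * (w + W) / (w ^ 2 * W ^ 2) * (W ^ 3 * w ^ 2)) with (m * ((w + W) * W)) by (field; lra).
    replace (2 * m * w ^ 2) with (m * (2 * w ^ 2)) by ring. apply Rmult_le_compat_l; nra.
  - apply (Rmult_le_reg_r (W ^ 2 * w ^ 3)); [apply Rmult_lt_0_compat; auto|].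
    replace (2 * m / w ^ 3 * (W ^ 2 * w ^ 3)) with (m * (2 * W ^ 2)) by (field; lra).
    replace (m * (w + W) / (w ^ 2 * W ^ 2) * (W ^ 2 * w ^ 3)) with (m * ((w + W) * w)) by (field; lra).
    apply Rmult_le_compat_l; nra.
Qed.

Lemma logdiff_derive m u : 0 <= m -> 0 < u ->
  is_derive (logdiff m) u ((/ (u + 1 + m) - / (u + 1)) - (/ (u + m) - / u)).
Proof. intros Hm Hu. unfold logdiff. auto_derive; [repeat split; lra|ring]. Qed.

Lemma recip_derive m w : 0 <= m -> 0 < w ->
  is_derive (fun w => / (w + m) - / w) w (/ w ^ 2 - / (w + m) ^ 2).
Proof. intros Hm Hw. auto_derive; [repeat split; lra|field; lra]. Qed.

(** Two unit differences of [ln (u + m) - ln u] are converted into its second derivative, which is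
    thus sampled on [[u, u + 2]]; this is why [N2] must exceed [u + 2 + m]. *)
Lemma logdiff_step m u N2 : 0 <= m -> 0 < u -> u + 2 + m <= N2 ->
  2 * m / N2 ^ 3 <= logdiff m (u + 1) - logdiff m u.
Proof.
  intros Hm Hu HN. set (c := 2 * m / N2 ^ 3).
  assert (HN2 : 0 < N2 ^ 3) by (apply pow_lt; lra).
  assert (Hc : forall w, u <= w <= u + 2 -> c <= / w ^ 2 - / (w + m) ^ 2).
  { intros w Hw. eapply Rle_trans; [|apply log_second_derivative; lra].
    unfold c. apply Rmult_le_compat_l; [lra|].
    apply Rinv_le_contravar; [apply pow_lt; lra|]. apply pow_incr; lra. }
  assert (H1 : forall v, u <= v <= u + 1 -> c <= (/ (v + 1 + m) - / (v + 1)) - (/ (v + m) - / v)).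
  { intros v Hv.
    assert ((fun w => (/ (w + m) - / w) - c * w) v <= (fun w => (/ (w + m) - / w) - c * w) (v + 1)); [|lra].
    apply (derive_nonneg_le (fun w => (/ (w + m) - / w) - c * w) (fun w => (/ w ^ 2 - / (w + m) ^ 2) - c)); [lra| |].
    - intros w Hw. apply (is_derive_minusR (fun w => / (w + m) - / w) (fun w => c * w)).
      + apply recip_derive; lra.
      + clearbody c. auto_derive; [auto|ring].
    - intros w Hw. specialize (Hc w ltac:(lra)). lra. }
  assert ((fun v => logdiff m v - c * v) u <= (fun v => logdiff m v - c * v) (u + 1)); [|lra].
  apply (derive_nonneg_le (fun v => logdiff m v - c * v) (fun v => ((/ (v + 1 + m) - / (v + 1)) - (/ (v + m) - / v)) - c)); [lra| |].
  - intros v Hv. apply (is_derive_minusR (logdiff m) (fun w => c * w)).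
    + apply logdiff_derive; lra.
    + clearbody c. auto_derive; [auto|ring].
  - intros v Hv. specialize (H1 v Hv). lra.
Qed.

Lemma logdiff_range m u v : 0 <= m -> 0 < u <= v ->
  logdiff m v - logdiff m u <= 2 * m / u ^ 3 * (v - u).
Proof.
  intros Hm Hu. set (c := 2 * m / u ^ 3).
  assert (Hu3 : 0 < u ^ 3) by (apply pow_lt; lra).
  assert (Hc : forall w, u <= w -> / w ^ 2 - / (w + m) ^ 2 <= c).
  { intros w Hw. eapply Rle_trans; [apply log_second_derivative; lra|].
    unfold c. apply Rmult_le_compat_l; [lra|].
    apply Rinv_le_contravar; [lra|]. apply pow_incr; lra. }
  assert (H1 : forall x, u <= x -> (/ (x + 1 + m) - / (x + 1)) - (/ (x + m) - / x) <= c).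
  { intros x Hx.
    assert ((fun w => c * w - (/ (w + m) - / w)) x <= (fun w => c * w - (/ (w + m) - / w)) (x + 1)); [|lra].
    apply (derive_nonneg_le (fun w => c * w - (/ (w + m) - / w)) (fun w => c - (/ w ^ 2 - / (w + m) ^ 2))); [lra| |].
    - intros w Hw. apply (is_derive_minusR (fun w => c * w) (fun w => / (w + m) - / w)).
      + clearbody c. auto_derive; [auto|ring].
      + apply recip_derive; lra.
    - intros w Hw. specialize (Hc w ltac:(lra)). lra. }
  assert ((fun x => c * x - logdiff m x) u <= (fun x => c * x - logdiff m x) v); [|lra].
  apply (derive_nonneg_le (fun x => c * x - logdiff m x) (fun x => c - ((/ (x + 1 + m) - / (x + 1)) - (/ (x + m) - / x)))); [lra| |].
  - intros x Hx. apply (is_derive_minusR (fun w => c * w) (logdiff m)).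
    + clearbody c. auto_derive; [auto|ring].
    + apply logdiff_derive; lra.
  - intros x Hx. specialize (H1 x ltac:(lra)). lra.
Qed.

Lemma csum_conj f n : csum (fun k => Cconj (f k)) n = Cconj (csum f n).
Proof.
  induction n as [|n IH]; [simpl; apply injective_projections; simpl; ring|].
  rewrite !csum_S, IH, Cplus_conj. reflexivity.
Qed.

Definition logphase (t : R) (N0 n : nat) : C := cis (t * ln (INR N0 + INR n)).

(** Conjugation makes the increments of the phase increase, as [second_derivative_test] requires.
    The bound depends on [L] only, so that it serves all shorter sums [L'] needed in the later Abel
    summation. *)
Lemma autocorr_bound t (N0 L L' m : nat) : 0 < t -> (1 <= N0)%nat -> (L' <= L)%nat -> (1 <= m)%nat ->
  Cmod (autocorr (logphase t N0) L' m) <=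
    (t * INR L / (PI * INR N0 ^ 3) * INR m + 2) *
    (4 / sqrt (t / (INR N0 + INR L) ^ 3) * / sqrt (INR m) + 1).
Proof.
  intros Ht HN HL Hm. assert (Hpi := PI_RGT_0).
  assert (HN1 : 1 <= INR N0) by (apply (le_INR 1); lia).
  assert (Hm1 : 1 <= INR m) by (apply (le_INR 1); lia).
  assert (HL0 := pos_INR L). assert (HL' : INR L' <= INR L) by (apply le_INR; lia).
  set (x := INR N0) in *. set (N2 := x + INR L).
  assert (HN20 : 0 < N2) by (unfold N2; lra).
  assert (HN2 : 0 < N2 ^ 3) by (apply pow_lt; lra).
  assert (Hx3 : 0 < x ^ 3) by (apply pow_lt; lra).
  set (phi := fun n => t / (2 * PI) * (ln (x + INR n + INR m) - ln (x + INR n))).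
  assert (Ep : forall n, phi (S n) - phi n = t / (2 * PI) * logdiff (INR m) (x + INR n)).
  { intros n. unfold phi, logdiff. rewrite S_INR.
    replace (x + (INR n + 1) + INR m) with (x + INR n + 1 + INR m) by ring.
    replace (x + (INR n + 1)) with (x + INR n + 1) by ring. ring. }
  assert (Et : 0 < t / (2 * PI)) by (apply Rdiv_lt_0_compat; lra).
  rewrite <- Cmod_conj. unfold autocorr. rewrite <- csum_conj.
  rewrite (csum_ext _ (fun n => cis (2 * PI * phi n))).
  2:{ intros n _. unfold logphase, phi. fold x. rewrite plus_INR, Cmult_conj, <- !cis_opp.
      rewrite <- cis_add. f_equal. replace (x + (INR n + INR m)) with (x + INR n + INR m) by ring.
      rewrite Ropp_involutive. field; lra. }
  assert (Hlam : 0 < t * INR m / (PI * N2 ^ 3)) by (apply Rdiv_lt_0_compat; nra).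
  replace (t * INR L / (PI * x ^ 3) * INR m) with (t / (2 * PI) * (2 * INR m / x ^ 3 * INR L)) by (field; lra).
  replace (4 / sqrt (t / N2 ^ 3) * / sqrt (INR m)) with (4 / sqrt (PI * (t * INR m / (PI * N2 ^ 3)))).
  2:{ replace (PI * (t * INR m / (PI * N2 ^ 3))) with (t / N2 ^ 3 * INR m) by (field; lra).
      assert (0 < t / N2 ^ 3) by (apply Rdiv_lt_0_compat; lra).
      assert (S1 : 0 < sqrt (t / N2 ^ 3)) by (apply sqrt_lt_R0; lra).
      assert (S2 : 0 < sqrt (INR m)) by (apply sqrt_lt_R0; lra).
      rewrite sqrt_mult by lra. unfold Rdiv at 1 3. rewrite Rinv_mult. ring. }
  apply second_derivative_test.
  - exact Hlam.
  - apply Rmult_le_pos; [lra|]. apply Rmult_le_pos; [|lra].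
    apply Rmult_le_pos; [lra|apply Rlt_le, Rinv_0_lt_compat; lra].
  - intros n Hn. rewrite !Ep, S_INR.
    assert (Hs : INR n + 2 + INR m <= INR L').
    { replace 2 with (INR 2) by reflexivity. rewrite <- !plus_INR. apply le_INR; lia. }
    assert (A := logdiff_step (INR m) (x + INR n) N2 ltac:(lra) ltac:(generalize (pos_INR n); lra) ltac:(unfold N2; lra)).
    replace (x + (INR n + 1)) with (x + INR n + 1) by ring.
    replace (t * INR m / (PI * N2 ^ 3)) with (t / (2 * PI) * (2 * INR m / N2 ^ 3)) by (field; lra).
    nra.
  - intros n Hn. rewrite !Ep.
    assert (Hs : INR n <= INR L') by (apply le_INR; lia).
    assert (H0 := pos_INR n).
    assert (A := logdiff_range (INR m) x (x + INR n) ltac:(lra) ltac:(lra)).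
    change (INR 0) with 0. rewrite Rplus_0_r.
    rewrite <- Rmult_minus_distr_l. apply Rmult_le_compat_l; [lra|].
    eapply Rle_trans; [exact A|]. apply Rmult_le_compat_l; [|lra].
    apply Rmult_le_pos; [lra|apply Rlt_le, Rinv_0_lt_compat; lra].
Qed.

(** The bound [(d m + 2) (w m^(-1/2) + 1)] of the correlation with lag [m] expands into multiples of
    [m^(1/2)], [m], [m^(-1/2)] and 1. Their double sums give the four terms of the bracket. *)
Lemma third_derivative_test t (N0 L L' M : nat) : 0 < t -> (1 <= N0)%nat -> (L' <= L)%nat ->
  let d := t * INR L / (PI * INR N0 ^ 3) in
  let w := 4 / sqrt (t / (INR N0 + INR L) ^ 3) in
  INR M ^ 2 * Cmod (csum (logphase t N0) L') ^ 2 <=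
  (INR L + INR M) * (INR M * INR L + 2 * (4 / 15 * d * w * (INR M ^ 2 * sqrt (INR M)) +
     d * (INR M ^ 3 / 6) + 8 / 3 * w * (INR M * sqrt (INR M)) + INR M ^ 2)).
Proof.
  intros Ht HN HL d w. assert (Hpi := PI_RGT_0).
  assert (HN1 : 1 <= INR N0) by (apply (le_INR 1); lia).
  assert (HL0 := pos_INR L). assert (HL' : INR L' <= INR L) by (apply le_INR; lia).
  assert (HL'0 := pos_INR L'). assert (HM0 := pos_INR M).
  assert (Hd : 0 <= d).
  { unfold d. apply Rmult_le_pos; [nra|]. apply Rlt_le, Rinv_0_lt_compat.
    apply Rmult_lt_0_compat; [lra|apply pow_lt; lra]. }
  assert (Hw : 0 <= w).
  { unfold w. apply Rmult_le_pos; [lra|]. apply Rlt_le, Rinv_0_lt_compat, sqrt_lt_R0.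
    apply Rdiv_lt_0_compat; [lra|apply pow_lt; lra]. }
  assert (HR : rsum (fun J => rsum (fun i => Cmod (autocorr (logphase t N0) L' (S i))) J) M <=
    4 / 15 * d * w * (INR M ^ 2 * sqrt (INR M)) +
     d * (INR M ^ 3 / 6) + 8 / 3 * w * (INR M * sqrt (INR M)) + INR M ^ 2).
  { apply Rle_trans with (d * w * rsum (fun J => rsum (fun i => sqrt (INR (S i))) J) M +
      d * rsum (fun J => rsum (fun i => INR (S i)) J) M +
      2 * w * rsum (fun J => rsum (fun i => / sqrt (INR (S i))) J) M +
      2 * rsum (fun J => rsum (fun i => 1) J) M).
    - rewrite <- !rsum_mult_l, <- !rsum_plus. apply rsum_le. intros J _.
      rewrite <- !rsum_mult_l, <- !rsum_plus. apply rsum_le. intros i _.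
      eapply Rle_trans; [apply (autocorr_bound t N0 L L' (S i)); try lia; exact Ht|].
      fold d w. apply Req_le.
      assert (H1 := INR_S_pos i). set (m := INR (S i)) in *.
      assert (Hs : 0 < sqrt m) by (apply sqrt_lt_R0; lra).
      assert (Em : m = sqrt m * sqrt m) by (rewrite sqrt_sqrt; lra).
      replace (d * m + 2) with (d * (sqrt m * sqrt m) + 2) by (rewrite <- Em; ring).
      replace (d * m) with (d * (sqrt m * sqrt m)) by (rewrite <- Em; ring).
      field. lra.
    - assert (H1 := sum_sum_sqrt_le M). assert (H2 := sum_sum_id_le M).
      assert (H3 := sum_sum_inv_sqrt_le M).
      assert (H4 : forall n, 2 * rsum (fun J => rsum (fun i => 1) J) n <= INR n ^ 2).
      { induction n as [|n IH]; [simpl; lra|]. rewrite rsum_S, rsum_const, S_INR. generalize (pos_INR n). nra. }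
      specialize (H4 M).
      assert (Hdw : 0 <= d * w) by (apply Rmult_le_pos; lra).
      apply (Rmult_le_compat_l _ _ _ Hdw) in H1. apply (Rmult_le_compat_l _ _ _ Hd) in H2.
      apply (Rmult_le_compat_l _ _ _ Hw) in H3. lra. }
  eapply Rle_trans; [apply weyl_differencing; intros; apply Cmod_cis|].
  assert (HR0 : 0 <= rsum (fun J => rsum (fun i => Cmod (autocorr (logphase t N0) L' (S i))) J) M).
  { apply rsum_nonneg; intros; apply rsum_nonneg; intros; apply Cmod_ge_0. }
  apply Rmult_le_compat; [lra| |lra|].
  - assert (0 <= INR M * INR L') by nra. lra.
  - assert (INR M * INR L' <= INR M * INR L) by (apply Rmult_le_compat_l; lra). lra.
Qed.

Lemma abel_bound (w : nat -> R) (a : nat -> C) (n : nat) (B : R) :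
  (forall k, 0 <= w (S k) <= w k) ->
  (forall k, (k <= n)%nat -> Cmod (csum a k) <= B) ->
  Cmod (csum (fun k => Cmult (RtoC (w k)) (a k)) n) <= w 0%nat * B.
Proof.
  intros Hw HB.
  assert (HB0 : 0 <= B) by (eapply Rle_trans; [apply Cmod_ge_0|apply (HB 0%nat); lia]).
  assert (E : forall k, csum (fun k => Cmult (RtoC (w k)) (a k)) (S k) =
    Cplus (Cmult (RtoC (w k)) (csum a (S k)))
      (csum (fun j => Cmult (RtoC (w j - w (S j))) (csum a (S j))) k)).
  { induction k as [|k IH].
    - simpl; ring.
    - rewrite csum_S, IH, (csum_S a (S k)).
      rewrite (csum_S (fun j => Cmult (RtoC (w j - w (S j))) (csum a (S j))) k), RtoC_minus. ring. }
  assert (T : forall k, (k <= n)%nat -> Cmod (csum (fun j => Cmult (RtoC (w j - w (S j))) (csum a (S j))) (pred k))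
     <= (w 0%nat - w (pred k)) * B).
  { intros [|k]; simpl pred.
    - intros _. simpl. rewrite Cmod_0. lra.
    - induction k as [|k IH]; intros Hk; [simpl; rewrite Cmod_0; lra|].
      rewrite csum_S. eapply Rle_trans; [apply Cmod_triangle|].
      specialize (IH ltac:(lia)). specialize (HB (S k) ltac:(lia)). specialize (Hw k).
      rewrite Cmod_mult, Cmod_R, Rabs_pos_eq by lra. nra. }
  destruct n as [|n].
  - simpl. rewrite Cmod_0. apply Rmult_le_pos; [|lra]. generalize (Hw 0%nat); lra.
  - rewrite E. eapply Rle_trans; [apply Cmod_triangle|].
    specialize (T (S n) (le_n _)). simpl pred in T. specialize (HB (S n) (le_n _)).
    assert (0 <= w n) by (generalize (Hw n); lra).
    rewrite Cmod_mult, Cmod_R, Rabs_pos_eq by lra. nra.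
Qed.

(** * Explicit bounds *)

Lemma PI_bounds : 31415 / 10000 < PI < 31416 / 10000.
Proof.
  generalize (PI_2_3_7_ineq 2). unfold sum_f_R0, tg_alt, PI_2_3_7_tg, Ratan_seq. simpl. lra.
Qed.

(** The first two terms of the series of [ln ((1 + z) / (1 - z))]. The relation between [a] and [z]
    is free of division so that [lra] can check it on numerals. *)
Lemma ln_lower (a z : R) : 0 <= z < 1 -> a * (1 - z) = 1 + z -> 2 * z + 2 / 3 * z ^ 3 <= ln a.
Proof.
  intros Hz Ha.
  assert (E : a = (1 + z) / (1 - z)) by (apply (Rmult_eq_reg_r (1 - z)); [rewrite Ha; field|]; lra).
  assert (H : (fun x => ln (1 + x) - ln (1 - x) - (2 * x + 2 / 3 * x ^ 3)) 0 <=
     (fun x => ln (1 + x) - ln (1 - x) - (2 * x + 2 / 3 * x ^ 3)) z).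
  { apply (derive_nonneg_le (fun x => ln (1 + x) - ln (1 - x) - (2 * x + 2 / 3 * x ^ 3)) (fun x => 2 / (1 - x * x) - (2 + 2 * x ^ 2))); [lra| |].
    - intros x Hx. auto_derive; [repeat split; lra|]. field. nra.
    - intros x Hx. assert (Hp : 0 < 1 - x * x) by nra.
      apply (Rmult_le_reg_r (1 - x * x)); [lra|].
      replace ((2 / (1 - x * x) - (2 + 2 * x ^ 2)) * (1 - x * x)) with (2 * x ^ 4) by (field; lra).
      assert (0 <= x ^ 4) by (apply pow_le; lra). lra. }
  cbv beta in H. rewrite Rplus_0_r, Rminus_0_r, ln_1 in H.
  rewrite E. unfold Rdiv. rewrite ln_mult, ln_Rinv by (try apply Rinv_0_lt_compat; lra). lra.
Qed.

Lemma nat_ceil (x : R) : 0 <= x -> exists M : nat, x <= INR M <= x + 1.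
Proof.
  intros Hx. destruct (archimed x) as [U1 U2].
  assert (Hup : (0 <= up x)%Z) by (apply le_IZR; lra).
  exists (Z.to_nat (up x)). rewrite INR_IZR_INZ, Z2Nat.id by lia. lra.
Qed.

(* With [A = q s^2] and [M] about [2 q], the bracket of [third_derivative_test] is at most
   [0.25 + 0.801 + 0.0336 + 0.8068 + 0.0046 < 1.897] times [M q s^2], and
   [0.12601 * 1.897 < 0.489^2]. *)
Lemma block_bound (s : R) (A L L' : nat) :
  316 / 10 <= s -> 4 * s ^ 2 <= INR A <= 57 / 100 * s ^ 3 -> 4 * INR L <= INR A -> (L' <= L)%nat ->
  Cmod (csum (logphase (s ^ 6) A) L') <= 489 / 1000 * s * sqrt (INR A).
Proof.
  intros Hs HA HL HL'. assert (Hpi := PI_bounds).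
  assert (Hs2 : 99856 / 100 <= s ^ 2) by (simpl; nra).
  assert (HA1 : (1 <= A)%nat) by (destruct A; [simpl in HA; nra|lia]).
  set (q := INR A / s ^ 2).
  assert (EA : INR A = q * s ^ 2) by (unfold q; field; lra).
  assert (Hq4 : 4 <= q) by (apply (Rmult_le_reg_r (s ^ 2)); lra).
  assert (Hqs : q <= 57 / 100 * s).
  { apply (Rmult_le_reg_r (s ^ 2)); [lra|]. rewrite <- EA. simpl in *. lra. }
  destruct (nat_ceil (2 * q) ltac:(lra)) as [M [HM1 HM2]].
  set (sg := sqrt q). set (mu := sqrt (INR M)).
  assert (Esg : sg * sg = q) by (apply sqrt_sqrt; lra).
  assert (Emu : mu * mu = INR M) by (apply sqrt_sqrt; lra).
  assert (Hsg : 0 < sg) by (apply sqrt_lt_R0; lra).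
  assert (Hmu : 0 < mu) by (apply sqrt_lt_R0; lra).
  (* [q >= 4] absorbs the rounding of [M]: [2 q + 1 <= 2.25 q]. *)
  assert (HMq : INR M <= 225 / 100 * q) by lra.
  assert (Hmus : mu <= 3 / 2 * sg) by nra.
  assert (Ht : 0 < s ^ 6) by (apply pow_lt; lra).
  assert (TD := third_derivative_test (s ^ 6) A L L' M Ht HA1 HL'). cbv zeta in TD.
  set (d := s ^ 6 * INR L / (PI * INR A ^ 3)) in *.
  set (w := 4 / sqrt (s ^ 6 / (INR A + INR L) ^ 3)) in *.
  fold mu in TD. assert (HL0 := pos_INR L). assert (HLq : INR L <= q * s ^ 2 / 4) by lra.
  assert (HA0 : 0 < INR A) by nra.
  assert (Hd0 : 0 <= d).
  { unfold d. apply Rmult_le_pos; [nra|]. apply Rlt_le, Rinv_0_lt_compat.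
    apply Rmult_lt_0_compat; [lra|apply pow_lt; lra]. }
  assert (Hd : d * q ^ 2 <= 796 / 10000 * s ^ 2).
  { unfold d. rewrite EA.
    replace (s ^ 6 * INR L / (PI * (q * s ^ 2) ^ 3) * q ^ 2) with (INR L / (PI * q)) by (field; lra).
    apply (Rmult_le_reg_r (PI * q)); [nra|]. unfold Rdiv at 1. rewrite Rmult_assoc, Rinv_l, Rmult_1_r by nra.
    apply Rle_trans with (q * s ^ 2 / 4); [exact HLq|].
    assert (0 <= q * s ^ 2) by nra.
    replace (796 / 10000 * s ^ 2 * (PI * q)) with (796 / 10000 * PI * (q * s ^ 2)) by ring.
    replace (q * s ^ 2 / 4) with (1 / 4 * (q * s ^ 2)) by field. apply Rmult_le_compat_r; lra. }
  set (B := INR A + INR L) in *.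
  assert (HB0 : 0 < B) by (unfold B; lra).
  assert (HB : B <= 5 / 4 * (q * s ^ 2)) by (unfold B; lra).
  assert (HB3 : 0 < B ^ 3) by (apply pow_lt; lra).
  set (r := sqrt (s ^ 6 / B ^ 3)) in *.
  assert (Hr : 0 < r) by (apply sqrt_lt_R0, Rdiv_lt_0_compat; lra).
  assert (Er : r * r = s ^ 6 / B ^ 3) by (apply sqrt_sqrt, Rlt_le, Rdiv_lt_0_compat; lra).
  assert (Hrq : 64 / 125 <= (r * (q * sg)) * (r * (q * sg))).
  { replace ((r * (q * sg)) * (r * (q * sg))) with ((r * r) * (q * q * (sg * sg))) by ring.
    rewrite Er, Esg.
    replace (s ^ 6 / B ^ 3 * (q * q * q)) with ((q * s ^ 2) ^ 3 / B ^ 3) by (field; lra).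
    apply (Rmult_le_reg_r (B ^ 3)); [lra|]. unfold Rdiv at 2. rewrite Rmult_assoc, Rinv_l, Rmult_1_r by lra.
    replace (64 / 125 * B ^ 3) with ((4 / 5 * B) ^ 3) by field. apply pow_incr; lra. }
  assert (Hrq1 : 71553 / 100000 <= r * (q * sg)).
  { assert (0 < r * (q * sg)) by (apply Rmult_lt_0_compat; [lra|nra]). nra. }
  assert (Hw0 : 0 < w) by (unfold w; apply Rdiv_lt_0_compat; lra).
  assert (Hw : w <= 55903 / 10000 * (q * sg)).
  { unfold w. apply (Rmult_le_reg_r r); [lra|]. unfold Rdiv at 1. rewrite Rmult_assoc, Rinv_l by lra. lra. }
  assert (Hdw : d * w * q <= 44499 / 100000 * s ^ 2 * sg).
  { apply Rle_trans with (d * (55903 / 10000 * (q * sg)) * q).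
    - apply Rmult_le_compat_r; [lra|]. apply Rmult_le_compat_l; lra.
    - replace (d * (55903 / 10000 * (q * sg)) * q) with (55903 / 10000 * sg * (d * q ^ 2)) by ring.
      apply Rle_trans with (55903 / 10000 * sg * (796 / 10000 * s ^ 2)).
      + apply Rmult_le_compat_l; [lra|exact Hd].
      + assert (0 <= sg * s ^ 2) by nra. lra. }
  assert (HMmu : INR M * mu <= 27 / 8 * (q * sg)).
  { apply Rle_trans with ((225 / 100 * q) * (3 / 2 * sg)).
    - apply Rmult_le_compat; lra.
    - apply Req_le; field. }
  assert (T1 : 8 / 15 * (d * w) * (INR M * mu) <= 80099 / 100000 * (q * s ^ 2)).
  { assert (0 <= d * w) by nra.
    apply Rle_trans with (8 / 15 * (d * w) * (27 / 8 * (q * sg))).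
    - apply Rmult_le_compat_l; lra.
    - replace (8 / 15 * (d * w) * (27 / 8 * (q * sg))) with (9 / 5 * sg * (d * w * q)) by field.
      apply Rle_trans with (9 / 5 * sg * (44499 / 100000 * s ^ 2 * sg)).
      + apply Rmult_le_compat_l; lra.
      + replace (9 / 5 * sg * (44499 / 100000 * s ^ 2 * sg)) with (9 / 5 * 44499 / 100000 * ((sg * sg) * s ^ 2)) by field.
        rewrite Esg. assert (0 <= q * s ^ 2) by nra. lra. }
  assert (T2 : d * (INR M * INR M) / 3 <= 336 / 10000 * (q * s ^ 2)).
  { assert (INR M * INR M <= 50625 / 10000 * q ^ 2).
    { replace (50625 / 10000 * q ^ 2) with ((225 / 100 * q) * (225 / 100 * q)) by field.
      apply Rmult_le_compat; lra. }
    apply Rle_trans with (d * (50625 / 10000 * q ^ 2) / 3).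
    - apply Rmult_le_compat_r; [lra|]. apply Rmult_le_compat_l; lra.
    - replace (d * (50625 / 10000 * q ^ 2) / 3) with (16875 / 10000 * (d * q ^ 2)) by field.
      assert (4 * s ^ 2 <= q * s ^ 2) by (apply Rmult_le_compat_r; lra). lra. }
  assert (T3 : 16 / 3 * w * mu <= 80672 / 100000 * (q * s ^ 2)).
  { apply Rle_trans with (16 / 3 * (55903 / 10000 * (q * sg)) * (3 / 2 * sg)).
    - apply Rmult_le_compat; [lra|lra| |exact Hmus]. apply Rmult_le_compat_l; lra.
    - replace (16 / 3 * (55903 / 10000 * (q * sg)) * (3 / 2 * sg)) with (8 * 55903 / 10000 * (q * (sg * sg))) by field.
      rewrite Esg.
      assert (q * q <= q * (57 / 100 * s)) by (apply Rmult_le_compat_l; lra).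
      assert (316 / 10 * (q * s) <= q * s ^ 2).
      { replace (q * s ^ 2) with (s * (q * s)) by ring. apply Rmult_le_compat_r; nra. }
      lra. }
  assert (T4 : 2 * INR M <= 451 / 100000 * (q * s ^ 2)).
  { assert (99856 / 100 * q <= q * s ^ 2) by (rewrite (Rmult_comm q); apply Rmult_le_compat_r; lra). lra. }
  assert (HP : 0 <= q * s ^ 2) by nra.
  assert (HM0 : 0 < INR M) by lra.
  assert (BR : INR M * INR L + 2 * (4 / 15 * d * w * (INR M ^ 2 * mu) +
     d * (INR M ^ 3 / 6) + 8 / 3 * w * (INR M * mu) + INR M ^ 2) <= INR M * (1897 / 1000 * (q * s ^ 2))).
  { replace (INR M * INR L + 2 * (4 / 15 * d * w * (INR M ^ 2 * mu) +
     d * (INR M ^ 3 / 6) + 8 / 3 * w * (INR M * mu) + INR M ^ 2)) with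
     (INR M * (INR L + 8 / 15 * (d * w) * (INR M * mu) + d * (INR M * INR M) / 3 + 16 / 3 * w * mu + 2 * INR M)) by field.
    apply Rmult_le_compat_l; lra. }
  assert (LM : INR L + INR M <= INR M * (12601 / 100000 * s ^ 2)).
  { assert (q * s ^ 2 <= INR M / 2 * s ^ 2) by (apply Rmult_le_compat_r; lra).
    assert (INR M * (99856 / 100) <= INR M * s ^ 2) by (apply Rmult_le_compat_l; lra). lra. }
  assert (F : INR M ^ 2 * Cmod (csum (logphase (s ^ 6) A) L') ^ 2 <=
    INR M ^ 2 * (489 / 1000 * s * sqrt (INR A)) ^ 2).
  { eapply Rle_trans; [exact TD|].
    eapply Rle_trans.
    - apply Rmult_le_compat; [lra| |exact LM|exact BR].
      apply Rplus_le_le_0_compat; [nra|]. apply Rmult_le_pos; [lra|].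
      assert (0 <= d * w) by nra. assert (0 < INR M ^ 2 /\ 0 < INR M ^ 3) by (split; apply pow_lt; lra).
      assert (0 <= d * w * (INR M ^ 2 * mu)) by (apply Rmult_le_pos; nra).
      assert (0 <= d * (INR M ^ 3 / 6)) by nra.
      assert (0 <= w * (INR M * mu)) by (apply Rmult_le_pos; nra). lra.
    - replace ((489 / 1000 * s * sqrt (INR A)) ^ 2) with (239121 / 1000000 * s ^ 2 * (sqrt (INR A) * sqrt (INR A))) by field.
      rewrite sqrt_sqrt by lra. rewrite EA.
      replace (INR M * (12601 / 100000 * s ^ 2) * (INR M * (1897 / 1000 * (q * s ^ 2)))) with
        (INR M ^ 2 * (12601 / 100000 * 1897 / 1000 * (s ^ 2 * (q * s ^ 2)))) by field.
      apply Rmult_le_compat_l; [apply pow2_ge_0|].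
      assert (0 <= s ^ 2 * (q * s ^ 2)) by nra. lra. }
  apply Rmult_le_reg_l in F; [|apply pow_lt; lra].
  apply Rsqr_incr_0_var; [rewrite !Rsqr_pow2; exact F|].
  apply Rmult_le_pos; [lra|apply sqrt_pos].
Qed.

Lemma Dsum_le t n : Cmod (Dsum t n) <= 2 * sqrt (INR n).
Proof.
  eapply Rle_trans; [|apply sum_inv_sqrt_le]. eapply Rle_trans; [apply Cmod_csum|].
  apply rsum_le; intros k _. rewrite Cmod_pw by apply INR_S_pos. lra.
Qed.

(** Abel summation with the decreasing weights [n^(-1/2)] cancels the factor [sqrt A] of
    [block_bound], so every block costs the same, wherever it lies. *)
Lemma Dsum_block (s : R) (n0 L : nat) :
  316 / 10 <= s -> 4 * s ^ 2 <= INR (S n0) <= 57 / 100 * s ^ 3 -> 4 * INR L <= INR (S n0) ->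
  Cmod (Dsum (s ^ 6) (n0 + L)) <= Cmod (Dsum (s ^ 6) n0) + 489 / 1000 * s.
Proof.
  intros Hs HA HL. unfold Dsum. rewrite csum_app.
  eapply Rle_trans; [apply Cmod_triangle|]. apply Rplus_le_compat_l.
  set (A := S n0) in *. assert (HA0 : 0 < INR A) by apply INR_S_pos.
  rewrite (csum_ext _ (fun k => Cmult (RtoC (/ sqrt (INR A + INR k))) (logphase (s ^ 6) A k))).
  2:{ intros k _. unfold pw, logphase. replace (INR (S (n0 + k))) with (INR A + INR k); [reflexivity|].
      rewrite <- plus_INR. f_equal. }
  eapply Rle_trans.
  - apply (abel_bound (fun k => / sqrt (INR A + INR k)) (logphase (s ^ 6) A) L
      (489 / 1000 * s * sqrt (INR A))).
    + intros k. assert (Hk := pos_INR k). assert (Hk' := S_INR k).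
      split; [apply Rlt_le, Rinv_0_lt_compat, sqrt_lt_R0; lra|].
      apply Rinv_le_contravar; [apply sqrt_lt_R0; lra|apply sqrt_le_1; lra].
    + intros k Hk. apply block_bound with L; assumption.
  - change (INR 0) with 0. rewrite Rplus_0_r.
    assert (0 < sqrt (INR A)) by (apply sqrt_lt_R0; lra).
    apply Req_le. field. lra.
Qed.

(* [447214/100000 > 2 sqrt 5] bounds the terms [n <= 5 s^2]; every block then multiplies [n]
   by at least 1.2497, whose logarithm exceeds 0.2228. *)
Lemma Dsum_large (s : R) : 316 / 10 <= s -> forall n,
  5 * s ^ 2 <= INR n <= 57 / 100 * s ^ 3 ->
  Cmod (Dsum (s ^ 6) n) <= 447214 / 100000 * s
     + 489 / 1000 * s * (ln (INR n / (5 * s ^ 2)) * / (2228 / 10000) + 1).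
Proof.
  intros Hs. assert (Hs2 : 99856 / 100 <= s ^ 2) by (simpl; nra).
  assert (Htriv : forall n, INR n <= 5 * s ^ 2 -> Cmod (Dsum (s ^ 6) n) <= 447214 / 100000 * s).
  { intros n Hn. eapply Rle_trans; [apply Dsum_le|].
    replace (447214 / 100000 * s) with (2 * (223607 / 100000 * s)) by field.
    apply Rmult_le_compat_l; [lra|].
    rewrite <- (sqrt_square (223607 / 100000 * s)) by lra.
    apply sqrt_le_1; [apply pos_INR|nra|]. eapply Rle_trans; [exact Hn|]. simpl. nra. }
  intros n. induction n as [n IH] using lt_wf_ind. intros Hn.
  (* The last fifth of the terms forms one block. It starts above [n0 >= 4 n / 5 >= 4 s^2], which
     explains the threshold [4 s^2] in [block_bound]. *)
  set (L := (n / 5)%nat). set (n0 := (n - L)%nat).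
  assert (HLn : (5 * L <= n)%nat) by (unfold L; apply Nat.Div0.mul_div_le).
  assert (HLn' : (n < 5 * L + 5)%nat).
  { unfold L. generalize (Nat.div_mod_eq n 5) (Nat.mod_upper_bound n 5 ltac:(lia)). lia. }
  assert (En : n = (n0 + L)%nat) by (unfold n0; lia).
  assert (R1 : 5 * INR L <= INR n).
  { replace 5 with (INR 5) by (simpl; lra). rewrite <- mult_INR. apply le_INR; exact HLn. }
  assert (R2 : INR n <= 5 * INR L + 4).
  { replace 5 with (INR 5) by (simpl; lra). replace 4 with (INR 4) by (simpl; lra).
    rewrite <- mult_INR, <- plus_INR. apply le_INR; lia. }
  assert (R3 : INR n = INR n0 + INR L) by (rewrite En at 1; apply plus_INR).
  assert (RS := S_INR n0).
  assert (HL1 : 1 <= INR L) by lra.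
  assert (Hblk := Dsum_block s n0 L Hs ltac:(lra) ltac:(lra)). rewrite <- En in Hblk.
  assert (Hlnn : 0 <= ln (INR n / (5 * s ^ 2))).
  { rewrite <- ln_1. apply ln_le; [lra|].
    apply (Rmult_le_reg_r (5 * s ^ 2)); [lra|]. unfold Rdiv. rewrite Rmult_assoc, Rinv_l; lra. }
  destruct (Rle_dec (5 * s ^ 2) (INR n0)) as [H|H].
  - assert (Hlt : (n0 < n)%nat) by (apply INR_lt; lra).
    specialize (IH n0 Hlt ltac:(lra)).
    assert (Hrho : 2228 / 10000 <= ln (12497 / 10000)).
    { eapply Rle_trans; [|apply (ln_lower (12497 / 10000) (2497 / 22497)); lra]. lra. }
    (* Rounding [n / 5] down lowers the ratio [n / n0] only from 5/4 to 1.2497, because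
       [n >= 5 s^2 > 4900]. *)
    assert (Hr : 12497 / 10000 * INR n0 <= INR n) by lra.
    assert (Hln : ln (INR n0 / (5 * s ^ 2)) + 2228 / 10000 <= ln (INR n / (5 * s ^ 2))).
    { apply Rle_trans with (ln (12497 / 10000 * (INR n0 / (5 * s ^ 2)))).
      - rewrite ln_mult; [lra|lra|]. apply Rdiv_lt_0_compat; lra.
      - apply ln_le; [apply Rmult_lt_0_compat; [lra|apply Rdiv_lt_0_compat; lra]|].
        unfold Rdiv. rewrite <- Rmult_assoc. apply Rmult_le_compat_r; [|lra].
        apply Rlt_le, Rinv_0_lt_compat; lra. }
    assert (s * ((ln (INR n0 / (5 * s ^ 2)) + 2228 / 10000) * / (2228 / 10000)) <=
       s * (ln (INR n / (5 * s ^ 2)) * / (2228 / 10000))).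
    { apply Rmult_le_compat_l; [lra|]. apply Rmult_le_compat_r; lra. }
    lra.
  (* What precedes this block is covered by the trivial bound; the summand 1 next to the logarithm
     pays for the block itself. *)
  - specialize (Htriv n0 ltac:(lra)).
    assert (0 <= s * (ln (INR n / (5 * s ^ 2)) * / (2228 / 10000))).
    { apply Rmult_le_pos; [lra|]. apply Rmult_le_pos; lra. }
    lra.
Qed.

(** * Trivial bounds of the sums and the explicit approximate functional equation *)

Definition Dhalf (t : R) (N : nat) : C :=
  Cminus (Dsum t N) (Cmult (RtoC (1 / 2)) (pw t (INR N))).

Lemma Cmod_sc_ge t : 0 < t -> t <= Cmod (sc t) <= t + 1 / (8 * t).
Proof.
  intros Ht. unfold sc, Cmod; simpl fst; simpl snd. split.
  - rewrite <- (sqrt_square t) at 1 by lra. apply sqrt_le_1; nra.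
  - assert (0 < / t) by (apply Rinv_0_lt_compat; lra).
    assert (E : 1 / (8 * t) = / 8 * / t) by (field; lra). rewrite E.
    rewrite <- (sqrt_square (t + / 8 * / t)) by lra. apply sqrt_le_1; [nra|nra|].
    assert (E2 : t * / t = 1) by (field; lra). nra.
Qed.

Lemma Qsum_le t N : 0 < t -> (1 <= N)%nat ->
  Cmod (Qsum t N) <= Cmod (Dhalf t N) + sqrt (INR N) / t.
Proof.
  intros Ht HN. unfold Qsum. fold (Dhalf t N).
  assert (HN1 : 1 <= INR N) by (apply (le_INR 1); lia).
  eapply Rle_trans; [apply Cmod_minus_le|]. apply Rplus_le_compat_l.
  rewrite !Cmod_mult, Cmod_inv, Cmod_pw, Cmod_R, Rabs_pos_eq by (try apply one_minus_sc_neq_0; lra).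
  assert (Hs : 0 < sqrt (INR N)) by (apply sqrt_lt_R0; lra).
  replace (INR N * / sqrt (INR N)) with (sqrt (INR N)).
  2:{ rewrite <- (sqrt_sqrt (INR N)) at 2 by lra. field; lra. }
  apply Rmult_le_compat_l; [lra|]. apply Rinv_le_contravar; [lra|].
  rewrite <- (sqrt_square t) at 1 by lra. unfold Cmod, sc, Cminus, Cplus, Copp, RtoC; simpl fst; simpl snd.
  apply sqrt_le_1; nra.
Qed.

(** By convexity each term is at most the integral of [x^(-1/2)] over the unit interval centred at
    it. The constant lies just below [2 sqrt (3/2) - 1], the value that [N = 1] permits. *)
Lemma sum_inv_sqrt_midpoint N : (1 <= N)%nat ->
  rsum (fun j => / sqrt (INR (S j))) N <= 2 * sqrt (INR N + 1 / 2) - 1449 / 1000.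
Proof.
  induction N as [|N IH]; [lia|]. intros _. destruct N as [|N].
  - simpl. rewrite sqrt_1, Rinv_1.
    assert (12246 / 10000 <= sqrt (1 + 1 / 2)); [|lra].
    rewrite <- (sqrt_square (12246 / 10000)) by lra. apply sqrt_le_1; lra.
  - specialize (IH ltac:(lia)). rewrite rsum_S.
    assert (H1 := S_INR (S N)). set (x := INR (S N)) in *. set (y := INR (S (S N))) in *.
    assert (Hx : 0 < x) by apply INR_S_pos.
    assert (Ea : sqrt (x + 1 / 2) * sqrt (x + 1 / 2) = x + 1 / 2) by (apply sqrt_sqrt; lra).
    assert (Eb : sqrt (y + 1 / 2) * sqrt (y + 1 / 2) = y + 1 / 2) by (apply sqrt_sqrt; lra).
    assert (Ey : sqrt y * sqrt y = y) by (apply sqrt_sqrt; lra).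
    assert (Ha : 0 < sqrt (x + 1 / 2)) by (apply sqrt_lt_R0; lra).
    assert (Hb : 0 < sqrt (y + 1 / 2)) by (apply sqrt_lt_R0; lra).
    assert (Hy : 0 < sqrt y) by (apply sqrt_lt_R0; lra).
    set (a := sqrt (x + 1 / 2)) in *. set (b := sqrt (y + 1 / 2)) in *. set (c := sqrt y) in *.
    assert (Hab : (b - a) * (a + b) = 1) by nra.
    assert (a + b <= 2 * c).
    { apply Rsqr_incr_0_var; [|lra]. unfold Rsqr.
      assert (0 <= (a - b) * (a - b)) by apply Rle_0_sqr. nra. }
    assert (/ c <= 2 * (b - a)); [|lra].
    apply (Rmult_le_reg_r c); [lra|]. rewrite Rinv_l by lra.
    assert (0 < b - a) by nra. nra.
Qed.

(** Halving the last term saves [1 / (2 sqrt N)], and this pays for replacing [2 sqrt (N + 1/2)] by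
    [2 sqrt N]. *)
Lemma Dhalf_trivial t N : (1 <= N)%nat -> Cmod (Dhalf t N) <= 2 * sqrt (INR N) - 1449 / 1000.
Proof.
  intros HN. destruct N as [|N]; [lia|].
  assert (H0 := INR_S_pos N). assert (Hs : 0 < sqrt (INR (S N))) by (apply sqrt_lt_R0; lra).
  assert (E : Dhalf t (S N) = Cplus (Dsum t N) (Cmult (RtoC (1 / 2)) (pw t (INR (S N))))).
  { unfold Dhalf. change (Dsum t (S N)) with (Cplus (Dsum t N) (pw t (INR (S N)))).
    generalize (Dsum t N) (pw t (INR (S N))). intros a b.
    apply injective_projections; simpl; field. }
  rewrite E. eapply Rle_trans; [apply Cmod_triangle|].
  rewrite Cmod_mult, Cmod_R, Rabs_pos_eq, Cmod_pw by lra.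
  assert (M := sum_inv_sqrt_midpoint (S N) HN). rewrite rsum_S in M.
  assert (C : Cmod (Dsum t N) <= rsum (fun j => / sqrt (INR (S j))) N).
  { eapply Rle_trans; [apply Cmod_csum|].
    apply rsum_le; intros k _. rewrite Cmod_pw by apply INR_S_pos. lra. }
  set (x := INR (S N)) in *.
  assert (Hq : sqrt (x + 1 / 2) <= sqrt x + / 4 * / sqrt x).
  { assert (0 < / sqrt x) by (apply Rinv_0_lt_compat; lra).
    rewrite <- (sqrt_square (sqrt x + / 4 * / sqrt x)) by lra. apply sqrt_le_1; [lra|nra|].
    assert (Ex : sqrt x * sqrt x = x) by (apply sqrt_sqrt; lra).
    assert (Ei : sqrt x * / sqrt x = 1) by (field; lra). nra. }
  lra.
Qed.

Lemma Dsum_le_midpoint t k : (1 <= k)%nat ->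
  Cmod (Dsum t k) <= 2 * sqrt (INR k) + / 2 * / sqrt (INR k) - 1449 / 1000.
Proof.
  intros Hk. assert (H := Dhalf_trivial t k Hk). assert (Hk1 : 1 <= INR k) by (apply (le_INR 1); lia).
  replace (Dsum t k) with (Cplus (Dhalf t k) (Cmult (RtoC (1 / 2)) (pw t (INR k)))) by (unfold Dhalf; ring).
  eapply Rle_trans; [apply Cmod_triangle|].
  rewrite Cmod_mult, Cmod_R, Rabs_pos_eq, Cmod_pw by lra. lra.
Qed.

Lemma plus_sum_le t N k : 0 < t -> (1 <= N)%nat -> 2 * PI * INR k * INR N <= t ->
  rsum (fun j => / sqrt (2 * PI * INR (S j) * t)) k <= / (PI * sqrt (INR N)).
Proof.
  intros Ht HN Hk. assert (Hpi := PI_RGT_0).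
  assert (HN1 : 1 <= INR N) by (apply (le_INR 1); lia).
  assert (HsN : 0 < sqrt (INR N)) by (apply sqrt_lt_R0; lra).
  assert (Hst : 0 < sqrt (2 * PI * t)) by (apply sqrt_lt_R0; nra).
  rewrite (rsum_ext _ (fun j => / sqrt (2 * PI * t) * / sqrt (INR (S j)))).
  2:{ intros j _. assert (H := INR_S_pos j).
      replace (2 * PI * INR (S j) * t) with (2 * PI * t * INR (S j)) by ring.
      rewrite sqrt_mult by nra. rewrite Rinv_mult. reflexivity. }
  rewrite rsum_mult_l.
  apply Rle_trans with (/ sqrt (2 * PI * t) * (2 * sqrt (INR k))).
  - apply Rmult_le_compat_l; [apply Rlt_le, Rinv_0_lt_compat; lra|apply sum_inv_sqrt_le].
  - apply (Rmult_le_reg_r (sqrt (2 * PI * t) * (PI * sqrt (INR N)))); [apply Rmult_lt_0_compat; [lra|apply Rmult_lt_0_compat; lra]|].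
    replace (/ sqrt (2 * PI * t) * (2 * sqrt (INR k)) * (sqrt (2 * PI * t) * (PI * sqrt (INR N))))
      with (2 * PI * (sqrt (INR k) * sqrt (INR N))) by (field; lra).
    replace (/ (PI * sqrt (INR N)) * (sqrt (2 * PI * t) * (PI * sqrt (INR N)))) with (sqrt (2 * PI * t)) by (field; lra).
    rewrite <- sqrt_mult by (try apply pos_INR; lra).
    rewrite <- (sqrt_square (2 * PI)) at 1 by lra.
    assert (0 <= INR k * INR N) by (apply Rmult_le_pos; [apply pos_INR|lra]).
    rewrite <- sqrt_mult by nra. apply sqrt_le_1; nra.
Qed.

(* [y = t / (2 pi N)] is the length of the dual sum. *)
Lemma low_sum_eq t N k y : (1 <= N)%nat -> t = 2 * PI * INR N * y -> INR k < y ->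
  rsum (fun j => 2 * sqrt (INR N) / (t - 2 * PI * INR (S j) * INR N)) k =
  / (PI * sqrt (INR N)) * rsum (fun j => / (y - INR (S j))) k.
Proof.
  intros HN Ht Hk. assert (Hpi := PI_RGT_0).
  assert (HN1 : 1 <= INR N) by (apply (le_INR 1); lia).
  assert (HsN : 0 < sqrt (INR N)) by (apply sqrt_lt_R0; lra).
  assert (EN : INR N = sqrt (INR N) * sqrt (INR N)) by (rewrite sqrt_sqrt; lra).
  rewrite <- rsum_mult_l. apply rsum_ext; intros j Hj.
  assert (INR (S j) <= INR k) by (apply le_INR; lia).
  replace (t - 2 * PI * INR (S j) * INR N) with (2 * PI * (sqrt (INR N) * sqrt (INR N)) * (y - INR (S j))).
  - field. repeat split; lra.
  - rewrite <- EN, Ht. ring.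
Qed.

Lemma high_term_eq t N nu y : (1 <= N)%nat -> t = 2 * PI * INR N * y -> 0 < y < nu ->
  / nu * (/ (2 * PI * nu * INR N - t) + / (2 * PI * nu * INR N + t)) =
  / (2 * PI * INR N) * (2 / (nu ^ 2 - y ^ 2)).
Proof.
  intros HN Ht Hy. assert (Hpi := PI_RGT_0).
  assert (HN1 : 1 <= INR N) by (apply (le_INR 1); lia).
  replace (2 * PI * nu * INR N - t) with (2 * PI * INR N * (nu - y)) by (rewrite Ht; ring).
  replace (2 * PI * nu * INR N + t) with (2 * PI * INR N * (nu + y)) by (rewrite Ht; ring).
  replace (nu ^ 2 - y ^ 2) with ((nu - y) * (nu + y)) by ring.
  field. repeat split; lra.
Qed.

(* Termwise comparison with the telescoping [1/(nu-1/2) - 1/(nu+1/2) = 1/(nu^2-1/4)]. *)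
Lemma high_tail y n m : 1 / 2 <= y < INR n ->
  rsum (fun j => 2 / (INR (n + j) ^ 2 - y ^ 2)) m <= (2 * INR n + 1) / (INR n ^ 2 - y ^ 2).
Proof.
  intros Hy. set (a := INR n) in *.
  assert (Hd : 0 < a ^ 2 - y ^ 2) by nra.
  set (c := (a ^ 2 - 1 / 4) / (a ^ 2 - y ^ 2)).
  assert (Hc : 0 < c) by (apply Rdiv_lt_0_compat; nra).
  assert (T : rsum (fun j => 2 / (INR (n + j) ^ 2 - y ^ 2)) m <=
     2 * c * (/ (a - 1 / 2) - / (a + INR m - 1 / 2))).
  { induction m as [|m IH].
    - simpl rsum. change (INR 0) with 0. rewrite Rplus_0_r. lra.
    - rewrite rsum_S. rewrite plus_INR, S_INR. fold a. assert (H0 := pos_INR m).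
      set (x := a + INR m) in *. replace (a + (INR m + 1) - 1 / 2) with (x + 1 / 2) by (unfold x; lra).
      assert (Hx : a <= x) by (unfold x; lra).
      assert (Hxd : 0 < x ^ 2 - y ^ 2) by nra.
      assert (2 / (x ^ 2 - y ^ 2) <= 2 * c * (/ (x - 1 / 2) - / (x + 1 / 2))); [|lra].
      replace (/ (x - 1 / 2) - / (x + 1 / 2)) with (/ (x ^ 2 - 1 / 4)) by (field; nra).
      unfold c. apply (Rmult_le_reg_r ((x ^ 2 - y ^ 2) * (x ^ 2 - 1 / 4) * (a ^ 2 - y ^ 2))).
      { apply Rmult_lt_0_compat; [apply Rmult_lt_0_compat|]; nra. }
      replace (2 / (x ^ 2 - y ^ 2) * ((x ^ 2 - y ^ 2) * (x ^ 2 - 1 / 4) * (a ^ 2 - y ^ 2)))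
        with (2 * (x ^ 2 - 1 / 4) * (a ^ 2 - y ^ 2)) by (field; lra).
      replace (2 * ((a ^ 2 - 1 / 4) / (a ^ 2 - y ^ 2)) * / (x ^ 2 - 1 / 4) * ((x ^ 2 - y ^ 2) * (x ^ 2 - 1 / 4) * (a ^ 2 - y ^ 2)))
        with (2 * (a ^ 2 - 1 / 4) * (x ^ 2 - y ^ 2)) by (field; split; nra).
      assert (a ^ 2 <= x ^ 2) by nra. assert (1 / 4 <= y ^ 2) by nra. nra. }
  eapply Rle_trans; [exact T|].
  assert (0 < / (a + INR m - 1 / 2)) by (apply Rinv_0_lt_compat; generalize (pos_INR m); lra).
  apply Rle_trans with (2 * c * / (a - 1 / 2)); [nra|].
  unfold c. apply Req_le. field. nra.
Qed.

(** The nearest integer [k + 1] is at distance at least 1/4, which gives the 4. The integer at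
    distance at least [i] contributes at most [sqrt (y/2) i^(-3/2)] by the inequality of the means;
    these terms sum to at most [3 sqrt (y/2)], and 2.1214 exceeds [3 / sqrt 2]. *)
Lemma high_sum_general y k m : 0 < y -> INR k + 1 / 4 <= y <= INR k + 3 / 4 ->
  y * rsum (fun j => 2 / (INR (S (k + j)) ^ 2 - y ^ 2)) m <= 4 + 21214 / 10000 * sqrt y.
Proof.
  intros Hy0 Hy.
  assert (Hterm : forall j, y * (2 / (INR (S (k + S j)) ^ 2 - y ^ 2)) <=
     sqrt (y / 2) * (/ INR (S j) * / sqrt (INR (S j)))).
  { intros j. assert (H1 := INR_S_pos j). set (i := INR (S j)) in *.
    assert (E : INR (S (k + S j)) = INR k + 1 + i) by (unfold i; rewrite !S_INR, plus_INR, S_INR; ring).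
    rewrite E. set (nu := INR k + 1 + i).
    assert (Hn : i <= nu - y) by (unfold nu; lra).
    assert (Hp : i + 2 * y <= nu + y) by lra.
    assert (Hd : i * (i + 2 * y) <= nu ^ 2 - y ^ 2).
    { replace (nu ^ 2 - y ^ 2) with ((nu - y) * (nu + y)) by ring. apply Rmult_le_compat; lra. }
    assert (Hi : 0 < sqrt i) by (apply sqrt_lt_R0; lra).
    assert (Ei : sqrt i * sqrt i = i) by (apply sqrt_sqrt; lra).
    assert (Hs : 0 < sqrt (y / 2)) by (apply sqrt_lt_R0; lra).
    assert (Es : sqrt (y / 2) * sqrt (y / 2) = y / 2) by (apply sqrt_sqrt; lra).
    set (r := sqrt (y / 2)) in *.
    assert (Hdp : 0 < i * (i + 2 * y)) by nra.
    apply Rle_trans with (y * (2 / (i * (i + 2 * y)))).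
    { apply Rmult_le_compat_l; [lra|]. apply Rmult_le_compat_l; [lra|]. apply Rinv_le_contravar; lra. }
    apply (Rmult_le_reg_r (i * (i + 2 * y) * sqrt i)); [nra|].
    replace (y * (2 / (i * (i + 2 * y))) * (i * (i + 2 * y) * sqrt i)) with (2 * y * sqrt i) by (field; lra).
    replace (r * (/ i * / sqrt i) * (i * (i + 2 * y) * sqrt i)) with (r * (i + 2 * y)) by (field; lra).
    (* AM-GM: [4 r sqrt i <= i + 4 r^2] *)
    replace (2 * y) with (4 * (r * r)) by lra.
    replace (4 * (r * r) * sqrt i) with (r * (4 * r * sqrt i)) by ring.
    apply Rmult_le_compat_l; [lra|].
    assert (0 <= (sqrt i - 2 * r) * (sqrt i - 2 * r)) by apply Rle_0_sqr. nra. }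
  assert (Hr : sqrt (y / 2) * 3 <= 21214 / 10000 * sqrt y).
  { unfold Rdiv at 1. rewrite sqrt_mult by lra.
    assert (sqrt (/ 2) <= 21214 / 30000).
    { rewrite <- (sqrt_square (21214 / 30000)) by lra. apply sqrt_le_1; lra. }
    generalize (sqrt_pos y). nra. }
  assert (Hr0 := sqrt_pos (y / 2)).
  destruct m as [|m].
  { simpl rsum. rewrite Rmult_0_r. generalize (sqrt_pos y). lra. }
  replace (S m) with (1 + m)%nat by lia. rewrite rsum_app, Rmult_plus_distr_l.
  apply Rplus_le_compat.
  - change (rsum ?f 1) with (0 + f 0%nat). cbv beta. rewrite Nat.add_0_r, S_INR, Rplus_0_l.
    set (nu := INR k + 1).
    replace (nu ^ 2 - y ^ 2) with ((nu - y) * (nu + y)) by ring.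
    assert (1 / 4 <= nu - y) by (unfold nu; lra).
    apply (Rmult_le_reg_r ((nu - y) * (nu + y))); [nra|].
    replace (y * (2 / ((nu - y) * (nu + y))) * ((nu - y) * (nu + y))) with (2 * y) by (field; lra). nra.
  - rewrite <- rsum_mult_l.
    apply Rle_trans with (rsum (fun j => sqrt (y / 2) * (/ INR (S j) * / sqrt (INR (S j)))) m).
    + apply rsum_le. intros j _. apply Hterm.
    + rewrite rsum_mult_l. eapply Rle_trans; [|exact Hr]. apply Rmult_le_compat_l; [lra|].
      destruct m as [|m]; [simpl; lra|].
      replace (S m) with (1 + m)%nat by lia. rewrite rsum_app.
      assert (P := sum_inv_pow32_le m 1 (le_n 1)).
      assert (0 < / sqrt (INR (1 + m))) by (apply Rinv_0_lt_compat, sqrt_lt_R0; apply INR_S_pos).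
      change (INR 1) with 1 in P. rewrite sqrt_1, Rinv_1 in P.
      simpl (rsum _ 1). rewrite sqrt_1, Rinv_1. lra.
Qed.

(** The integer nearest to [y] gives the 4; for the others the distance exceeds an integer [i >= 1],
    and [1/i] is replaced by [1/sqrt i]. This is crude but of the order [sqrt N], which the factor
    [1 / (pi sqrt N)] compensates. *)
Lemma low_sum_general y k : INR k + 1 / 4 <= y ->
  rsum (fun j => / (y - INR (S j))) k <= 4 + 2 * sqrt (INR k).
Proof.
  intros Hy. destruct k as [|k].
  { simpl. rewrite sqrt_0. lra. }
  assert (R : forall n, (n <= k)%nat ->
    rsum (fun j => / (y - INR (S j))) n <= rsum (fun j => / sqrt (INR (S j))) k - rsum (fun j => / sqrt (INR (S j))) (k - n)).
  { induction n as [|n IH]; intros Hn.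
    - rewrite Nat.sub_0_r. simpl rsum at 1. lra.
    - specialize (IH ltac:(lia)). rewrite rsum_S.
      assert (El : (k - n)%nat = S (k - S n)) by lia. rewrite El, rsum_S in IH.
      assert (/ (y - INR (S n)) <= / sqrt (INR (S (k - S n)))); [|lra].
      rewrite <- El. rewrite minus_INR by lia. rewrite !S_INR in *.
      assert (Hkn : 1 <= INR k - INR n).
      { rewrite <- minus_INR by lia. apply (le_INR 1); lia. }
      apply Rinv_le_contravar; [apply sqrt_lt_R0; lra|].
      apply Rle_trans with (INR k - INR n); [|lra].
      rewrite <- (sqrt_square (INR k - INR n)) at 2 by lra. apply sqrt_le_1; nra. }
  specialize (R k (le_n k)). rewrite Nat.sub_diag in R. simpl (rsum _ 0) in R.
  rewrite rsum_S.
  assert (S1 := sum_inv_sqrt_le k).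
  assert (sqrt (INR k) <= sqrt (INR (S k))).
  { apply sqrt_le_1; [apply pos_INR|apply pos_INR|apply le_INR; lia]. }
  assert (/ (y - INR (S k)) <= 4).
  { replace 4 with (/ (1 / 4)) by field. apply Rinv_le_contravar; lra. }
  lra.
Qed.

(** Written in terms of [y], the three error sums share the factor [1 / (pi sqrt N)]. The factor
    [1 + 1 / (8 t)] bounds [|s| / t]. *)
Lemma functional_equation_explicit t z N k y U : is_zeta_conj t z -> 1 <= t -> (1 <= N)%nat ->
  t = 2 * PI * INR N * y -> INR k < y < INR k + 1 ->
  (forall m, y * rsum (fun j => 2 / (INR (S (k + j)) ^ 2 - y ^ 2)) m <= U) ->
  Cmod z <= Cmod (Dhalf t N) + sqrt (INR N) / t + Cmod (Dsum t k) +
    / (PI * sqrt (INR N)) * (1 + rsum (fun j => / (y - INR (S j))) k + (1 + 1 / (8 * t)) * U).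
Proof.
  intros Hz Ht HN Hy Hk HU. assert (Hpi := PI_RGT_0).
  assert (HN1 : 1 <= INR N) by (apply (le_INR 1); lia).
  assert (HsN : 0 < sqrt (INR N)) by (apply sqrt_lt_R0; lra).
  assert (Hk0 := pos_INR k).
  assert (HP : 0 < 2 * PI * INR N) by nra.
  assert (Hi : 0 < / (PI * sqrt (INR N))) by (apply Rinv_0_lt_compat; nra).
  assert (A := approximate_functional_equation t z N k (/ t * U) Hz ltac:(lra) HN).
  assert (HS := S_INR k).
  specialize (A ltac:(rewrite Hy; nra) ltac:(rewrite Hy, HS; nra)).
  assert (HV : forall m, rsum (fun j => / INR (S (k + j)) *
     (/ (2 * PI * INR (S (k + j)) * INR N - t) + / (2 * PI * INR (S (k + j)) * INR N + t))) m <= / t * U).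
  { intros m. rewrite (rsum_ext _ (fun j => / (2 * PI * INR N) * (2 / (INR (S (k + j)) ^ 2 - y ^ 2)))).
    - rewrite rsum_mult_l. specialize (HU m).
      replace (/ t) with (/ (2 * PI * INR N) * / y) by (rewrite Hy; field; lra).
      replace (/ (2 * PI * INR N) * / y * U) with (/ (2 * PI * INR N) * (/ y * U)) by ring.
      apply Rmult_le_compat_l; [apply Rlt_le, Rinv_0_lt_compat; lra|].
      apply (Rmult_le_reg_l y); [lra|]. eapply Rle_trans; [exact HU|].
      apply Req_le. field. lra.
    - intros j _. apply high_term_eq; try assumption.
      split; [lra|]. apply Rlt_le_trans with (INR (S k)); [lra|apply le_INR; lia]. }
  specialize (A HV).
  assert (HU0 : 0 <= U) by (specialize (HU 0%nat); simpl in HU; lra).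
  rewrite (low_sum_eq t N k y) in A by (try assumption; lra).
  assert (B := plus_sum_le t N k ltac:(lra) HN ltac:(rewrite Hy; nra)).
  assert (C := Qsum_le t N ltac:(lra) HN).
  assert (D : Cmod (sc t) / (PI * sqrt (INR N)) * (/ t * U) <= / (PI * sqrt (INR N)) * ((1 + 1 / (8 * t)) * U)).
  { replace (Cmod (sc t) / (PI * sqrt (INR N)) * (/ t * U)) with (/ (PI * sqrt (INR N)) * ((Cmod (sc t) * / t) * U)) by (field; lra).
    apply Rmult_le_compat_l; [lra|]. apply Rmult_le_compat_r; [lra|].
    apply (Rmult_le_reg_r t); [lra|]. rewrite Rmult_assoc, Rinv_l by lra.
    destruct (Cmod_sc_ge t ltac:(lra)) as [_ H].
    assert (1 / (8 * t) <= 1 / (8 * t) * t).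
    { assert (0 < 1 / (8 * t)) by (apply Rdiv_lt_0_compat; lra). nra. }
    lra. }
  assert (Cmod z <= Cmod (Cminus z (Qsum t N)) + Cmod (Qsum t N)).
  { replace z with (Cplus (Cminus z (Qsum t N)) (Qsum t N)) at 1 by ring. apply Cmod_triangle. }
  lra.
Qed.

(* [k] is chosen with [k + 1/2] just below [Y] and [N] as the integer nearest to
   [t / (2 pi (k + 1/2))]; as [N >= 2 k + 1], this keeps [y] at distance 1/4 from the integers. *)
Lemma functional_equation_bound t z : is_zeta_conj t z -> 450 <= t ->
  exists N k : nat, (11 <= N)%nat /\ (5 <= k)%nat /\
    INR N <= 2 * sqrt (t / (4 * PI)) + 291 / 100 /\
    sqrt (t / (4 * PI)) - 3 / 2 <= INR k <= sqrt (t / (4 * PI)) - 1 / 2 /\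
    2 * sqrt (t / (4 * PI)) - 1 / 2 <= INR N /\
    2 * PI * INR k * INR N <= t /\
    Cmod z <= Cmod (Dhalf t N) + Cmod (Dsum t k) + 186 / 100.
Proof.
  intros Hz Ht. assert (Hpi := PI_bounds).
  set (Y := sqrt (t / (4 * PI))).
  assert (Ht4 : 35806 / 1000 <= t / (4 * PI)).
  { apply (Rmult_le_reg_r (4 * PI)); [lra|]. unfold Rdiv at 2. rewrite Rmult_assoc, Rinv_l; lra. }
  assert (EY : Y * Y = t / (4 * PI)) by (apply sqrt_sqrt; lra).
  assert (HY0 : 0 <= Y) by apply sqrt_pos.
  assert (HY : 598 / 100 <= Y) by nra.
  assert (EtY : t = 4 * PI * (Y * Y)) by (rewrite EY; field; lra).
  destruct (nat_ceil (Y - 3 / 2)) as [k [Hk1 Hk2]]; [lra|].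
  assert (Hk5 : (5 <= k)%nat).
  { apply INR_le. apply Rnot_lt_le; intros H.
    assert (k <= 4)%nat by (apply INR_lt in H; lia).
    assert (INR k <= INR 4) by (apply le_INR; lia). simpl (INR 4) in H1. lra. }
  assert (Hk5' : 5 <= INR k) by (apply (le_INR 5) in Hk5; simpl (INR 5) in Hk5; lra).
  set (Ns := 2 * (Y * Y) / (INR k + 1 / 2)).
  assert (ENs : Ns * (INR k + 1 / 2) = 2 * (Y * Y)) by (unfold Ns; field; lra).
  assert (HNs1 : 2 * Y <= Ns).
  { apply (Rmult_le_reg_r (INR k + 1 / 2)); [lra|]. rewrite ENs. nra. }
  assert (HNs2 : 2 * (INR k + 1 / 2) <= Ns) by lra.
  assert (HNs3 : Ns <= 2 * Y + 241 / 100).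
  { apply (Rmult_le_reg_r (INR k + 1 / 2)); [lra|]. rewrite ENs.
    apply Rle_trans with ((2 * Y + 241 / 100) * (Y - 1)); [nra|]. apply Rmult_le_compat_l; lra. }
  destruct (nat_ceil (Ns - 1 / 2)) as [N [HN1 HN2]]; [lra|].
  assert (HNk : (2 * k + 1 <= N)%nat).
  { assert (2 * INR k < INR N) by lra.
    assert (2 * k < N)%nat; [|lia]. apply INR_lt. rewrite mult_INR. simpl (INR 2). lra. }
  assert (HN11 : (11 <= N)%nat) by lia.
  assert (HNk' : 2 * INR k + 1 <= INR N).
  { apply le_INR in HNk. rewrite plus_INR, mult_INR in HNk. simpl (INR 2) in HNk. simpl (INR 1) in HNk. lra. }
  set (y := Ns * (INR k + 1 / 2) / INR N).
  assert (Ey : INR N * y = 2 * (Y * Y)) by (unfold y; rewrite ENs; field; lra).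
  assert (Hty : t = 2 * PI * INR N * y) by (replace (2 * PI * INR N * y) with (2 * PI * (INR N * y)) by ring; rewrite Ey; lra).
  assert (Hyk : INR k + 1 / 4 <= y <= INR k + 3 / 4).
  { split; apply (Rmult_le_reg_l (INR N)); try lra; rewrite Ey, <- ENs; nra. }
  assert (Hy0 : 0 < y) by lra.
  exists N, k. repeat split; try assumption; try lra.
  { rewrite Hty. replace (2 * PI * INR k * INR N) with (2 * PI * INR N * INR k) by ring.
    apply Rmult_le_compat_l; [nra|lra]. }
  assert (A := functional_equation_explicit t z N k y (4 + 21214 / 10000 * sqrt y) Hz ltac:(lra) ltac:(lia) Hty ltac:(lra)
    (fun m => high_sum_general y k m Hy0 Hyk)).
  assert (L := low_sum_general y k ltac:(lra)).
  set (n := sqrt (INR N)) in *.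
  assert (Hn0 : 0 < n) by (apply sqrt_lt_R0; lra).
  assert (En : n * n = INR N) by (apply sqrt_sqrt; lra).
  assert (Hn : 33166 / 10000 <= n) by (apply (le_INR 11) in HN11; simpl (INR 11) in HN11; nra).
  assert (K1 : sqrt (INR k) <= 7072 / 10000 * n).
  { apply Rsqr_incr_0_var; [|lra]. unfold Rsqr. rewrite sqrt_sqrt by lra. nra. }
  assert (K2 : sqrt y <= 7231 / 10000 * n).
  { apply Rsqr_incr_0_var; [|lra]. unfold Rsqr. rewrite sqrt_sqrt by lra. nra. }
  assert (Hn_t : n / t <= 2 / 100).
  { apply (Rmult_le_reg_r t); [lra|]. unfold Rdiv at 1. rewrite Rmult_assoc, Rinv_l by lra.
    assert (HYY : 598 / 100 * Y <= Y * Y) by (apply Rmult_le_compat_r; lra).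
    assert (HnY : n <= Y).
    { apply Rsqr_incr_0_var; [|lra]. unfold Rsqr. lra. }
    assert (12 * (Y * Y) <= t).
    { rewrite EtY. apply Rmult_le_compat_r; lra. }
    lra. }
  assert (H8 : 1 / (8 * t) <= 1 / 3600).
  { unfold Rdiv. rewrite !Rmult_1_l. apply Rinv_le_contravar; lra. }
  set (E := 1 + rsum (fun j => / (y - INR (S j))) k + (1 + 1 / (8 * t)) * (4 + 21214 / 10000 * sqrt y)) in *.
  assert (HE : E <= 9 + 2 / 1000 + 2951 / 1000 * n).
  { unfold E. assert (0 <= sqrt y) by apply sqrt_pos.
    assert ((1 + 1 / (8 * t)) * (4 + 21214 / 10000 * sqrt y) <= (1 + 1 / 3600) * (4 + 21214 / 10000 * sqrt y)).
    { apply Rmult_le_compat_r; lra. }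
    lra. }
  (* [E] is linear in [n >= sqrt 11], so [E / (pi n)] is bounded; the remaining 0.02 of the constant
     1.86 is for [n / t]. *)
  assert (HF : / (PI * n) * E <= 184 / 100).
  { apply (Rmult_le_reg_l (PI * n)); [nra|]. rewrite <- Rmult_assoc, Rinv_r, Rmult_1_l by nra.
    eapply Rle_trans; [exact HE|].
    apply Rle_trans with (31415 / 10000 * n * (184 / 100)); [lra|].
    apply Rmult_le_compat_r; [lra|]. apply Rmult_le_compat_r; lra. }
  lra.
Qed.

(** * The range [t >= 450], in terms of [s = t^(1/6)] *)

Lemma ln_2_ge : 6930 / 10000 <= ln 2.
Proof.
  replace 2 with ((5 / 4) ^ 3 * (128 / 125)) by field.
  rewrite ln_mult, ln_pow by (try apply pow_lt; lra). simpl (INR 3).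
  assert (A := ln_lower (5 / 4) (1 / 9) ltac:(lra) ltac:(lra)).
  assert (B := ln_lower (128 / 125) (3 / 253) ltac:(lra) ltac:(lra)). lra.
Qed.

(** 0.282 and 0.2821 enclose [1 / sqrt (4 pi)]. *)
Lemma Y_bounds s : 0 < s -> 282 / 1000 * s ^ 3 <= sqrt (s ^ 6 / (4 * PI)) <= 2821 / 10000 * s ^ 3.
Proof.
  intros Hs. assert (Hpi := PI_bounds). assert (H3 : 0 < s ^ 3) by (apply pow_lt; lra).
  assert (E : s ^ 6 / (4 * PI) = (s ^ 3 * s ^ 3) * / (4 * PI)) by (field; lra).
  assert (I1 : 79577 / 1000000 <= / (4 * PI)).
  { replace (79577 / 1000000) with (/ (1000000 / 79577)) by field. apply Rinv_le_contravar; lra. }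
  assert (I2 : / (4 * PI) <= 795804 / 10000000).
  { replace (795804 / 10000000) with (/ (10000000 / 795804)) by field. apply Rinv_le_contravar; lra. }
  assert (H33 : 0 < s ^ 3 * s ^ 3) by nra.
  rewrite E. split.
  - rewrite <- (sqrt_square (282 / 1000 * s ^ 3)) by lra. apply sqrt_le_1; nra.
  - rewrite <- (sqrt_square (2821 / 10000 * s ^ 3)) by lra. apply sqrt_le_1; nra.
Qed.

(** From [N k <= s^6 / (2 pi)] the two logarithms add up to at most [2 ln s - ln (50 pi)], and
    [50 pi > 157], [ln 157 >= 5]. The coefficient of [s ln s] is [2 * 0.489 / 0.2228 < 4.392]. The
    terms linear in [s], with the constant 1.86 + 0.5 divided by [s >= 31.6], amount to about 10 and
    are outweighed by [5 * 0.489 / 0.2228]. *)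
Lemma zeta_large s z : 316 / 10 <= s -> is_zeta_conj (s ^ 6) z -> Cmod z <= 4392 / 1000 * s * ln s.
Proof.
  intros Hs Hz. assert (Hpi := PI_bounds).
  assert (Hs2 : 99856 / 100 <= s ^ 2) by (simpl; nra).
  assert (Hs3 : 316 / 10 * s ^ 2 <= s ^ 3).
  { replace (s ^ 3) with (s * s ^ 2) by ring. apply Rmult_le_compat_r; lra. }
  assert (Hs6 : 450 <= s ^ 6).
  { replace (s ^ 6) with (s ^ 3 * s ^ 3) by ring. nra. }
  destruct (functional_equation_bound (s ^ 6) z Hz Hs6) as [N [k [HN [Hk [N1 [K1 [N2 [HNk B]]]]]]]].
  destruct (Y_bounds s ltac:(lra)) as [Y1 Y2].
  set (Y := sqrt (s ^ 6 / (4 * PI))) in *.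
  assert (D1 := Dsum_large s Hs N ltac:(lra)).
  assert (D2 := Dsum_large s Hs k ltac:(lra)).
  assert (HN0 : 5 * s ^ 2 <= INR N) by lra.
  assert (Hk0 : 5 * s ^ 2 <= INR k) by lra.
  assert (Dh : Cmod (Dhalf (s ^ 6) N) <= Cmod (Dsum (s ^ 6) N) + 1 / 2).
  { unfold Dhalf. eapply Rle_trans; [apply Cmod_minus_le|]. apply Rplus_le_compat_l.
    rewrite Cmod_mult, Cmod_R, Rabs_pos_eq, Cmod_pw by lra.
    assert (/ sqrt (INR N) <= 1); [|lra].
    rewrite <- Rinv_1. apply Rinv_le_contravar; [lra|]. rewrite <- sqrt_1. apply sqrt_le_1; lra. }
  assert (Hls : 0 <= ln s) by (rewrite <- ln_1; apply ln_le; lra).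
  assert (L157 : 5 <= ln 157).
  { replace 157 with (2 ^ 7 * (157 / 128)) by field.
    rewrite ln_mult, ln_pow by (try apply pow_lt; lra). simpl (INR 7).
    assert (A := ln_2_ge). assert (A2 := ln_lower (157 / 128) (29 / 285) ltac:(lra) ltac:(lra)).
    lra. }
  assert (HL : ln (INR N / (5 * s ^ 2)) + ln (INR k / (5 * s ^ 2)) <= 2 * ln s - 5).
  { rewrite <- ln_mult by (apply Rdiv_lt_0_compat; lra).
    apply Rle_trans with (ln (s ^ 2 / 157)).
    - apply ln_le.
      + apply Rmult_lt_0_compat; apply Rdiv_lt_0_compat; lra.
      + assert (HNk' : INR N * INR k <= s ^ 6 / (2 * PI)).
        { apply (Rmult_le_reg_r (2 * PI)); [lra|]. replace (s ^ 6 / (2 * PI) * (2 * PI)) with (s ^ 6) by (field; lra). lra. }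
        replace (INR N / (5 * s ^ 2) * (INR k / (5 * s ^ 2))) with (INR N * INR k * / (25 * s ^ 4)) by (field; lra).
        assert (H4 : 0 < s ^ 4) by (apply pow_lt; lra).
        apply Rle_trans with (s ^ 6 / (2 * PI) * / (25 * s ^ 4)).
        * apply Rmult_le_compat_r; [apply Rlt_le, Rinv_0_lt_compat; lra|exact HNk'].
        * replace (s ^ 6 / (2 * PI) * / (25 * s ^ 4)) with (s ^ 2 / (50 * PI)) by (field; lra).
          apply Rmult_le_compat_l; [lra|]. apply Rinv_le_contravar; lra.
    - unfold Rdiv. rewrite ln_mult, ln_Rinv, ln_pow by (try apply Rinv_0_lt_compat; lra).
      simpl (INR 2). lra. }
  assert (s * ((ln (INR N / (5 * s ^ 2)) + ln (INR k / (5 * s ^ 2))) * / (2228 / 10000)) <=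
    s * ((2 * ln s - 5) * / (2228 / 10000))).
  { apply Rmult_le_compat_l; [lra|]. apply Rmult_le_compat_r; lra. }
  assert (0 <= s * ln s) by (apply Rmult_le_pos; lra).
  lra.
Qed.

(* The difference of the two sides increases and then decreases in [v]. *)
Lemma linear_le_ln v : 166 / 100 <= v <= 563 / 100 -> 256458 / 100000 * v + 1 / 10 <= 8784 / 1000 * ln v.
Proof.
  intros Hv.
  assert (A1 : 5064 / 10000 <= ln (166 / 100)).
  { eapply Rle_trans; [|apply (ln_lower (166 / 100) (66 / 266)); lra]. lra. }
  assert (A2 : 1724 / 1000 <= ln (563 / 100)).
  { replace (563 / 100) with (2 * (2 * (563 / 400))) by field. rewrite !ln_mult by lra.
    assert (A := ln_2_ge). assert (A3 := ln_lower (563 / 400) (163 / 963) ltac:(lra) ltac:(lra)). lra. }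
  set (f := fun x => 8784 / 1000 * ln x - 256458 / 100000 * x).
  assert (D : forall x, 0 < x -> is_derive f x (8784 / 1000 / x - 256458 / 100000)).
  { intros x Hx. unfold f. auto_derive; [lra|field; lra]. }
  destruct (Rle_dec (256458 / 100000 * v) (8784 / 1000)) as [H|H].
  - assert (f (166 / 100) <= f v).
    { apply (derive_nonneg_le f (fun x => 8784 / 1000 / x - 256458 / 100000)); [lra| |].
      - intros x Hx; apply D; lra.
      - intros x Hx. assert (256458 / 100000 <= 8784 / 1000 / x); [|lra].
        apply (Rmult_le_reg_r x); [lra|]. unfold Rdiv at 2. rewrite Rmult_assoc, Rinv_l; lra. }
    unfold f in H0. lra.
  - assert (- f v <= - f (563 / 100)).
    { apply (derive_nonneg_le (fun x => - f x) (fun x => - (8784 / 1000 / x - 256458 / 100000))); [lra| |].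
      - intros x Hx; apply (is_derive_opp f), D; lra.
      - intros x Hx. assert (8784 / 1000 / x <= 256458 / 100000); [|lra].
        apply (Rmult_le_reg_r x); [lra|]. unfold Rdiv at 1. rewrite Rmult_assoc, Rinv_l; lra. }
    unfold f in H0. lra.
Qed.

(** With [v = sqrt s] one has [sqrt Y <= 0.53114 v^3], and the trivial bounds of both sums come to
    about [2 (sqrt 2 + 1) sqrt Y], at most [2.56458 v^3] plus a small constant. Division by [v^2]
    leaves [linear_le_ln], where [8.784 = 2 * 4.392] because [ln s = 2 ln v]. *)
Lemma zeta_mid s z : 0 < s -> 450 <= s ^ 6 -> s <= 316 / 10 -> is_zeta_conj (s ^ 6) z ->
  Cmod z <= 4392 / 1000 * s * ln s.
Proof.
  intros Hs0 Hs6 Hs Hz. assert (Hpi := PI_bounds).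
  destruct (functional_equation_bound (s ^ 6) z Hz Hs6) as [N [k [HN [Hk [N1 [K1 [N2 [HNk B]]]]]]]].
  destruct (Y_bounds s Hs0) as [Y1 Y2].
  set (Y := sqrt (s ^ 6 / (4 * PI))) in *.
  set (v := sqrt s). assert (Hv0 : 0 < v) by (apply sqrt_lt_R0; lra).
  assert (Ev : v * v = s) by (apply sqrt_sqrt; lra).
  assert (Hk5 : 5 <= INR k) by (apply (le_INR 5) in Hk; simpl (INR 5) in Hk; lra).
  assert (HN11 : 11 <= INR N) by (apply (le_INR 11) in HN; simpl (INR 11) in HN; lra).
  assert (HY0 : 11 / 2 <= Y) by lra.
  assert (Hsv : s ^ 3 = v ^ 6) by (rewrite <- Ev; ring).
  assert (Hv : 166 / 100 <= v <= 563 / 100).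
  { split.
    - apply Rnot_lt_le; intros H.
      assert (v ^ 12 <= (166 / 100) ^ 12) by (apply pow_incr; lra).
      replace (s ^ 6) with (v ^ 12) in Hs6 by (rewrite <- Ev; ring). simpl in H0. lra.
    - apply Rsqr_incr_0_var; [|lra]. unfold Rsqr. lra. }
  assert (Hy : sqrt Y <= 53114 / 100000 * v ^ 3).
  { rewrite <- (sqrt_square (53114 / 100000 * v ^ 3)) by (assert (0 < v ^ 3) by (apply pow_lt; lra); lra).
    apply sqrt_le_1; [lra|apply Rle_0_sqr|]. eapply Rle_trans; [exact Y2|]. rewrite Hsv.
    replace (53114 / 100000 * v ^ 3 * (53114 / 100000 * v ^ 3)) with (53114 / 100000 * (53114 / 100000) * v ^ 6) by ring.
    assert (0 < v ^ 6) by (apply pow_lt; lra). lra. }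
  assert (D1 := Dhalf_trivial (s ^ 6) N ltac:(lia)).
  assert (D2 := Dsum_le_midpoint (s ^ 6) k ltac:(lia)).
  assert (S1 : sqrt (INR k) <= sqrt Y) by (apply sqrt_le_1; lra).
  assert (S2 : / sqrt (INR k) <= 448 / 1000).
  { assert (2235 / 1000 <= sqrt (INR k)).
    { rewrite <- (sqrt_square (2235 / 1000)) by lra. apply sqrt_le_1; lra. }
    replace (448 / 1000) with (/ (1000 / 448)) by field. apply Rinv_le_contravar; lra. }
  assert (S3 : sqrt (INR N) <= 141422 / 100000 * sqrt Y + 44 / 100).
  { assert (Ey : sqrt Y * sqrt Y = Y) by (apply sqrt_sqrt; lra).
    assert (Hy2 : 2345 / 1000 <= sqrt Y) by (rewrite <- (sqrt_square (2345 / 1000)) by lra; apply sqrt_le_1; lra).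
    apply Rsqr_incr_0_var; [|lra]. unfold Rsqr. rewrite sqrt_sqrt by lra. nra. }
  assert (C := linear_le_ln v Hv).
  assert (Els : ln s = 2 * ln v) by (rewrite <- Ev, ln_mult by lra; ring).
  rewrite Els, <- Ev.
  apply (Rmult_le_compat_l (v * v)) in C; [|nra].
  assert (27556 / 10000 <= v * v) by (clear - Hv; nra).
  assert (0 < v * v * v) by (repeat apply Rmult_lt_0_compat; lra).
  replace (v ^ 3) with (v * v * v) in Hy by ring.
  lra.
Qed.

(** * Verification on an interval of [t] from rational data *)

Definition zbound (t : R) : R := 732 / 1000 * Rpower t (1 / 6) * ln t.

Lemma Rpower_sixth_ge c t : 0 < c -> c ^ 6 <= t -> c <= Rpower t (1 / 6).
Proof.
  intros Hc Ht. assert (0 < c ^ 6) by (apply pow_lt; lra).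
  replace c with (Rpower (c ^ 6) (1 / 6)) at 1.
  - apply Rle_Rpower_l; lra.
  - rewrite <- Rpower_pow, Rpower_mult by lra.
    replace (INR 6 * (1 / 6)) with 1 by (simpl; field). apply Rpower_1; lra.
Qed.

(* [l] comes from [ln a = m ln 2 + 2 (z + z^3/3 + ...)]. *)
Lemma zbound_lower (m : nat) (a z c l t B : R) :
  0 < c -> 0 <= z < 1 -> a * (1 - z) = 2 ^ m * (1 + z) -> c ^ 6 <= a -> a <= t ->
  0 <= l <= INR m * (6930 / 10000) + (2 * z + 2 / 3 * z ^ 3) ->
  B <= 732 / 1000 * c * l -> B <= zbound t.
Proof.
  intros Hc Hz Ha Hca Hat Hl HB. eapply Rle_trans; [exact HB|]. unfold zbound.
  assert (Hp : 0 < c ^ 6) by (apply pow_lt; lra).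
  assert (H2 : 0 < 2 ^ m) by (apply pow_lt; lra).
  assert (L : l <= ln t).
  { apply Rle_trans with (ln a); [|apply ln_le; lra].
    replace a with (2 ^ m * (a / 2 ^ m)) by (field; lra).
    assert (0 < a / 2 ^ m) by (apply Rdiv_lt_0_compat; lra).
    rewrite ln_mult, ln_pow by lra.
    assert (A := ln_lower (a / 2 ^ m) z Hz). assert (L2 := ln_2_ge).
    assert (INR m * (6930 / 10000) <= INR m * ln 2) by (apply Rmult_le_compat_l; [apply pos_INR|lra]).
    assert (2 * z + 2 / 3 * z ^ 3 <= ln (a / 2 ^ m)); [|lra].
    apply A. apply (Rmult_eq_reg_l (2 ^ m)); [|lra].
    replace (2 ^ m * (a / 2 ^ m * (1 - z))) with (a * (1 - z)) by (field; lra). exact Ha. }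
  assert (C := Rpower_sixth_ge c t Hc ltac:(lra)).
  apply Rmult_le_compat; [nra|lra| |exact L]. apply Rmult_le_compat_l; lra.
Qed.

Lemma EMmain_parts t n : 0 < n ->
  Re (EMmain t n) = - (n / 2 / (1 / 4 + t ^ 2)) + 1 / (24 * n) - (15 / 8 - 9 / 2 * t ^ 2) / (720 * n ^ 3) /\
  Im (EMmain t n) = n * t / (1 / 4 + t ^ 2) - t / (12 * n) - (t ^ 3 - 23 / 4 * t) / (720 * n ^ 3).
Proof.
  intros Hn. assert (Hd : 0 < 1 / 4 + t ^ 2) by nra.
  unfold EMmain, poch3, sc, Re, Im; simpl fst; simpl snd.
  split; field; repeat split; nra.
Qed.

Lemma Cmod_le_parts (z : C) m : 0 <= m -> Re z ^ 2 + Im z ^ 2 <= m ^ 2 -> Cmod z <= m.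
Proof.
  intros Hm H. rewrite <- Cmod2_alt in H. apply Rsqr_incr_0_var; [|exact Hm].
  rewrite !Rsqr_pow2. exact H.
Qed.

Lemma Cmod_poch5_le t b P : 0 <= t <= b -> 0 <= P ->
  (1 / 4 + b ^ 2) * (9 / 4 + b ^ 2) * (25 / 4 + b ^ 2) * (49 / 4 + b ^ 2) * (81 / 4 + b ^ 2) <= P ^ 2 ->
  Cmod (poch5 t) <= P.
Proof.
  intros Ht HP H. apply Rsqr_incr_0_var; [|exact HP]. rewrite !Rsqr_pow2.
  unfold poch5. rewrite !Cmod_mult.
  replace ((Cmod (sc t) * (Cmod (sc t + 1) * (Cmod (sc t + 2) * (Cmod (sc t + 3) * Cmod (sc t + 4))))) ^ 2)
    with (Cmod (sc t) ^ 2 * Cmod (sc t + 1) ^ 2 * Cmod (sc t + 2) ^ 2 * Cmod (sc t + 3) ^ 2 * Cmod (sc t + 4) ^ 2) by ring.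
  rewrite !Cmod2_alt. unfold sc, Re, Im; simpl fst; simpl snd.
  eapply Rle_trans; [|exact H].
  assert (Hs : forall x, 0 <= x -> 0 <= x ^ 2 + t ^ 2 <= x ^ 2 + b ^ 2) by (intros; nra).
  repeat (apply Rmult_le_compat; [repeat apply Rmult_le_pos| | |]); nra.
Qed.

(** For [t >= 2] the real part of [1/2 + EMmain] increases with [t] and the imaginary part
    decreases, so inequalities at [a] and [b] control the whole interval. The other data are
    rational majorants: [S] of the trivial sum, [w] of [1 / sqrt n], [m] of the modulus of
    [1/2 + EMmain], and [P] of [|poch5|]. *)
Lemma euler_maclaurin_interval t z (N : nat) (a b S w R I m P : R) :
  is_zeta_conj t z -> 2 <= a -> a <= t <= b ->
  let n := INR (Datatypes.S N) in
  rsum (fun j => / sqrt (INR (Datatypes.S j))) N <= S -> 0 <= w -> 1 <= n * w ^ 2 -> 0 <= m -> 0 <= P ->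
  - R <= 1 / 2 - n / 2 / (1 / 4 + a ^ 2) + 1 / (24 * n) - (15 / 8 - 9 / 2 * a ^ 2) / (720 * n ^ 3) ->
  1 / 2 - n / 2 / (1 / 4 + b ^ 2) + 1 / (24 * n) - (15 / 8 - 9 / 2 * b ^ 2) / (720 * n ^ 3) <= R ->
  - I <= n * b / (1 / 4 + b ^ 2) - b / (12 * n) - (b ^ 3 - 23 / 4 * b) / (720 * n ^ 3) ->
  n * a / (1 / 4 + a ^ 2) - a / (12 * n) - (a ^ 3 - 23 / 4 * a) / (720 * n ^ 3) <= I ->
  R ^ 2 + I ^ 2 <= m ^ 2 ->
  (1 / 4 + b ^ 2) * (9 / 4 + b ^ 2) * (25 / 4 + b ^ 2) * (49 / 4 + b ^ 2) * (81 / 4 + b ^ 2) <= P ^ 2 ->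
  Cmod z <= S + w * m + P * (246 / 5400000) * w / n ^ 4.
Proof.
  intros Hz Ha Ht n HS Hw0 Hw Hm HP HR1 HR2 HI1 HI2 Hm2 HP2.
  assert (Hn : 1 <= n) by (unfold n; apply (le_INR 1); lia).
  assert (Hn3 : 0 < 720 * n ^ 3) by (assert (0 < n ^ 3) by (apply pow_lt; lra); lra).
  assert (Hi3 : 0 < / (720 * n ^ 3)) by (apply Rinv_0_lt_compat; lra).
  assert (Hw1 : / sqrt n <= w).
  { assert (Hsn : 0 < sqrt n) by (apply sqrt_lt_R0; lra).
    apply (Rmult_le_reg_r (sqrt n)); [lra|]. rewrite Rinv_l by lra.
    apply Rsqr_incr_0_var; [|apply Rmult_le_pos; lra]. unfold Rsqr.
    replace (w * sqrt n * (w * sqrt n)) with (w ^ 2 * (sqrt n * sqrt n)) by ring. rewrite sqrt_sqrt; lra. }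
  assert (Hz' := Hz (Datatypes.S N) ltac:(lia)). fold n in Hz'.
  assert (EA : A5 t (Datatypes.S N) = Cplus (Dsum t N) (Cmult (pw t n) (Cplus (RtoC (1 / 2)) (EMmain t n)))).
  { unfold A5. change (Dsum t (Datatypes.S N)) with (Cplus (Dsum t N) (pw t (INR (Datatypes.S N)))). fold n.
    generalize (Dsum t N) (pw t n) (EMmain t n). intros x y u.
    apply injective_projections; simpl; field. }
  assert (HD : Cmod (Dsum t N) <= S).
  { eapply Rle_trans; [apply Cmod_csum|]. eapply Rle_trans; [|exact HS].
    apply rsum_le; intros k _. rewrite Cmod_pw by apply INR_S_pos. lra. }
  assert (Hmain : Cmod (Cplus (RtoC (1 / 2)) (EMmain t n)) <= m).
  { apply Cmod_le_parts; [exact Hm|]. destruct (EMmain_parts t n ltac:(lra)) as [E1 E2].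
    replace (Re (Cplus (RtoC (1 / 2)) (EMmain t n))) with (1 / 2 + Re (EMmain t n)) by (unfold Re; simpl; ring).
    replace (Im (Cplus (RtoC (1 / 2)) (EMmain t n))) with (Im (EMmain t n)) by (unfold Im; simpl; ring).
    rewrite E1, E2.
    assert (Hsq : forall x r, - r <= x <= r -> x ^ 2 <= r ^ 2) by (intros; nra).
    assert (M1 : forall x y, 2 <= x <= y -> 1 / 2 - n / 2 / (1 / 4 + x ^ 2) + 1 / (24 * n) - (15 / 8 - 9 / 2 * x ^ 2) / (720 * n ^ 3)
      <= 1 / 2 - n / 2 / (1 / 4 + y ^ 2) + 1 / (24 * n) - (15 / 8 - 9 / 2 * y ^ 2) / (720 * n ^ 3)).
    { intros x y Hxy. assert (x ^ 2 <= y ^ 2) by nra.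
      assert (/ (1 / 4 + y ^ 2) <= / (1 / 4 + x ^ 2)) by (apply Rinv_le_contravar; nra).
      assert (n / 2 * / (1 / 4 + y ^ 2) <= n / 2 * / (1 / 4 + x ^ 2)) by (apply Rmult_le_compat_l; lra).
      assert ((15 / 8 - 9 / 2 * y ^ 2) * / (720 * n ^ 3) <= (15 / 8 - 9 / 2 * x ^ 2) * / (720 * n ^ 3)) by (apply Rmult_le_compat_r; lra).
      unfold Rdiv in *. lra. }
    assert (M2 : forall x y, 2 <= x <= y -> n * y / (1 / 4 + y ^ 2) - y / (12 * n) - (y ^ 3 - 23 / 4 * y) / (720 * n ^ 3)
      <= n * x / (1 / 4 + x ^ 2) - x / (12 * n) - (x ^ 3 - 23 / 4 * x) / (720 * n ^ 3)).
    { intros x y Hxy.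
      assert (n * y / (1 / 4 + y ^ 2) <= n * x / (1 / 4 + x ^ 2)).
      { apply (Rmult_le_reg_r ((1 / 4 + y ^ 2) * (1 / 4 + x ^ 2))); [apply Rmult_lt_0_compat; nra|].
        replace (n * y / (1 / 4 + y ^ 2) * ((1 / 4 + y ^ 2) * (1 / 4 + x ^ 2))) with (n * (y * (1 / 4 + x ^ 2))) by (field; nra).
        replace (n * x / (1 / 4 + x ^ 2) * ((1 / 4 + y ^ 2) * (1 / 4 + x ^ 2))) with (n * (x * (1 / 4 + y ^ 2))) by (field; nra).
        apply Rmult_le_compat_l; [lra|].
        assert (0 <= (y - x) * (x * y - 1 / 4)) by (apply Rmult_le_pos; nra). nra. }
      assert (x / (12 * n) <= y / (12 * n)).
      { apply Rmult_le_compat_r; [apply Rlt_le, Rinv_0_lt_compat; lra|lra]. }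
      assert (x ^ 3 - 23 / 4 * x <= y ^ 3 - 23 / 4 * y).
      { assert (0 <= (y - x) * (x * x + x * y + y * y - 23 / 4)) by (apply Rmult_le_pos; nra). nra. }
      assert ((x ^ 3 - 23 / 4 * x) / (720 * n ^ 3) <= (y ^ 3 - 23 / 4 * y) / (720 * n ^ 3)) by (apply Rmult_le_compat_r; lra).
      lra. }
    eapply Rle_trans; [|exact Hm2]. apply Rplus_le_compat; apply Hsq.
    - generalize (M1 a t ltac:(lra)) (M1 t b ltac:(lra)); lra.
    - generalize (M2 a t ltac:(lra)) (M2 t b ltac:(lra)); lra. }
  assert (HP5 := Cmod_poch5_le t b P ltac:(lra) HP HP2).
  assert (Hrem : EMh t n <= P * (246 / 5400000) * w / n ^ 4).
  { unfold EMh, EMc. assert (0 < / n ^ 4) by (apply Rinv_0_lt_compat, pow_lt; lra).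
    assert (0 < / sqrt n) by (apply Rinv_0_lt_compat, sqrt_lt_R0; lra).
    assert (0 <= Cmod (poch5 t)) by apply Cmod_ge_0.
    replace (Cmod (poch5 t) * (246 / 1200000) / (9 / 2) * (/ n ^ 4 * / sqrt n)) with
      (246 / 5400000 * / n ^ 4 * (Cmod (poch5 t) * / sqrt n)).
    2:{ field. split; [apply Rgt_not_eq, sqrt_lt_R0; lra|lra]. }
    replace (P * (246 / 5400000) * w / n ^ 4) with (246 / 5400000 * / n ^ 4 * (P * w)) by (field; lra).
    apply Rmult_le_compat_l; [lra|]. apply Rmult_le_compat; lra. }
  assert (Cmod z <= Cmod (A5 t (Datatypes.S N)) + EMh t n).
  { replace z with (Cplus (A5 t (Datatypes.S N)) (Cminus z (A5 t (Datatypes.S N)))) at 1 by ring.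
    eapply Rle_trans; [apply Cmod_triangle|]. lra. }
  rewrite EA in H.
  assert (HA : Cmod (Cplus (Dsum t N) (Cmult (pw t n) (Cplus (RtoC (1 / 2)) (EMmain t n)))) <= S + w * m).
  { eapply Rle_trans; [apply Cmod_triangle|]. apply Rplus_le_compat; [exact HD|].
    rewrite Cmod_mult, Cmod_pw by lra.
    apply Rmult_le_compat; [apply Rlt_le, Rinv_0_lt_compat, sqrt_lt_R0; lra|apply Cmod_ge_0|exact Hw1|exact Hmain]. }
  lra.
Qed.

(** The bounds of [pi] enclose [y = t / (2 pi N)] in [[y1, y2]], and each error sum is monotone in
    [y]. In the high sum the nearest term is kept exactly and the rest is bounded by [high_tail];
    [q] and [w] are rational majorants of [sqrt N] and [1 / sqrt N]. *)
Lemma functional_equation_interval t z (N k : nat) (a b q w y1 y2 D low : R) :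
  is_zeta_conj t z -> 1 <= a -> a <= t <= b -> (1 <= N)%nat ->
  0 <= q -> INR N <= q ^ 2 -> 0 <= w -> 1 <= INR N * w ^ 2 ->
  1 / 2 <= y1 -> INR k < y1 -> y2 < INR k + 1 ->
  2 * (31416 / 10000) * INR N * y1 <= a -> b <= 2 * (31415 / 10000) * INR N * y2 ->
  Cmod (Dsum t k) <= D -> rsum (fun j => / (y1 - INR (S j))) k <= low ->
  Cmod z <= 2 * q - 1449 / 1000 + q / a + D + w / (31415 / 10000) *
    (1 + low + (1 + 1 / (8 * a)) *
     (y2 * (2 / ((INR k + 1) ^ 2 - y2 ^ 2) + (2 * INR k + 5) / ((INR k + 2) ^ 2 - y2 ^ 2)))).
Proof.
  intros Hz Ha Ht HN Hq0 Hq Hw0 Hw Hy1 Hky1 Hky2 HA HB HD Hlow.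
  assert (Hpi := PI_bounds). assert (Hk0 := pos_INR k).
  assert (HN1 : 1 <= INR N) by (apply (le_INR 1); lia).
  set (y := t / (2 * PI * INR N)).
  assert (HP : 0 < 2 * PI * INR N) by nra.
  assert (Hty : t = 2 * PI * INR N * y) by (unfold y; field; lra).
  assert (Y1 : y1 <= y).
  { apply (Rmult_le_reg_l (2 * PI * INR N)); [lra|]. rewrite <- Hty.
    apply Rle_trans with a; [|lra]. eapply Rle_trans; [|exact HA].
    apply Rmult_le_compat_r; [lra|]. apply Rmult_le_compat_r; lra. }
  assert (Hy2 : 0 < y2).
  { apply (Rmult_lt_reg_l (2 * (31415 / 10000) * INR N)); lra. }
  assert (Y2 : y <= y2).
  { apply (Rmult_le_reg_l (2 * PI * INR N)); [lra|]. rewrite <- Hty.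
    apply Rle_trans with b; [lra|]. eapply Rle_trans; [exact HB|].
    apply Rmult_le_compat_r; [lra|]. apply Rmult_le_compat_r; lra. }
  set (U := y2 * (2 / ((INR k + 1) ^ 2 - y2 ^ 2) + (2 * INR k + 5) / ((INR k + 2) ^ 2 - y2 ^ 2))).
  assert (D1 : 0 < (INR k + 1) ^ 2 - y2 ^ 2).
  { replace ((INR k + 1) ^ 2 - y2 ^ 2) with ((INR k + 1 - y2) * (INR k + 1 + y2)) by ring.
    apply Rmult_lt_0_compat; lra. }
  assert (D2 : 0 < (INR k + 2) ^ 2 - y2 ^ 2).
  { replace ((INR k + 2) ^ 2 - y2 ^ 2) with ((INR k + 2 - y2) * (INR k + 2 + y2)) by ring.
    apply Rmult_lt_0_compat; lra. }
  assert (Hyy : y ^ 2 <= y2 ^ 2) by (apply pow_incr; lra).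
  assert (HU : forall m, y * rsum (fun j => 2 / (INR (S (k + j)) ^ 2 - y ^ 2)) m <= U).
  { intros m.
    assert (HT : rsum (fun j => 2 / (INR (S (k + j)) ^ 2 - y ^ 2)) m <=
      2 / ((INR k + 1) ^ 2 - y ^ 2) + (2 * INR k + 5) / ((INR k + 2) ^ 2 - y ^ 2)).
    { assert (0 < 2 / ((INR k + 1) ^ 2 - y ^ 2)) by (apply Rdiv_lt_0_compat; lra).
      assert (0 < (2 * INR k + 5) / ((INR k + 2) ^ 2 - y ^ 2)) by (apply Rdiv_lt_0_compat; lra).
      destruct m as [|m]; [simpl rsum; lra|].
      replace (S m) with (1 + m)%nat by lia. rewrite rsum_app. apply Rplus_le_compat.
      - change (rsum ?f 1) with (0 + f 0%nat). cbv beta. rewrite Nat.add_0_r, S_INR. lra.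
      - assert (E2 : INR (k + 2) = INR k + 2) by (rewrite plus_INR; simpl (INR 2); ring).
        assert (T := high_tail y (k + 2) m ltac:(rewrite E2; lra)). rewrite E2 in T.
        rewrite (rsum_ext _ (fun j => 2 / (INR (k + 2 + j) ^ 2 - y ^ 2))).
        + eapply Rle_trans; [exact T|]. apply Req_le. f_equal. ring.
        + intros j _. do 4 f_equal. lia. }
    assert (0 <= rsum (fun j => 2 / (INR (S (k + j)) ^ 2 - y ^ 2)) m).
    { apply rsum_nonneg; intros j _. apply Rlt_le, Rdiv_lt_0_compat; [lra|].
      assert (INR k + 1 <= INR (S (k + j))) by (rewrite <- S_INR; apply le_INR; lia). nra. }
    unfold U. apply Rmult_le_compat; [lra|lra|lra|].
    eapply Rle_trans; [exact HT|]. apply Rplus_le_compat.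
    - apply Rmult_le_compat_l; [lra|]. apply Rinv_le_contravar; lra.
    - apply Rmult_le_compat_l; [lra|]. apply Rinv_le_contravar; lra. }
  assert (A := functional_equation_explicit t z N k y U Hz ltac:(lra) HN Hty ltac:(lra) HU).
  assert (HU0 : 0 <= U).
  { specialize (HU 0%nat). simpl rsum in HU. lra. }
  assert (B := Dhalf_trivial t N HN).
  set (n := sqrt (INR N)) in *.
  assert (Hn0 : 0 < n) by (apply sqrt_lt_R0; lra).
  assert (En : n * n = INR N) by (apply sqrt_sqrt; lra).
  assert (Hnq : n <= q) by (apply Rsqr_incr_0_var; [|lra]; unfold Rsqr; lra).
  assert (Hnw : / n <= w).
  { apply (Rmult_le_reg_r n); [lra|]. rewrite Rinv_l by lra.
    apply Rsqr_incr_0_var; [|apply Rmult_le_pos; lra]. unfold Rsqr.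
    replace (w * n * (w * n)) with ((n * n) * w ^ 2) by ring. rewrite En. lra. }
  assert (F1 : n / t <= q / a).
  { apply Rmult_le_compat; [lra|apply Rlt_le, Rinv_0_lt_compat; lra|lra|apply Rinv_le_contravar; lra]. }
  assert (F2 : rsum (fun j => / (y - INR (S j))) k <= low).
  { eapply Rle_trans; [|exact Hlow]. apply rsum_le; intros j Hj.
    assert (INR (S j) <= INR k) by (apply le_INR; lia). apply Rinv_le_contravar; lra. }
  assert (F3 : (1 + 1 / (8 * t)) * U <= (1 + 1 / (8 * a)) * U).
  { apply Rmult_le_compat_r; [lra|]. apply Rplus_le_compat_l. unfold Rdiv.
    apply Rmult_le_compat_l; [lra|]. apply Rinv_le_contravar; lra. }
  assert (F4 : / (PI * n) <= w / (31415 / 10000)).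
  { rewrite Rinv_mult. unfold Rdiv. rewrite Rmult_comm.
    apply Rmult_le_compat; [apply Rlt_le, Rinv_0_lt_compat; lra|apply Rlt_le, Rinv_0_lt_compat; lra|exact Hnw|].
    apply Rinv_le_contravar; lra. }
  assert (0 <= rsum (fun j => / (y - INR (S j))) k).
  { apply rsum_nonneg; intros j Hj. assert (INR (S j) <= INR k) by (apply le_INR; lia).
    apply Rlt_le, Rinv_0_lt_compat; lra. }
  assert (0 <= (1 + 1 / (8 * t)) * U).
  { apply Rmult_le_pos; [|lra]. assert (0 < 1 / (8 * t)) by (apply Rdiv_lt_0_compat; lra). lra. }
  assert (F5 : / (PI * n) * (1 + rsum (fun j => / (y - INR (S j))) k + (1 + 1 / (8 * t)) * U) <=
     w / (31415 / 10000) * (1 + low + (1 + 1 / (8 * a)) * U)).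
  { apply Rmult_le_compat; [apply Rlt_le, Rinv_0_lt_compat; nra|lra|exact F4|lra]. }
  fold U. lra.
Qed.

(** * The range [2 <= t <= 450] *)

Lemma inv_sqrt_le x w : 0 < x -> 0 <= w -> 1 <= x * w ^ 2 -> / sqrt x <= w.
Proof.
  intros Hx Hw H. assert (Hs : 0 < sqrt x) by (apply sqrt_lt_R0; lra).
  apply (Rmult_le_reg_r (sqrt x)); [lra|]. rewrite Rinv_l by lra.
  apply Rsqr_incr_0_var; [|apply Rmult_le_pos; lra]. unfold Rsqr.
  replace (w * sqrt x * (w * sqrt x)) with (sqrt x * sqrt x * w ^ 2) by ring. rewrite sqrt_sqrt; lra.
Qed.

Lemma sum_inv_sqrt_step N S w :
  rsum (fun j => / sqrt (INR (Datatypes.S j))) N <= S -> 0 <= w -> 1 <= INR (Datatypes.S N) * w ^ 2 ->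
  rsum (fun j => / sqrt (INR (Datatypes.S j))) (Datatypes.S N) <= S + w.
Proof.
  intros H Hw H1. rewrite rsum_S. apply Rplus_le_compat; [exact H|].
  apply inv_sqrt_le; auto. apply INR_S_pos.
Qed.

Lemma sum_inv_sqrt_0 : rsum (fun j => / sqrt (INR (S j))) 0 <= 0.
Proof. simpl; lra. Qed.

Lemma sum_inv_sqrt_1 : rsum (fun j => / sqrt (INR (S j))) 1 <= 1.
Proof.
  eapply Rle_trans; [apply (sum_inv_sqrt_step _ _ (1) sum_inv_sqrt_0); simpl INR; lra|lra].
Qed.

Lemma sum_inv_sqrt_2 : rsum (fun j => / sqrt (INR (S j))) 2 <= 170711 / 100000.
Proof.
  eapply Rle_trans; [apply (sum_inv_sqrt_step _ _ (70711 / 100000) sum_inv_sqrt_1); simpl INR; lra|lra].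
Qed.

Lemma sum_inv_sqrt_3 : rsum (fun j => / sqrt (INR (S j))) 3 <= 228447 / 100000.
Proof.
  eapply Rle_trans; [apply (sum_inv_sqrt_step _ _ (7217 / 12500) sum_inv_sqrt_2); simpl INR; lra|lra].
Qed.

Lemma sum_inv_sqrt_4 : rsum (fun j => / sqrt (INR (S j))) 4 <= 278447 / 100000.
Proof.
  eapply Rle_trans; [apply (sum_inv_sqrt_step _ _ (1 / 2) sum_inv_sqrt_3); simpl INR; lra|lra].
Qed.

Lemma sum_inv_sqrt_5 : rsum (fun j => / sqrt (INR (S j))) 5 <= 323169 / 100000.
Proof.
  eapply Rle_trans; [apply (sum_inv_sqrt_step _ _ (22361 / 50000) sum_inv_sqrt_4); simpl INR; lra|lra].
Qed.

Lemma sum_inv_sqrt_6 : rsum (fun j => / sqrt (INR (S j))) 6 <= 181997 / 50000.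
Proof.
  eapply Rle_trans; [apply (sum_inv_sqrt_step _ _ (1633 / 4000) sum_inv_sqrt_5); simpl INR; lra|lra].
Qed.

(** Reduces an interval to inequalities between numerals. The last four arguments are the witnesses
    of [zbound_lower]: [a = 2^k (1 + zz) / (1 - zz)], [c] a lower bound of the sixth root of [a],
    and [l] one of [ln a]. *)
Ltac em_case N n HS a b S w R I m P k zz c l :=
  intros z t Ht Hz;
  let H := fresh "H" in
  assert (H := fun Hz => euler_maclaurin_interval t z N a b S w R I m P Hz ltac:(lra) Ht); cbv zeta in H;
  replace (INR (Datatypes.S N)) with (IZR n) in H by (simpl; lra);
  specialize (H Hz HS ltac:(lra) ltac:(lra) ltac:(lra) ltac:(lra) ltac:(lra) ltac:(lra)
    ltac:(lra) ltac:(lra) ltac:(lra) ltac:(lra));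
  eapply Rle_trans; [exact H|];
  apply (zbound_lower k a zz c l t); simpl INR; lra.

Ltac afe_case N k a b q w y1 y2 D low HD kk zz c l :=
  intros z t Ht Hz;
  let H := fresh "H" in
  assert (H := functional_equation_interval t z N k a b q w y1 y2 D low Hz ltac:(lra) Ht ltac:(lia) ltac:(lra)
    ltac:(simpl; lra) ltac:(lra) ltac:(simpl; lra) ltac:(lra) ltac:(simpl; lra) ltac:(simpl; lra)
    ltac:(simpl; lra) ltac:(simpl; lra) (HD t) ltac:(simpl; lra));
  eapply Rle_trans; [exact H|];
  apply (zbound_lower kk a zz c l t); simpl INR; lra.

Lemma Dsum_1 t : Cmod (Dsum t 1) <= 1.
Proof.
  eapply Rle_trans; [apply Cmod_csum|]. eapply Rle_trans; [|exact sum_inv_sqrt_1].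
  apply rsum_le; intros k _. rewrite Cmod_pw by apply INR_S_pos. lra.
Qed.

Lemma Dsum_2 t : Cmod (Dsum t 2) <= 170711 / 100000.
Proof.
  eapply Rle_trans; [apply Cmod_csum|]. eapply Rle_trans; [|exact sum_inv_sqrt_2].
  apply rsum_le; intros k _. rewrite Cmod_pw by apply INR_S_pos. lra.
Qed.

(** * Euler-Maclaurin intervals, with [n] from 1 to 7 *)

Lemma zeta_em_0 : forall z t, (2) <= t <= (2091 / 1000) -> is_zeta_conj t z -> Cmod z <= zbound t.
Proof.
  em_case 0%nat 1%Z sum_inv_sqrt_0 (2) (2091 / 1000) (0) (1) (22911 / 50000) (30879 / 100000) (6907 / 12500) (364797 / 1000) 1%nat (0) (56123 / 50000) (693 / 1000).
Qed.

Lemma zeta_em_1 : forall z t, (2091 / 1000) <= t <= (2581 / 1000) -> is_zeta_conj t z -> Cmod z <= zbound t.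
Proof.
  em_case 0%nat 1%Z sum_inv_sqrt_0 (2091 / 1000) (2581 / 1000) (0) (1) (12709 / 25000) (28213 / 100000) (58141 / 100000) (636191 / 1000) 1%nat (91 / 4091) (113081 / 100000) (73749 / 100000).
Qed.

Lemma zeta_em_2 : forall z t, (2581 / 1000) <= t <= (4291 / 1000) -> is_zeta_conj t z -> Cmod z <= zbound t.
Proof.
  em_case 0%nat 1%Z sum_inv_sqrt_0 (2581 / 1000) (4291 / 1000) (0) (1) (3921 / 6250) (20313 / 100000) (65943 / 100000) (134311 / 40) 1%nat (581 / 4581) (732 / 625) (94801 / 100000).
Qed.

Lemma zeta_em_3 : forall z t, (4291 / 1000) <= t <= (1427 / 250) -> is_zeta_conj t z -> Cmod z <= zbound t.
Proof.
  em_case 0%nat 1%Z sum_inv_sqrt_0 (4291 / 1000) (1427 / 250) (0) (1) (72747 / 100000) (51453 / 100000) (17821 / 20000) (10255461 / 1000) 2%nat (291 / 8291) (5099 / 4000) (72811 / 50000).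
Qed.

Lemma zeta_em_4 : forall z t, (1427 / 250) <= t <= (4889 / 500) -> is_zeta_conj t z -> Cmod z <= zbound t.
Proof.
  em_case 1%nat 2%Z sum_inv_sqrt_1 (1427 / 250) (4889 / 500) (1) (70711 / 100000) (29239 / 50000) (8899 / 25000) (3423 / 5000) (54636467 / 500) 2%nat (427 / 2427) (33421 / 25000) (3483 / 2000).
Qed.

Lemma zeta_em_5 : forall z t, (4889 / 500) <= t <= (1947 / 125) -> is_zeta_conj t z -> Cmod z <= zbound t.
Proof.
  em_case 2%nat 3%Z sum_inv_sqrt_2 (4889 / 500) (1947 / 125) (170711 / 100000) (7217 / 12500) (28189 / 50000) (8601 / 20000) (17727 / 25000) (995715461 / 1000) 3%nat (889 / 8889) (146231 / 100000) (7124 / 3125).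
Qed.

Lemma zeta_em_6 : forall z t, (1947 / 125) <= t <= (22277 / 1000) -> is_zeta_conj t z -> Cmod z <= zbound t.
Proof.
  em_case 3%nat 4%Z sum_inv_sqrt_3 (1947 / 125) (22277 / 1000) (228447 / 100000) (1 / 2) (27741 / 50000) (26089 / 50000) (76163 / 100000) (28578708 / 5) 3%nat (947 / 2947) (158031 / 100000) (13719 / 5000).
Qed.

Lemma zeta_em_7 : forall z t, (22277 / 1000) <= t <= (14643 / 500) -> is_zeta_conj t z -> Cmod z <= zbound t.
Proof.
  em_case 5%nat 6%Z sum_inv_sqrt_5 (22277 / 1000) (14643 / 500) (323169 / 100000) (1633 / 4000) (26413 / 50000) (9059 / 25000) (3203 / 5000) (4412513573 / 200) 4%nat (6277 / 38277) (83871 / 50000) (310291 / 100000).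
Qed.

Lemma zeta_em_8 : forall z t, (14643 / 500) <= t <= (18017 / 500) -> is_zeta_conj t z -> Cmod z <= zbound t.
Proof.
  em_case 6%nat 7%Z sum_inv_sqrt_6 (14643 / 500) (18017 / 500) (181997 / 50000) (37797 / 100000) (52691 / 100000) (21169 / 50000) (33797 / 50000) (61719482091 / 1000) 4%nat (6643 / 22643) (175567 / 100000) (337559 / 100000).
Qed.

(** * Intervals treated by the approximate functional equation, with one or two dual terms *)

Lemma zeta_afe_0 : forall z t, (36) <= t <= (321 / 8) -> is_zeta_conj t z -> Cmod z <= zbound t.
Proof.
  afe_case 4%nat 1%nat (36) (321 / 8) (200001 / 100000) (1 / 2) (143239 / 100000) (79829 / 50000) (1) (231273 / 100000) Dsum_1 5%nat (1 / 17) (11357 / 6250) (179139 / 50000).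
Qed.

Lemma zeta_afe_1 : forall z t, (321 / 8) <= t <= (177 / 4) -> is_zeta_conj t z -> Cmod z <= zbound t.
Proof.
  afe_case 4%nat 1%nat (321 / 8) (177 / 4) (200001 / 100000) (1 / 2) (159651 / 100000) (176071 / 100000) (1) (83821 / 50000) Dsum_1 5%nat (65 / 577) (185027 / 100000) (2953 / 800).
Qed.

Lemma zeta_afe_2 : forall z t, (177 / 4) <= t <= (209 / 4) -> is_zeta_conj t z -> Cmod z <= zbound t.
Proof.
  afe_case 5%nat 1%nat (177 / 4) (209 / 4) (223607 / 100000) (22361 / 50000) (140851 / 100000) (83161 / 50000) (1) (244793 / 100000) Dsum_1 5%nat (49 / 305) (188069 / 100000) (378907 / 100000).
Qed.

Lemma zeta_afe_3 : forall z t, (209 / 4) <= t <= (509 / 8) -> is_zeta_conj t z -> Cmod z <= zbound t.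
Proof.
  afe_case 6%nat 1%nat (209 / 4) (509 / 8) (244949 / 100000) (1633 / 4000) (138597 / 100000) (21097 / 12500) (1) (16193 / 6250) Dsum_1 5%nat (81 / 337) (193351 / 100000) (49437 / 12500).
Qed.

Lemma zeta_afe_4 : forall z t, (509 / 8) <= t <= (629 / 8) -> is_zeta_conj t z -> Cmod z <= zbound t.
Proof.
  afe_case 7%nat 1%nat (509 / 8) (629 / 8) (8268 / 3125) (37797 / 100000) (7233 / 5000) (178771 / 100000) (1) (44783 / 20000) Dsum_1 5%nat (253 / 765) (49951 / 25000) (83011 / 20000).
Qed.

Lemma zeta_afe_5 : forall z t, (629 / 8) <= t <= (797 / 8) -> is_zeta_conj t z -> Cmod z <= zbound t.
Proof.
  afe_case 9%nat 1%nat (629 / 8) (797 / 8) (300001 / 100000) (16667 / 50000) (139039 / 100000) (176181 / 100000) (1) (51231 / 20000) Dsum_1 6%nat (117 / 1141) (206979 / 100000) (21819 / 5000).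
Qed.

Lemma zeta_afe_6 : forall z t, (797 / 8) <= t <= (1005 / 8) -> is_zeta_conj t z -> Cmod z <= zbound t.
Proof.
  afe_case 11%nat 1%nat (797 / 8) (1005 / 8) (331663 / 100000) (3769 / 12500) (144143 / 100000) (22721 / 12500) (1) (226537 / 100000) Dsum_1 6%nat (285 / 1309) (53827 / 25000) (14376 / 3125).
Qed.

Lemma zeta_afe_7 : forall z t, (1005 / 8) <= t <= (1281 / 8) -> is_zeta_conj t z -> Cmod z <= zbound t.
Proof.
  afe_case 9%nat 2%nat (1005 / 8) (1281 / 8) (300001 / 100000) (16667 / 50000) (222153 / 100000) (70793 / 25000) (170711 / 100000) (533271 / 100000) Dsum_2 6%nat (493 / 1517) (13987 / 6250) (120771 / 25000).
Qed.

Lemma zeta_afe_8 : forall z t, (1281 / 8) <= t <= (1621 / 8) -> is_zeta_conj t z -> Cmod z <= zbound t.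
Proof.
  afe_case 12%nat 2%nat (1281 / 8) (1621 / 8) (346411 / 100000) (7217 / 25000) (212371 / 100000) (67187 / 25000) (170711 / 100000) (448667 / 50000) Dsum_2 7%nat (257 / 2305) (58257 / 25000) (507491 / 100000).
Qed.

Lemma zeta_afe_9 : forall z t, (1621 / 8) <= t <= (531 / 2) -> is_zeta_conj t z -> Cmod z <= zbound t.
Proof.
  afe_case 15%nat 2%nat (1621 / 8) (531 / 2) (387299 / 100000) (1291 / 5000) (214991 / 100000) (281713 / 100000) (170711 / 100000) (754031 / 100000) Dsum_2 7%nat (597 / 2645) (242353 / 100000) (16594 / 3125).
Qed.

Lemma zeta_afe_10 : forall z t, (531 / 2) <= t <= (345) -> is_zeta_conj t z -> Cmod z <= zbound t.
Proof.
  afe_case 19%nat 2%nat (531 / 2) (345) (43589 / 10000) (11471 / 50000) (222397 / 100000) (289001 / 100000) (170711 / 100000) (52819 / 10000) Dsum_2 8%nat (19 / 1043) (253519 / 100000) (558043 / 100000).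
Qed.

Lemma zeta_afe_11 : forall z t, (345) <= t <= (3577 / 8) -> is_zeta_conj t z -> Cmod z <= zbound t.
Proof.
  afe_case 25%nat 2%nat (345) (3577 / 8) (500001 / 100000) (1 / 5) (219633 / 100000) (142329 / 50000) (170711 / 100000) (74117 / 12500) Dsum_2 8%nat (89 / 601) (264831 / 100000) (584233 / 100000).
Qed.

Lemma zeta_afe_12 : forall z t, (3577 / 8) <= t <= (450) -> is_zeta_conj t z -> Cmod z <= zbound t.
Proof.
  afe_case 31%nat 2%nat (3577 / 8) (450) (556777 / 100000) (17961 / 100000) (114777 / 50000) (231039 / 100000) (170711 / 100000) (12986 / 3125) Dsum_2 8%nat (1529 / 5625) (276527 / 100000) (610103 / 100000).
Qed.

Lemma zeta_small z t : 2 <= t <= 450 -> is_zeta_conj t z -> Cmod z <= zbound t.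
Proof.
  intros Ht Hz.
  destruct (Rle_dec t (2091 / 1000)) as [?|?]; [apply zeta_em_0; [lra|exact Hz]|].
  destruct (Rle_dec t (2581 / 1000)) as [?|?]; [apply zeta_em_1; [lra|exact Hz]|].
  destruct (Rle_dec t (4291 / 1000)) as [?|?]; [apply zeta_em_2; [lra|exact Hz]|].
  destruct (Rle_dec t (1427 / 250)) as [?|?]; [apply zeta_em_3; [lra|exact Hz]|].
  destruct (Rle_dec t (4889 / 500)) as [?|?]; [apply zeta_em_4; [lra|exact Hz]|].
  destruct (Rle_dec t (1947 / 125)) as [?|?]; [apply zeta_em_5; [lra|exact Hz]|].
  destruct (Rle_dec t (22277 / 1000)) as [?|?]; [apply zeta_em_6; [lra|exact Hz]|].
  destruct (Rle_dec t (14643 / 500)) as [?|?]; [apply zeta_em_7; [lra|exact Hz]|].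
  destruct (Rle_dec t (18017 / 500)) as [?|?]; [apply zeta_em_8; [lra|exact Hz]|].
  destruct (Rle_dec t (321 / 8)) as [?|?]; [apply zeta_afe_0; [lra|exact Hz]|].
  destruct (Rle_dec t (177 / 4)) as [?|?]; [apply zeta_afe_1; [lra|exact Hz]|].
  destruct (Rle_dec t (209 / 4)) as [?|?]; [apply zeta_afe_2; [lra|exact Hz]|].
  destruct (Rle_dec t (509 / 8)) as [?|?]; [apply zeta_afe_3; [lra|exact Hz]|].
  destruct (Rle_dec t (629 / 8)) as [?|?]; [apply zeta_afe_4; [lra|exact Hz]|].
  destruct (Rle_dec t (797 / 8)) as [?|?]; [apply zeta_afe_5; [lra|exact Hz]|].
  destruct (Rle_dec t (1005 / 8)) as [?|?]; [apply zeta_afe_6; [lra|exact Hz]|].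
  destruct (Rle_dec t (1281 / 8)) as [?|?]; [apply zeta_afe_7; [lra|exact Hz]|].
  destruct (Rle_dec t (1621 / 8)) as [?|?]; [apply zeta_afe_8; [lra|exact Hz]|].
  destruct (Rle_dec t (531 / 2)) as [?|?]; [apply zeta_afe_9; [lra|exact Hz]|].
  destruct (Rle_dec t (345)) as [?|?]; [apply zeta_afe_10; [lra|exact Hz]|].
  destruct (Rle_dec t (3577 / 8)) as [?|?]; [apply zeta_afe_11; [lra|exact Hz]|].
  apply zeta_afe_12; [lra|exact Hz].
Qed.

Lemma Cmod_zeta_le t z : 2 <= t -> is_zeta_conj t z -> Cmod z <= zbound t.
Proof.
  intros Ht Hz. destruct (Rle_dec t 450) as [H|H]; [apply zeta_small; [lra|exact Hz]|].
  unfold zbound. set (s := Rpower t (1 / 6)).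
  assert (Hs : 0 < s) by apply exp_pos.
  assert (Es : s ^ 6 = t).
  { unfold s. rewrite <- Rpower_pow, Rpower_mult by apply exp_pos.
    replace (1 / 6 * INR 6) with 1 by (simpl; field). apply Rpower_1; lra. }
  assert (El : ln t = 6 * ln s) by (unfold s, Rpower; rewrite ln_exp; field).
  (* [4.392 = 6 * 0.732], the 6 coming from [ln t = 6 ln s]. *)
  replace (732 / 1000 * s * ln t) with (4392 / 1000 * s * ln s) by (rewrite El; field).
  rewrite <- Es in Hz.
  destruct (Rle_dec s (316 / 10)) as [H1|H1].
  - apply zeta_mid; try assumption. rewrite Es; lra.
  - apply zeta_large; [lra|exact Hz].
Qed.

Theorem theorem1 : forall t : R, 2 <= t ->
  exists z : R, is_abs_zeta_half t z /\
    z <= 732 / 1000 * Rpower t (1 / 6) * ln t.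
Proof.
  intros t Ht. apply abs_zeta_half_le. intros z Hz. exact (Cmod_zeta_le t z Ht Hz).
Qed.
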